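(* Let $\mathcal H_t^{\mathrm{glob}}$, $t>0$, be the global part of the Ornstein--Uhlenbeck semigroup on $\mathbb R^n$ determined by $Q$ and $B$, defined with a localization parameter $A$ that is sufficiently large depending only on $n,Q,B$. For all $\varrho\ge1$ and all $1<p<\infty$ there is a constant $C<\infty$, depending only on $n,Q,B,p$ (and the fixed $A$), such that for all $f\in L^p(\gamma_\infty)$ $$J_\varrho^p\big(\mathcal H_t^{\mathrm{glob}}f:\ t\in(0,1]\big)\le C\,\|f\|_{L^p(\gamma_\infty)} .$$
   Context: Fix $n\ge 1$, a real symmetric positive definite $n\times n$ matrix $Q$, and a real $n\times n$ matrix $B$ all of whose eigenvalues have negative real parts. For $t\in(0,+\infty]$ let $Q_t=\int_0^t e^{sB}Qe^{sB^*}\,ds$ and let $\gamma_t$ be the Gaussian probability measure $d\gamma_t(x)=(2\pi)^{-n/2}(\det Q_t)^{-1/2}e^{-\frac12\langle Q_t^{-1}x,x\rangle}\,dx$. The Ornstein--Uhlenbeck semigroup is $\mathcal H_t f(x)=\int_{\mathbb R^n} f(e^{tB}x-y)\,d\gamma_t(y)$ for $t>0$, $x\in\mathbb R^n$, $f\in L^1(\gamma_\infty)$; $\gamma_\infty$ is its invariant measure. Localization. Let $A>4$ be a fixed large constant (depending only on $n,Q,B$). Let $(B_j)_{j\ge0}$ be a family of closed balls $B_j=B(x_j,A/(1+|x_j|))$ with pairwise disjoint interiors, maximal with respect to this property, with $B_0=B(0,A)$ (so $x_0=0$). For $s>0$, $sB_j=B(x_j,sA/(1+|x_j|))$; the balls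 $3B_j$ cover $\mathbb R^n$ and the balls $6B_j$ have bounded overlap. Let $r_j$, $j\ge 0$, be smooth nonnegative functions with $\sum_j r_j=1$ on $\mathbb R^n$, $r_j$ supported in $4B_j$, and $r_0=1$ in $\frac12B_0$ (so $r_j=0$ in $\frac12B_0$ for $j>0$). Let $\widetilde r_j$ be smooth functions with values in $[0,1]$, supported in $6B_j$ and equal to $1$ in $5B_j$. Assume $|\nabla r_j(x)|,|\nabla\widetilde r_j(x)|\le C(1+|x|)$ with $C$ independent of $j$. Define $$\mathcal H_t^{\mathrm{loc}}f(x)=\sum_{j=0}^\infty\widetilde r_j(x)\,\mathcal H_t(fr_j)(x),\qquad \mathcal H_t^{\mathrm{glob}}=\mathcal H_t-\mathcal H_t^{\mathrm{loc}} .$$ Jumps. For an interval $\mathcal I\subset(0,\infty)$, $\lambda>0$, and $T_t=\mathcal H_t^{\mathrm{glob}}$, let $N_\lambda(T_tf(x):t\in\mathcal I)$ be the supremum of all $N\in\{1,2,\dots\}$ for which there exist $t_0<t_1<\dots<t_N$ in $\mathcal I$ with $|T_{t_i}f(x)-T_{t_{i-1}}f(x)|>\lambda$ for $i=1,\dots,N$ (and $0$ if there is no such $N$), and $$J_\varrho^p(T_tf:t\in\mathcal I)=\sup_{\lambda>0}\big\|\lambda\big(N_\lambda(T_tf(\cdot):t\in\mathcal I)\big)^{1/\varrho}\big\|_{L^p(\gamma_\infty)},\qquad 1\le p,\varrho<\infty .$$ *)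

(* Defs.v *)
From HB Require Import structures.
From mathcomp Require Import all_boot all_order all_algebra.
From mathcomp Require Import complex.
From mathcomp Require Import all_classical all_reals all_analysis.
From mathcomp Require Import measurable_realfun.

Set Implicit Arguments.
Unset Strict Implicit.
Unset Printing Implicit Defensive.

Import Order.TTheory GRing.Theory Num.Theory.
Import numFieldTopology.Exports numFieldNormedType.Exports.

Local Open Scope classical_set_scope.
Local Open Scope ring_scope.

(* Vectors of R^n are columns. The sigma-algebra on 'cV[R]_n is the one
   generated by the coordinates, as the library does for n.-tuple; for R^n it is
   the Borel one. *)
Definition measure_cV_display : measure_display -> measure_display.
Proof. exact. Qed.

Section measurable_cV.
Context {d} {T : measurableType d}.
Variable n : nat.

Let coors : 'I_n -> 'cV[T]_n -> T := fun i x => x i ord0.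

Let cV_set0 : g_sigma_preimage coors set0.
Proof. exact: sigma_algebra0. Qed.

Let cV_setC A : g_sigma_preimage coors A -> g_sigma_preimage coors (~` A).
Proof. exact: sigma_algebraC. Qed.

Let cV_bigcup (F : _^nat) : (forall i, g_sigma_preimage coors (F i)) ->
  g_sigma_preimage coors (\bigcup_i (F i)).
Proof. exact: sigma_algebra_bigcup. Qed.

HB.instance Definition _ := @isMeasurable.Build (measure_cV_display d)
  'cV[T]_n (g_sigma_preimage coors) cV_set0 cV_setC cV_bigcup.

End measurable_cV.

Section measurable_cV_theory.
Context {d1 d2} {T1 : measurableType d1} {T2 : measurableType d2}.

Lemma measurable_cV_coord n (i : 'I_n) :
  measurable_fun [set: 'cV[T2]_n] (fun x => x i ord0).
Proof.
move=> _ Y mY; rewrite setTI; apply: sub_sigma_algebra => /=.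
rewrite -bigcup_seq/=; exists i => /=; first by rewrite mem_index_enum.
by exists Y => //; rewrite setTI.
Qed.

Lemma measurable_fun_cV n (f : T1 -> 'cV[T2]_n) :
  (forall i, measurable_fun [set: T1] (fun x => f x i ord0)) ->
  measurable_fun [set: T1] f.
Proof.
move=> mf _ A mA; rewrite setTI.
suff: (<<s \big[setU/set0]_(i < n) preimage_set_system [set: 'cV[T2]_n]
         (fun x : 'cV[T2]_n => x i ord0) measurable >>)
      `<=` image_set_system [set: T1] f measurable.
  by move=> /(_ _ mA); rewrite /image_set_system/= setTI.
apply: smallest_sub.
  exact/sigma_algebra_image/sigma_algebra_measurable.
move=> B; rewrite -bigcup_seq => -[i _ [C mC <-]].
rewrite /image_set_system/= !setTI.
by have := mf i measurableT _ mC; rewrite setTI.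
Qed.

End measurable_cV_theory.

Section lebesgue_cV.
Context {R : realType}.

Definition cons_cV n (p : 'cV[R]_n * R) : 'cV[R]_n.+1 := col_mx (p.2)%:M p.1.

Lemma measurable_cons_cV n : measurable_fun setT (@cons_cV n).
Proof.
apply: measurable_fun_cV => i.
have [->|[j ->]] : i = lshift n (ord0 : 'I_1) \/ exists j, i = rshift 1 j.
  by case: (split_ordP (i : 'I_(1 + n))) => j ->;
    [left; rewrite ord1|right; exists j].
- have -> : (fun p => cons_cV p (lshift n (ord0 : 'I_1)) ord0) =
            (snd : 'cV[R]_n * R -> R).
    apply/funext => p; rewrite /cons_cV (col_mxEu ((p.2)%:M : 'M[R]_1) p.1).
    by rewrite mxE eqxx mulr1n.
  exact: measurable_snd.
- have -> : (fun p => cons_cV p (rshift 1 j) ord0) =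
            (fun y : 'cV[R]_n => y j ord0) \o fst.
    by apply/funext => p; rewrite /cons_cV (col_mxEd ((p.2)%:M : 'M[R]_1) p.1).
  by apply: (measurableT_comp (measurable_cV_coord j)); exact: measurable_fst.
Qed.

Section cons_measure.
Variables (n : nat) (mu : {measure set 'cV[R]_n -> \bar R}).

Definition cons_measure : set 'cV[R]_n.+1 -> \bar R :=
  pushforward (mu \x @lebesgue_measure R)%E (@cons_cV n).

Let cons_measure_isMeasure :
  [/\ cons_measure set0 = 0%E, forall A, (0 <= cons_measure A)%E &
      semi_sigma_additive cons_measure].
Proof.
pose m := measure_function_pushforward__canonical__measure_function_Measure
  (mu \x @lebesgue_measure R)%E (@measurable_cons_cV n).
split; first exact: (@measure0 _ _ _ m).
  by move=> A; exact: (@measure_ge0 _ _ _ m).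
exact: (@measure_semi_sigma_additive _ _ _ m).
Qed.

Let cons_measure0 : cons_measure set0 = 0%E.
Proof. by case: cons_measure_isMeasure. Qed.

Let cons_measure_ge0 A : (0 <= cons_measure A)%E.
Proof. by case: cons_measure_isMeasure. Qed.

Let cons_measure_sigma_additive : semi_sigma_additive cons_measure.
Proof. by case: cons_measure_isMeasure. Qed.

HB.instance Definition _ := isMeasure.Build _ _ _ cons_measure
  cons_measure0 cons_measure_ge0 cons_measure_sigma_additive.

End cons_measure.

(* The n-fold product of the one-dimensional Lebesgue measure. *)
Fixpoint lebesgue_cV n : {measure set 'cV[R]_n -> \bar R} :=
  match n with
  | 0%N => dirac (0 : 'cV[R]_0)
  | m.+1 => cons_measure (lebesgue_cV m)
  end.

End lebesgue_cV.

Section euclidean.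
Context {R : realType} {n : nat}.
Implicit Types (x y : 'cV[R]_n) (r : R) (f : 'cV[R]_n -> R).

Definition inner x y : R := (x^T *m y) ord0 ord0.

(* The library's norm on 'cV[R]_n is the sup norm. *)
Definition enorm x : R := Num.sqrt (inner x x).

Definition cball x r : set 'cV[R]_n := [set y | enorm (y - x) <= r].

Definition partial (i : 'I_n) f : 'cV[R]_n -> R :=
  fun x => 'D_(delta_mx i ord0) (f : 'cV[R]_n -> R^o) x.

Definition gradient f x : 'cV[R]_n := \col_i partial i f x.

Fixpoint C_k (k : nat) f : Prop :=
  continuous (f : 'cV[R]_n -> R^o) /\
  if k is k'.+1 then
    (forall i x, derivable (f : 'cV[R]_n -> R^o) x (delta_mx i ord0)) /\
    (forall i, C_k k' (partial i f))
  else True.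

Definition smooth f : Prop := forall k, C_k k f.

Definition supp f : set 'cV[R]_n := closure [set x | f x != 0].

End euclidean.

Section ornstein_uhlenbeck.
Context {R : realType} {n : nat}.
Implicit Types (Q B S : 'M[R]_n).

Definition posdefmx Q : Prop :=
  Q^T = Q /\ forall x : 'cV[R]_n, x != 0 -> 0 < inner (Q *m x) x.

(* B is real, so its eigenvalues are those of its image over R[i]. *)
Definition hurwitzmx B : Prop :=
  forall a : R[i],
    eigenvalue (map_mx (real_complex R) B) a -> complex.Re a < 0.

Definition expmx B : 'M[R]_n := limn (series (fun k => (k`!%:R)^-1 *: B ^+ k)).

Definition OUcov Q B (t : \bar R) : 'M[R]_n :=
  \matrix_(i, j) \int[@lebesgue_measure R]_(s in [set s : R | 0 <= s /\ (s%:E <= t)%E])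
    (expmx (s *: B) *m Q *m expmx (s *: B^T)) i j.

Definition gauss_pdf S (x : 'cV[R]_n) : R :=
  (2 * pi) `^ (- (n%:R / 2)) * (\det S) `^ (- 2^-1)
  * expR (- 2^-1 * inner (invmx S *m x) x).

Lemma gauss_pdf_ge0 S x : 0 <= gauss_pdf S x.
Proof. by rewrite /gauss_pdf !mulr_ge0 ?powR_ge0 ?expR_ge0. Qed.

Lemma measurable_gauss_pdf S : measurable_fun setT (gauss_pdf S).
Proof.
apply: measurable_funM => //; apply: measurableT_comp => //.
apply: measurable_funM => //.
have -> : (fun x => inner (invmx S *m x) x) =
    (fun x => \sum_(i < n) (\sum_(j < n) invmx S i j * x j ord0) * x i ord0).
  apply/funext => x; rewrite /inner mxE; apply: eq_bigr => i _.
  by rewrite !mxE.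
apply: measurable_sum => i; apply: measurable_funM; last first.
  exact: measurable_cV_coord.
apply: measurable_sum => j; apply: measurable_funM => //.
exact: measurable_cV_coord.
Qed.

(* The measure with density gauss_pdf S; it is the Gaussian probability measure
   of covariance S when S is positive definite. *)
Definition gaussian S (A : set 'cV[R]_n) : \bar R :=
  (\int[lebesgue_cV n]_(x in A) (gauss_pdf S x)%:E)%E.

Section gaussian_measure.
Variable S : 'M[R]_n.

Let gaussian0 : gaussian S set0 = 0%E.
Proof. by rewrite /gaussian integral_set0. Qed.

Let gaussian_ge0 A : (0 <= gaussian S A)%E.
Proof. by apply: integral_ge0 => x _; rewrite lee_fin gauss_pdf_ge0. Qed.

Let gaussian_sigma_additive : semi_sigma_additive (gaussian S).
Proof.
move=> F mF tF mUF; rewrite /gaussian ge0_integral_bigcup//=; last 2 first.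
- by apply/measurable_EFinP; apply: measurable_funTS; exact: measurable_gauss_pdf.
- by move=> x _; rewrite lee_fin gauss_pdf_ge0.
apply: is_cvg_ereal_nneg_natsum_cond => k _ _.
by apply: integral_ge0 => x _; rewrite lee_fin gauss_pdf_ge0.
Qed.

HB.instance Definition _ := isMeasure.Build _ _ _ (gaussian S)
  gaussian0 gaussian_ge0 gaussian_sigma_additive.

End gaussian_measure.

Definition OUmeasure Q B (t : \bar R) : {measure set 'cV[R]_n -> \bar R} :=
  gaussian (OUcov Q B t).

Definition OU Q B (t : R) (f : 'cV[R]_n -> R) (x : 'cV[R]_n) : R :=
  \int[OUmeasure Q B t%:E]_y f (expmx (t *: B) *m x - y).

End ornstein_uhlenbeck.

Section localization.
Context {R : realType} {n : nat}.
Implicit Types (A : R) (x : nat -> 'cV[R]_n) (r rt : nat -> 'cV[R]_n -> R).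

Definition locball A (s : R) (y : 'cV[R]_n) : set 'cV[R]_n :=
  cball y (s * A / (1 + enorm y)).

(* The centres form a maximal set among those whose balls have pairwise disjoint
   interiors. *)
Definition maximal_balls A x : Prop :=
  [/\ x 0%N = 0,
      trivIset setT (fun j => (locball A 1 (x j))°) &
      forall E : set 'cV[R]_n, range x `<=` E ->
        trivIset E (fun y => (locball A 1 y)°) -> E = range x].

Record localization A x r rt : Prop := Localization {
  loc_balls : maximal_balls A x;
  loc_r_smooth : forall j, smooth (r j);
  loc_r_ge0 : forall j y, 0 <= r j y;
  loc_r_sum : forall y, series (fun j => r j y) @ \oo --> (1 : R);
  loc_r_supp : forall j, supp (r j) `<=` locball A 4 (x j);
  loc_r_0 : forall y, locball A 2^-1 (x 0%N) y -> r 0%N y = 1;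
  loc_rt_smooth : forall j, smooth (rt j);
  loc_rt_01 : forall j y, 0 <= rt j y <= 1;
  loc_rt_supp : forall j, supp (rt j) `<=` locball A 6 (x j);
  loc_rt_1 : forall j y, locball A 5 (x j) y -> rt j y = 1;
  loc_gradient : exists C : R, forall j y,
    enorm (gradient (r j) y) <= C * (1 + enorm y) /\
    enorm (gradient (rt j) y) <= C * (1 + enorm y) }.

Definition OUloc Q B r rt (t : R) (f : 'cV[R]_n -> R) (y : 'cV[R]_n) : R :=
  limn (series (fun j => rt j y * OU Q B t (f \* r j) y)).

Definition OUglob Q B r rt (t : R) (f : 'cV[R]_n -> R) (y : 'cV[R]_n) : R :=
  OU Q B t f y - OUloc Q B r rt t f y.

End localization.

Section jumps.
Context {R : realType}.

Definition has_jumps (I : set R) (a : R -> R) (lambda : R) (N : nat) : Prop :=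
  exists t : nat -> R,
    (forall i, (i <= N)%N -> I (t i)) /\
    (forall i, (i < N)%N ->
       t i < t i.+1 /\ lambda < `|a (t i.+1) - a (t i)|).

(* An extended real: the supremum may be infinite. The 0 is its value when there
   is no N at all. *)
Definition jump_number (I : set R) (a : R -> R) (lambda : R) : \bar R :=
  ereal_sup (0%E |` [set (N%:R)%:E | N in
    [set N : nat | (1 <= N)%N /\ has_jumps I a lambda N]]).

Definition jump_quasinorm d (T : measurableType d)
    (mu : {measure set T -> \bar R}) (I : set R) (F : R -> T -> R)
    (rho p : R) : \bar R :=
  ereal_sup [set
      'N[mu]_(p%:E)[(fun x => lambda%:E * jump_number I (F ^~ x) lambda `^ rho^-1)]%E
    | lambda in [set lambda : R | 0 < lambda]].

End jumps.

(* Main.v *)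
(* A jump function is dominated by the total variation, so it suffices to bound the
   variation of [t |-> OUglob t f y] over ]0, 1]. Its kernel is [eta(u) p_t(y, u)], where
   [p_t] is the kernel of the semigroup with respect to Lebesgue measure and [0 <= eta <= 1]
   vanishes unless [(1 + |u|) |y - u| >= c].

   Put [R(x) = <Q_oo^-1 x, x> / 2] and fix [0 < th < 1]. Combining the Gaussian form of
   [p_t(x, u)] with its form for the reversed process, [p_t(x, u) e^(th (R(u) - R(x)))] decays
   like [t^(-n/2) exp(- c |x - u|^2 / t - c t |u|^2)], and its time derivative like [1/t] times
   that. Where [(1 + |u|) |x - u| >= c], this derivative is at most
   [M(x, u) a / (1 + t a)^2], with [a = (1 + |u|)^2] and
   [M(x, u) = C (1 + |u|)^n exp(- k (1 + |u|) |x - u|)]; the time factor has integral at most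
   [1]. The variation of [p_t(x, u)] is therefore at most [M(x, u) e^(th (R(x) - R(u)))].

   For [th = 1/p] the weights turn [L^p] of the invariant measure into [L^p] of Lebesgue
   measure, where [M] is bounded by Schur's test. *)

From HB Require Import structures.
Require Import Defs.
From mathcomp Require Import all_boot all_order all_algebra.
From mathcomp Require Import complex.
From mathcomp Require Import all_classical all_reals all_analysis.
From mathcomp Require Import measurable_realfun.
From mathcomp Require Import perm ring lra.

Set Implicit Arguments.
Unset Strict Implicit.
Unset Printing Implicit Defensive.

Import Order.TTheory GRing.Theory Num.Theory.
Import numFieldTopology.Exports numFieldNormedType.Exports.

Local Open Scope classical_set_scope.
Local Open Scope ring_scope.

(** * Euclidean linear algebra *)

(** The Gaussian form alone gives decay in [|e^(tB) x - u|^2 / t]. The reversed form, available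
    because [Q_oo = Q_t + e^(tB) Q_oo e^(tB^T)], gives decay in
    [|e^(tB) x - u + Q_t Q_oo^-1 u|^2 / t]. If both carry a positive weight, [1 - th] and [th], the
    difference of the two vectors is controlled too. It has size [t |u|]: this is the origin of
    [exp(- c t |u|^2)], and the reason for [p > 1].

    Put [s = t a] and [m = (1 + |u|) |x - u|]. Up to an additive constant the exponent is at least a
    multiple of [m^2 / s + s]. One half of it is at least a multiple of [m], whence the spatial
    decay of [M]. In the global region [m] is bounded below, so the other half gives
    [exp(- k' / s - k' s)], which absorbs every power of [1/s] near [0] and decays at infinity.

    The profile [a / (1 + t a)^2] has the elementary primitive [- 1 / (1 + t a)]. Increments of the
    kernel are compared with increments of this primitive, which telescope, so that no integral in
    time is formed. *)

Section linear_algebra.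
Context {R : realType}.

Section inner.
Context {n : nat}.
Implicit Types (x y z : 'cV[R]_n) (M N : 'M[R]_n).

Lemma innerE x y : inner x y = \sum_i x i ord0 * y i ord0.
Proof. by rewrite /inner mxE; apply: eq_bigr => i _; rewrite mxE. Qed.

Lemma innerC x y : inner x y = inner y x.
Proof. by rewrite !innerE; apply: eq_bigr => i _; rewrite mulrC. Qed.

Lemma innerDl x y z : inner (x + y) z = inner x z + inner y z.
Proof. by rewrite /inner linearD/= mulmxDl mxE. Qed.

Lemma innerDr x y z : inner z (x + y) = inner z x + inner z y.
Proof. by rewrite /inner mulmxDr mxE. Qed.

Lemma innerZl a x y : inner (a *: x) y = a * inner x y.
Proof. by rewrite /inner linearZ/= -scalemxAl mxE. Qed.

Lemma innerZr a x y : inner y (a *: x) = a * inner y x.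
Proof. by rewrite innerC innerZl innerC. Qed.

Lemma innerNl x y : inner (- x) y = - inner x y.
Proof. by rewrite -scaleN1r innerZl mulN1r. Qed.

Lemma innerNr x y : inner y (- x) = - inner y x.
Proof. by rewrite innerC innerNl innerC. Qed.

Lemma innerBl x y z : inner (x - y) z = inner x z - inner y z.
Proof. by rewrite innerDl innerNl. Qed.

Lemma innerBr x y z : inner z (x - y) = inner z x - inner z y.
Proof. by rewrite innerDr innerNr. Qed.

Lemma inner0l x : inner 0 x = 0.
Proof. by rewrite -(scale0r x) innerZl mul0r. Qed.

Lemma inner0r x : inner x 0 = 0.
Proof. by rewrite innerC inner0l. Qed.

Lemma inner_mull M x y : inner (M *m x) y = inner x (M^T *m y).
Proof. by rewrite /inner trmx_mul mulmxA. Qed.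

Lemma inner_ge0 x : 0 <= inner x x.
Proof. by rewrite innerE; apply: sumr_ge0 => i _; rewrite -expr2 sqr_ge0. Qed.

Lemma inner_eq0 x : (inner x x == 0) = (x == 0).
Proof.
apply/idP/idP => [|/eqP->]; last by rewrite inner0l.
rewrite innerE psumr_eq0; last by move=> i _; rewrite -expr2 sqr_ge0.
move=> /allP h; apply/eqP/matrixP => i j; rewrite ord1 mxE.
by have := h i (mem_index_enum i); rewrite -expr2 sqrf_eq0 => /eqP.
Qed.

Lemma enorm_ge0 x : 0 <= enorm x. Proof. exact: sqrtr_ge0. Qed.

Lemma enorm_sqr x : enorm x ^+ 2 = inner x x.
Proof. by rewrite sqr_sqrtr// inner_ge0. Qed.

Lemma enorm0 : enorm (0 : 'cV[R]_n) = 0.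
Proof. by rewrite /enorm inner0l sqrtr0. Qed.

Lemma enorm_eq0 x : (enorm x == 0) = (x == 0).
Proof. by rewrite -(inner_eq0 x) -enorm_sqr sqrf_eq0. Qed.

Lemma enormN x : enorm (- x) = enorm x.
Proof. by rewrite /enorm innerNl innerNr opprK. Qed.

Lemma enorm_distC x y : enorm (x - y) = enorm (y - x).
Proof. by rewrite -enormN opprB. Qed.

(** The polynomial [s -> <M (x + s y), x + s y>] is nonnegative; evaluate it at its minimum. *)
Lemma psd_CauchySchwarz M x y : M^T = M ->
  (forall z, 0 <= inner (M *m z) z) ->
  inner (M *m x) y ^+ 2 <= inner (M *m x) x * inner (M *m y) y.
Proof.
move=> MT M0.
have sym a b : inner (M *m a) b = inner (M *m b) a by rewrite inner_mull MT innerC.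
have quad s : 0 <= inner (M *m x) x + 2 * s * inner (M *m x) y
                   + s ^+ 2 * inner (M *m y) y.
  have := M0 (x + s *: y).
  rewrite mulmxDr -scalemxAr !(innerDl, innerDr, innerZl, innerZr) (sym y x).
  by move=> /le_trans; apply; rewrite le_eqVlt; apply/orP; left; apply/eqP; ring.
set a := inner (M *m x) x in quad *; set b := inner (M *m x) y in quad *.
set c := inner (M *m y) y in quad *.
have [c0|c0] := eqVneq c 0.
  rewrite c0 mulr0; have [->|b0] := eqVneq b 0; first by rewrite expr0n.
  (* For [c = 0] the polynomial is affine, and it takes the value [-1] at this point. *)
  have := quad (- (a + 1) / (2 * b)).
  rewrite c0 mulr0 addr0 (_ : 2 * (- (a + 1) / (2 * b)) * b = - (a + 1)); last by field.
  by rewrite opprD addrA subrr add0r oppr_ge0 leNgt ltr01.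
have cp : 0 < c by rewrite lt_def c0 M0.
have := quad (- b / c).
rewrite (_ : a + 2 * (- b / c) * b + (- b / c) ^+ 2 * c = (a * c - b ^+ 2) / c).
  by rewrite pmulr_lge0 ?invr_gt0// subr_ge0.
by field.
Qed.

Lemma inner_CS x y : `|inner x y| <= enorm x * enorm y.
Proof.
rewrite -ler_sqr ?nnegrE ?mulr_ge0 ?enorm_ge0//.
rewrite real_normK ?num_real// exprMn !enorm_sqr.
have := @psd_CauchySchwarz 1%:M x y (trmx1 _ _).
by rewrite !mul1mx; apply => z; rewrite mul1mx inner_ge0.
Qed.

Lemma enormD x y : enorm (x + y) <= enorm x + enorm y.
Proof.
rewrite -ler_sqr ?nnegrE ?addr_ge0 ?enorm_ge0//.
rewrite sqrrD !enorm_sqr innerDl !innerDr (innerC y x).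
have := le_trans (ler_norm _) (inner_CS x y); lra.
Qed.

Lemma enormD_sqr x y : enorm (x + y) ^+ 2 <= 2 * enorm x ^+ 2 + 2 * enorm y ^+ 2.
Proof.
have := enormD x y; have := enorm_ge0 (x + y).
have := enorm_ge0 x; have := enorm_ge0 y => *.
apply: (@le_trans _ _ ((enorm x + enorm y) ^+ 2)).
  by rewrite lerXn2r ?nnegrE// addr_ge0.
by have := sqr_ge0 (enorm x - enorm y); rewrite sqrrB sqrrD; lra.
Qed.

Lemma normr_le_enorm x i : `|x i ord0| <= enorm x.
Proof.
rewrite -ler_sqr ?nnegrE ?enorm_ge0// real_normK ?num_real//.
rewrite enorm_sqr innerE (bigD1 i)//= -expr2 lerDl.
by apply: sumr_ge0 => j _; rewrite -expr2 sqr_ge0.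
Qed.

Lemma enorm_le_sum x : enorm x <= \sum_i `|x i ord0|.
Proof.
rewrite -ler_sqr ?nnegrE ?enorm_ge0 ?sumr_ge0//.
rewrite enorm_sqr innerE expr2 big_distrl/= ler_sum// => i _.
rewrite -expr2 -real_normK ?num_real// expr2 ler_wpM2l//.
by rewrite (bigD1 i)//= lerDl sumr_ge0.
Qed.

Lemma enorm_mulmx M K x : (forall i j, `|M i j| <= K) ->
  enorm (M *m x) <= (n * n)%:R * K * enorm x.
Proof.
move=> MK; apply: le_trans (enorm_le_sum _) _.
have -> : (n * n)%:R * K * enorm x = \sum_(i < n) \sum_(j < n) K * enorm x.
  by rewrite !(sumr_const, card_ord) -mulrnA mulr_natl mulrnAl.
apply: ler_sum => i _; rewrite mxE (le_trans (ler_norm_sum _ _ _))//.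
apply: ler_sum => j _; rewrite normrM ler_pM//; exact: normr_le_enorm.
Qed.

Lemma inner_delta M i j :
  inner (delta_mx i ord0) (M *m delta_mx j ord0) = M i j.
Proof.
rewrite -colE innerE (bigD1 i)//= !mxE !eqxx mul1r big1 ?addr0// => k ki.
by rewrite !mxE (negbTE ki) mul0r.
Qed.

Lemma enorm_delta (i : 'I_n) : enorm (delta_mx i ord0 : 'cV[R]_n) = 1.
Proof.
by rewrite /enorm -[X in inner _ X]mul1mx inner_delta mxE eqxx sqrtr1.
Qed.

Lemma coef_bound M K : (forall x, enorm (M *m x) <= K * enorm x) ->
  forall i j, `|M i j| <= K.
Proof.
move=> MK i j; rewrite -inner_delta (le_trans (inner_CS _ _))//.
by rewrite enorm_delta mul1r (le_trans (MK _))// enorm_delta mulr1.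
Qed.

Lemma coef_bounded (M : 'M[R]_n) : exists2 K, 0 < K & forall i j, `|M i j| <= K.
Proof.
exists (1 + \sum_i \sum_j `|M i j|).
  by rewrite ltr_pwDl// sumr_ge0// => i _; rewrite sumr_ge0.
move=> i j; rewrite (bigD1 i)//= (bigD1 j)//=.
set a := \sum_(_ < _ | _) _; set b := \sum_(_ < _ | _) _.
have a0 : 0 <= a by apply: sumr_ge0.
have b0 : 0 <= b by apply: sumr_ge0 => k _; apply: sumr_ge0.
lra.
Qed.

Lemma enorm_mulmx_bounded M :
  exists2 K, 0 < K & forall x, enorm (M *m x) <= K * enorm x.
Proof.
have [K K0 MK] := coef_bounded M.
exists ((n * n)%:R * K + 1); first by rewrite ltr_wpDl// mulr_ge0// ltW.
move=> x; apply: le_trans (enorm_mulmx x MK) _.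
by rewrite ler_wpM2r ?enorm_ge0// lerDl.
Qed.

Lemma unitmx_inj M : (forall x, M *m x = 0 -> x = 0) -> M \in unitmx.
Proof.
move=> Minj; rewrite -unitmx_tr -row_free_unit -kermx_eq0.
apply/eqP/row_matrixP => i; rewrite row0; set v := row i _.
have vM : v *m M^T = 0 by apply/sub_kermxP; rewrite /v row_sub.
by apply: trmx_inj; rewrite trmx0; apply: Minj; rewrite -[M]trmxK -trmx_mul vM trmx0.
Qed.

(** Quantitative positive definiteness. Carrying both constants explicitly lets the linear
    dependence of [Q_t] on [t] pass to inverses and determinants. *)
Definition form_between (l u : R) M : Prop :=
  M^T = M /\ forall x, l * inner x x <= inner (M *m x) x <= u * inner x x.

Section form_between.
Variables (l u : R) (M : 'M[R]_n).
Hypotheses (l0 : 0 < l) (Mlu : form_between l u M).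

Lemma form_ge x : l * enorm x ^+ 2 <= inner (M *m x) x.
Proof. by rewrite enorm_sqr; have [_ /(_ x)/andP[]] := Mlu. Qed.

Lemma form_le x : inner (M *m x) x <= u * enorm x ^+ 2.
Proof. by rewrite enorm_sqr; have [_ /(_ x)/andP[]] := Mlu. Qed.

Lemma form_ge0 x : 0 <= inner (M *m x) x.
Proof. by apply: le_trans (form_ge x); rewrite mulr_ge0 ?sqr_ge0// ltW. Qed.

Lemma form_enorm_ge x : l * enorm x <= enorm (M *m x).
Proof.
have [->|x0] := eqVneq x 0; first by rewrite mulmx0 enorm0 mulr0.
have xp : 0 < enorm x by rewrite lt_def enorm_eq0 x0 enorm_ge0.
rewrite -(ler_pM2r xp) -mulrA -expr2 (le_trans (form_ge x))//.
by rewrite (le_trans (ler_norm _))// inner_CS.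
Qed.

Lemma form_unitmx : M \in unitmx.
Proof.
apply: unitmx_inj => x Mx0; have := form_enorm_ge x.
rewrite Mx0 enorm0 pmulr_rle0// => xn.
by apply/eqP; rewrite -enorm_eq0 eq_le xn enorm_ge0.
Qed.

Lemma form_invmx_tr : (invmx M)^T = invmx M.
Proof. by rewrite trmx_inv; have [->] := Mlu. Qed.

Lemma form_invmx_enorm x : enorm (invmx M *m x) <= l^-1 * enorm x.
Proof.
have := form_enorm_ge (invmx M *m x).
by rewrite mulmxA mulmxV ?form_unitmx// mul1mx -ler_pdivlMl.
Qed.

(** Completion of the square around a trial vector [v]. Dropping the last term, which is
    nonnegative, leaves a lower bound for the inverse form that does not involve the inverse; good
    choices of [v] are the substance of [quad_reversed]. *)
Lemma form_invmx_variational x v :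
  inner (invmx M *m x) x = 2 * inner v x - inner (M *m v) v
    + inner (invmx M *m (x - M *m v)) (x - M *m v).
Proof.
have U := form_unitmx.
rewrite mulmxBr mulmxA mulVmx// mul1mx !(innerBl, innerBr).
have -> : inner (invmx M *m x) (M *m v) = inner v x.
  by rewrite inner_mull form_invmx_tr mulmxA mulVmx// mul1mx innerC.
by rewrite (innerC v (M *m v)); ring.
Qed.

Lemma form_invmx_ge0 x : 0 <= inner (invmx M *m x) x.
Proof.
have U := form_unitmx.
have -> : inner (invmx M *m x) x = inner (M *m (invmx M *m x)) (invmx M *m x).
  by rewrite mulmxA mulmxV// mul1mx innerC.
exact: form_ge0.
Qed.

Lemma form_invmx_ge x : 0 < u -> u^-1 * enorm x ^+ 2 <= inner (invmx M *m x) x.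
Proof.
move=> u0; rewrite (form_invmx_variational x (u^-1 *: x)) -scalemxAr.
rewrite !(innerZl, innerZr) -enorm_sqr.
have h : u^-1 * (u^-1 * inner (M *m x) x) <= u^-1 * enorm x ^+ 2.
  rewrite ler_pM2l ?invr_gt0// ler_pdivrMl//; exact: form_le.
have := form_invmx_ge0 (x - u^-1 *: (M *m x)); lra.
Qed.

End form_between.

(** The lower constant comes from Cauchy-Schwarz for the form of [M] at [x] and [M^-1 x],
    [|x|^4 <= <M x, x> <M^-1 x, x>], and a bound on [M^-1]; neither eigenvalues nor compactness is
    involved. *)
Lemma posdef_form_between M : posdefmx M ->
  exists l u, [/\ 0 < l, 0 < u & form_between l u M].
Proof.
move=> [MT Mpos].
have M0 x : 0 <= inner (M *m x) x.
  by have [->|/Mpos/ltW//] := eqVneq x 0; rewrite inner0r.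
have U : M \in unitmx.
  apply: unitmx_inj => x Mx0; apply/eqP/contraT => /Mpos.
  by rewrite Mx0 inner0l ltxx.
have [K K0 MK] := enorm_mulmx_bounded M.
have [L L0 ML] := enorm_mulmx_bounded (invmx M).
exists L^-1, K; split => //; first by rewrite invr_gt0.
split=> // x; apply/andP; split; last first.
  rewrite (le_trans (ler_norm _))// (le_trans (inner_CS _ _))//.
  by rewrite -enorm_sqr expr2 mulrA ler_wpM2r ?enorm_ge0.
have [->|x0] := eqVneq x 0; first by rewrite !inner0r mulr0.
have xx : 0 < inner x x by rewrite lt_def inner_eq0 x0 inner_ge0.
have := @psd_CauchySchwarz M x (invmx M *m x) MT M0.
rewrite [inner (M *m x) (invmx M *m x)]inner_mull MT mulKVmx// => h.
rewrite ler_pdivrMl// -(ler_pM2r xx) -expr2 (le_trans h)//.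
rewrite [leRHS]mulrAC [leRHS]mulrC ler_wpM2l//.
rewrite (le_trans (ler_norm _))// (le_trans (inner_CS _ _))//.
by rewrite -enorm_sqr expr2 mulrCA ler_wpM2l ?enorm_ge0.
Qed.

End inner.
End linear_algebra.

(** * Derivatives of real functions and matrices *)

Section derivatives.
Context {R : realType}.
Implicit Types (f g : R -> R) (t a b : R).

Definition D1 f t a := is_derive t (1 : R) f a.

Lemma D1_cst (c : R) t : D1 (fun=> c) t 0. Proof. exact: is_derive_cst. Qed.

Lemma D1_id t : D1 (fun s => s) t 1. Proof. exact: is_derive_id. Qed.

Lemma D1_eq f t a b : a = b -> D1 f t a -> D1 f t b. Proof. by move=> ->. Qed.

Lemma D1D f g t a b : D1 f t a -> D1 g t b -> D1 (fun s => f s + g s) t (a + b).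
Proof. exact: is_deriveD. Qed.

Lemma D1N f t a : D1 f t a -> D1 (fun s => - f s) t (- a).
Proof. exact: is_deriveN. Qed.

Lemma D1B f g t a b : D1 f t a -> D1 g t b -> D1 (fun s => f s - g s) t (a - b).
Proof. exact: is_deriveB. Qed.

Lemma D1M f g t a b :
  D1 f t a -> D1 g t b -> D1 (fun s => f s * g s) t (a * g t + f t * b).
Proof.
move=> fa gb; apply: D1_eq (is_deriveM fa gb).
by rewrite addrC /GRing.scale/= mulrC.
Qed.

Lemma D1Zl f t a (c : R) : D1 f t a -> D1 (fun s => c * f s) t (c * a).
Proof. by move=> fa; apply: D1_eq (D1M (D1_cst c t) fa); rewrite mul0r add0r. Qed.

Lemma D1_sum (I : Type) (r : seq I) (h : I -> R -> R) (dh : I -> R) t :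
  (forall i, D1 (h i) t (dh i)) ->
  D1 (fun s => \sum_(i <- r) h i s) t (\sum_(i <- r) dh i).
Proof.
move=> H; elim: r => [|i r IH].
  by rewrite big_nil; under eq_fun do rewrite big_nil; exact: D1_cst.
by rewrite big_cons; under eq_fun do rewrite big_cons; exact: D1D.
Qed.

Lemma D1V f t a : f t != 0 -> D1 f t a -> D1 (fun s => (f s)^-1) t (- a / f t ^+ 2).
Proof.
move=> f0 fa; apply: D1_eq (is_deriveV f0 fa).
by rewrite /GRing.scale/= !mulNr mulrC.
Qed.

Lemma D1_comp f g t a b : D1 f (g t) a -> D1 g t b -> D1 (fun s => f (g s)) t (a * b).
Proof. exact: is_derive1_comp. Qed.

Lemma D1_expR f t a : D1 f t a -> D1 (fun s => expR (f s)) t (expR (f t) * a).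
Proof. by move=> fa; apply: D1_comp => //; exact: is_derive_expR. Qed.

Lemma D1_continuous f t a : D1 f t a -> {for t, continuous f}.
Proof. by move=> [df _]; apply/differentiable_continuous/derivable1_diffP. Qed.

Lemma D1_unique f t a b : D1 f t a -> D1 f t b -> a = b.
Proof. by move=> [_ <-] [_ <-]. Qed.

Lemma D1_le f df a b : a <= b -> (forall t, a <= t <= b -> D1 f t (df t)) ->
  (forall t, a <= t <= b -> 0 <= df t) -> f a <= f b.
Proof.
move=> ab Df df0; rewrite -subr_ge0.
have [||c cab ->] := @MVT_segment _ f df a b ab.
- by move=> t; rewrite in_itv/= => /andP[at_ tb]; apply: Df; rewrite !ltW.
- apply: derivable_within_continuous => t; rewrite in_itv/= => tab.
  by have [] := Df t tab.
- by rewrite mulr_ge0 ?subr_ge0// df0.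
Qed.

(** Both [g - f] and [g + f] are nondecreasing. This replaces integration of a derivative bound
    wherever an explicit primitive [g] of the bound is known. *)
Lemma D1_dominated f df g dg a b : a <= b ->
  (forall t, a <= t <= b -> D1 f t (df t)) ->
  (forall t, a <= t <= b -> D1 g t (dg t)) ->
  (forall t, a <= t <= b -> `|df t| <= dg t) -> `|f b - f a| <= g b - g a.
Proof.
move=> ab Df Dg dfg.
have h1 : g a - f a <= g b - f b.
  apply: (@D1_le (fun s => g s - f s) (fun s => dg s - df s) a b) => // t tab; first exact/D1B/Df/tab/Dg.
  by rewrite subr_ge0 (le_trans (ler_norm _))// dfg.
have h2 : g a + f a <= g b + f b.
  apply: (@D1_le (fun s => g s + f s) (fun s => dg s + df s) a b) => // t tab; first exact/D1D/Df/tab/Dg.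
  by have := dfg t tab; rewrite ler_norml => /andP[]; lra.
by rewrite ler_norml; apply/andP; split; lra.
Qed.

Lemma D1_const f t a : (forall t, D1 f t 0) -> f t = f a.
Proof. exact: is_derive_0_is_cst. Qed.

(** The exact exponent of [K] matters: it will be applied with [K] of order [t] and [L] of order
    [1]. *)
Lemma D1_prod (I : Type) (r : seq I) (h : I -> R -> R) (dh : I -> R) (K L : R) t :
  (forall i, D1 (h i) t (dh i)) -> (forall i, `|h i t| <= K) ->
  (forall i, `|dh i| <= L) ->
  exists2 d, D1 (fun s => \prod_(i <- r) h i s) t d
    & `|d| <= (size r)%:R * K ^+ (size r).-1 * L.
Proof.
move=> Dh hK dhL; elim: r => [|i r [d Dd dle]].
  exists 0; last by rewrite normr0 !mul0r.
  by under eq_fun do rewrite big_nil; exact: D1_cst.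
have K0 : 0 <= K by rewrite (le_trans _ (hK i)).
exists (dh i * \prod_(j <- r) h j t + h i t * d).
  by under eq_fun do rewrite big_cons; exact: D1M.
rewrite (le_trans (ler_normD _ _))// !normrM /=.
have -> : (size r).+1%:R * K ^+ size r * L
    = L * K ^+ size r + (size r)%:R * K ^+ size r * L by rewrite -nat1r; ring.
rewrite lerD//.
  rewrite ler_pM// normr_prod; elim: (r) => [|j s IH] /=; first by rewrite big_nil.
  by rewrite big_cons exprS ler_pM// prodr_ge0.
rewrite (le_trans (ler_pM _ _ (hK i) dle))//.
case: (r) => [|j s] /=; first by rewrite !mul0r mulr0.
by rewrite exprS le_eqVlt; apply/orP; left; apply/eqP; ring.
Qed.

Definition mderiv {m n} (F : R -> 'M[R]_(m, n)) t (dF : 'M[R]_(m, n)) :=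
  forall i j, D1 (fun s => F s i j) t (dF i j).

Section mderiv.
Context {m n p : nat}.
Implicit Types (F G : R -> 'M[R]_(m, n)).

Lemma mderiv_eq F t A B : A = B -> mderiv F t A -> mderiv F t B.
Proof. by move=> ->. Qed.

Lemma mderiv_cst (A : 'M[R]_(m, n)) t : mderiv (fun=> A) t 0.
Proof. by move=> i j; rewrite mxE; exact: D1_cst. Qed.

Lemma mderivD F G t A B :
  mderiv F t A -> mderiv G t B -> mderiv (fun s => F s + G s) t (A + B).
Proof.
move=> FA GB i j; rewrite mxE; under eq_fun do rewrite mxE; exact: D1D.
Qed.

Lemma mderivN F t A : mderiv F t A -> mderiv (fun s => - F s) t (- A).
Proof. by move=> FA i j; rewrite mxE; under eq_fun do rewrite mxE; exact: D1N. Qed.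

Lemma mderivB F G t A B :
  mderiv F t A -> mderiv G t B -> mderiv (fun s => F s - G s) t (A - B).
Proof. by move=> FA GB; apply: mderivD => //; exact: mderivN. Qed.

Lemma mderiv_tr F t A : mderiv F t A -> mderiv (fun s => (F s)^T) t A^T.
Proof. by move=> FA i j; rewrite mxE; under eq_fun do rewrite mxE. Qed.

Lemma mderivM F (G : R -> 'M[R]_(n, p)) t A B :
  mderiv F t A -> mderiv G t B ->
  mderiv (fun s => F s *m G s) t (A *m G t + F t *m B).
Proof.
move=> FA GB i j; rewrite !mxE -big_split/=; under eq_fun do rewrite mxE.
by apply: D1_sum => k; exact: D1M.
Qed.

Lemma mderiv_unique F t A B : mderiv F t A -> mderiv F t B -> A = B.
Proof. by move=> FA FB; apply/matrixP => i j; exact: D1_unique (FA i j) (FB i j). Qed.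

Lemma mderiv_const F s t : (forall t, mderiv F t 0) -> F s = F t.
Proof.
move=> F0; apply/matrixP => i j; apply: (@D1_const (fun s => F s i j)) => r.
by have := F0 r i j; rewrite mxE.
Qed.

End mderiv.

Lemma mderivMl {m n p} (A : 'M[R]_(m, n)) (F : R -> 'M[R]_(n, p)) t dF :
  mderiv F t dF -> mderiv (fun s => A *m F s) t (A *m dF).
Proof.
move=> FdF; apply: mderiv_eq (mderivM (mderiv_cst A t) FdF).
by rewrite mul0mx add0r.
Qed.

Lemma mderivMr {m n p} (A : 'M[R]_(n, p)) (F : R -> 'M[R]_(m, n)) t dF :
  mderiv F t dF -> mderiv (fun s => F s *m A) t (dF *m A).
Proof.
move=> FdF; apply: mderiv_eq (mderivM FdF (mderiv_cst A t)).
by rewrite mulmx0 addr0.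
Qed.

Lemma D1_inner {n} (F G : R -> 'cV[R]_n) t A B : mderiv F t A -> mderiv G t B ->
  D1 (fun s => inner (F s) (G s)) t (inner A (G t) + inner (F t) B).
Proof.
move=> FA GB; have := mderivM (mderiv_tr FA) GB.
by move=> /(_ ord0 ord0); rewrite mxE.
Qed.

Lemma card_perm_ord (n : nat) : #|{: 'S_n}| = n`!.
Proof. by rewrite -card_Sn; apply: eq_card => s; rewrite !inE. Qed.

(** Leibniz expansion, term by term. For [Q_t] the bound is of order [t^(n-1)], so that the
    derivative of [ln (det Q_t)] is of order [1/t]. *)
Lemma D1_det {n} (F : R -> 'M[R]_n) t dF (K L : R) :
  mderiv F t dF -> (forall i j, `|F t i j| <= K) -> (forall i j, `|dF i j| <= L) ->
  exists2 d, D1 (fun s => \det (F s)) t d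
    & `|d| <= n`!%:R * (n%:R * K ^+ n.-1 * L).
Proof.
move=> FdF FK dFL.
have H (s : 'S_n) : exists d, D1 (fun u => (-1) ^+ s * \prod_(i < n) F u i (s i)) t d
    /\ `|d| <= n%:R * K ^+ n.-1 * L.
  have [d Dd dle] := @D1_prod _ (index_enum 'I_n) (fun i u => F u i (s i))
    (fun i => dF i (s i)) K L t (fun i => FdF i (s i)) (fun i => FK i (s i))
    (fun i => dFL i (s i)).
  exists ((-1) ^+ s * d); split; first exact: D1Zl.
  rewrite normrM normrX normrN1 expr1n mul1r (le_trans dle)//.
  by rewrite -[index_enum _]enumT size_enum_ord.
have [d Hd] := choice H.
exists (\sum_s d s).
  by rewrite /determinant; apply: D1_sum => s; case: (Hd s).
rewrite (le_trans (ler_norm_sum _ _ _))//.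
rewrite (le_trans (ler_sum _ (fun s _ => (Hd s).2)))//.
by rewrite sumr_const [leRHS]mulr_natl -card_perm_ord.
Qed.

Lemma det_bound {n} (A : 'M[R]_n) (K : R) :
  (forall i j, `|A i j| <= K) -> `|\det A| <= n`!%:R * K ^+ n.
Proof.
move=> AK; rewrite /determinant (le_trans (ler_norm_sum _ _ _))//.
apply: (@le_trans _ _ (\sum_(s : 'S_n) K ^+ n)); last first.
  by rewrite sumr_const [leRHS]mulr_natl -card_perm_ord.
apply: ler_sum => s _; rewrite normrM normrX normrN1 expr1n mul1r normr_prod.
rewrite -[X in K ^+ X]card_ord -prodr_const.
by apply: ler_prod => i _; rewrite AK normr_ge0.
Qed.

Lemma D1_det_ex {n} (F : R -> 'M[R]_n) t dF : mderiv F t dF ->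
  exists d, D1 (fun s => \det (F s)) t d.
Proof.
move=> FdF; have [K _ FK] := coef_bounded (F t).
by have [L _ FL] := coef_bounded dF; have [d] := D1_det FdF FK FL; exists d.
Qed.

(** Cramer's formula without the case distinction of [invmx], so that its entries can be
    differentiated as quotients of polynomials in the entries of [A]. *)
Definition adjinv {n} (A : 'M[R]_n) : 'M[R]_n := (\det A)^-1 *: \adj A.

Lemma adjinvE {n} (A : 'M[R]_n) : A \in unitmx -> adjinv A = invmx A.
Proof. by move=> U; rewrite /invmx U. Qed.

Lemma mderiv_adjinv {n} (F : R -> 'M[R]_n) t dF : mderiv F t dF ->
  F t \in unitmx ->
  mderiv (fun s => adjinv (F s)) t (- (invmx (F t) *m dF *m invmx (F t))).
Proof.
move=> FdF U.
have D0 : \det (F t) != 0 by move: U; rewrite unitmxE unitfE.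
have [d Dd] := D1_det_ex FdF.
have H (ij : 'I_n * 'I_n) : exists e, D1 (fun s => adjinv (F s) ij.1 ij.2) t e.
  case: ij => i j /=.
  have [e De] : exists e, D1 (fun s => \adj (F s) i j) t e.
    have -> : (fun s => \adj (F s) i j)
        = (fun s => (-1) ^+ (j + i) * \det (row' j (col' i (F s)))).
      by apply/funext => s; rewrite mxE.
    have : mderiv (fun s => row' j (col' i (F s))) t (row' j (col' i dF)).
      by move=> k l; rewrite !mxE; under eq_fun do rewrite !mxE; exact: FdF.
    move=> /D1_det_ex[e De]; eexists; apply: D1Zl; exact: De.
  exists (- d / \det (F t) ^+ 2 * \adj (F t) i j + (\det (F t))^-1 * e).
  by under eq_fun do rewrite mxE; exact: D1M (D1V D0 Dd) De.
have [e De] := choice H.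
pose G' := \matrix_(i, j) e (i, j).
have DG : mderiv (fun s => adjinv (F s)) t G'.
  by move=> i j; rewrite mxE; exact: (De (i, j)).
(* Differentiability is settled; the value of the derivative follows from the product with [F],
   which is [(det F)^-1 det F] times the identity and has derivative [0] at [t] by the quotient
   rule. *)
have : mderiv (fun s => adjinv (F s) *m F s) t 0.
  move=> i j; rewrite mxE /adjinv.
  under eq_fun do rewrite -scalemxAl mul_adj_mx scale_scalar_mx mxE.
  have : D1 (fun s => (\det (F s))^-1 * \det (F s)) t 0.
    by apply: D1_eq (D1M (D1V D0 Dd) Dd); field.
  by case: (i == j) => // _; exact: D1_cst.
move=> /mderiv_unique/(_ (mderivM DG FdF)); rewrite (adjinvE U).
move=> /eqP; rewrite eq_sym addr_eq0 => /eqP /(congr1 (mulmx^~ (invmx (F t)))).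
by rewrite mulmxK// mulNmx => <-.
Qed.

(** On the segment from the identity to [M] every matrix is positive definite, so the determinant
    never vanishes there and keeps the sign it has at the identity. *)
Lemma form_between_det_gt0 {n} (l u : R) (M : 'M[R]_n) :
  0 < l -> form_between l u M -> 0 < \det M.
Proof.
move=> l0 Mlu.
pose F s := s *: M + (1 - s) *: (1%:M : 'M[R]_n).
have DF t : mderiv F t (M - 1%:M).
  move=> i j; rewrite /F !mxE; under eq_fun do rewrite !mxE.
  apply: D1_eq (D1D (D1M (D1_id t) (D1_cst (M i j) t))
    (D1M (D1B (D1_cst 1 t) (D1_id t)) (D1_cst ((i == j)%:R) t))); ring.
have cF : {within `[0, 1], continuous (fun s => \det (F s))}.
  apply: derivable_within_continuous => t _.
  by have [d []] := D1_det_ex (DF t).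
have F0 : \det (F 0) = 1 by rewrite /F scale0r add0r subr0 scale1r det1.
have F1 : \det (F 1) = \det M by rewrite /F scale1r subrr scale0r addr0.
have Fn s : s \in `[0, 1] -> \det (F s) != 0.
  rewrite in_itv/= => /andP[s0 s1].
  suff : F s \in unitmx by rewrite unitmxE unitfE.
  apply: (@form_unitmx _ _ (s * l + (1 - s)) (s * u + (1 - s))).
    have [->|sn0] := eqVneq s 0; first by rewrite mul0r add0r subr0.
    by rewrite ltr_wpDr ?subr_ge0// mulr_gt0// lt_def sn0.
  have [MT Mb] := Mlu.
  split=> [|x]; first by rewrite /F linearD/= !linearZ/= MT trmx1.
  rewrite /F mulmxDl -!scalemxAl mul1mx innerDl !innerZl !mulrDl.
  rewrite !lerD2r -!mulrA; have /andP[h1 h2] := Mb x.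
  by rewrite !ler_wpM2l.
have [//|] := ltP 0 (\det M); rewrite -F1 => h.
have [|c c01 Fc0] := @IVT _ _ 0 1 0 ler01 cF.
  by rewrite F0 ge_min h orbT le_max ler01.
by have := Fn c c01; rewrite Fc0 eqxx.
Qed.

End derivatives.

(** * The matrix exponential *)

Section matrix_series.
Context {R : realType}.

Lemma cvg_matrix {m n : nat} (F : nat -> 'M[R]_(m, n)) (M : 'M[R]_(m, n)) :
  (forall i j, (fun k => F k i j) @ \oo --> M i j) -> F @ \oo --> M.
Proof.
move=> FM; apply/cvgrPdist_le => /= e e0.
have : \forall k \near \oo, forall ij : 'I_m * 'I_n,
    `|M ij.1 ij.2 - F k ij.1 ij.2| <= e.
  apply: filter_forall => -[i j] /=.
  by have /cvgrPdist_le/(_ e e0) := FM i j.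
apply: filterS => k H; rewrite [leLHS]/Num.Def.normr/= mx_normrE.
by apply: bigmax_le => [|ij _]; [exact: ltW|rewrite !mxE].
Qed.

(** Coefficients dominated by those of an exponential: the power series converges everywhere, and
    the class is stable under formal differentiation, as termwise differentiation requires. *)
Definition exp_bounded (f : nat -> R) :=
  exists M b, [/\ 0 <= M, 0 <= b & forall k, `|f k| <= M * (b ^+ k / k`!%:R)].

Lemma exp_bounded_cvg f t : exp_bounded f -> cvgn (pseries f t).
Proof.
move=> [M [b [M0 b0 fb]]]; apply: normed_cvg.
apply: (@series_le_cvg _ _ (fun k => M * exp_coeff (b * `|t|) k)).
- by move=> k; exact: normr_ge0.
- by move=> k; rewrite mulr_ge0// exp_coeff_ge0// mulr_ge0.
- move=> k; rewrite /exp_coeff/= normrM normrX exprMn.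
  by rewrite [X in _ <= _ * X]mulrAC mulrA ler_wpM2r ?exprn_ge0.
- apply: is_cvg_seriesZ; exact: is_cvg_series_exp_coeff.
Qed.

Lemma mulSfact_inv k : k.+1%:R * (k.+1`!%:R)^-1 = (k`!%:R)^-1 :> R.
Proof. by rewrite factS natrM invfM mulVKf. Qed.

Lemma exp_bounded_diffs f : exp_bounded f -> exp_bounded (pseries_diffs f).
Proof.
move=> [M [b [M0 b0 fb]]]; exists (M * b), b; split => //; first exact: mulr_ge0.
move=> k; rewrite /pseries_diffs normrM normr_nat.
rewrite (le_trans (ler_wpM2l (ler0n _ _) (fb k.+1)))//.
rewrite le_eqVlt; apply/orP; left; apply/eqP.
by rewrite mulrCA [_%:R * _]mulrCA mulSfact_inv exprS; ring.
Qed.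

Lemma D1_pseries f t : exp_bounded f ->
  D1 (fun s => limn (pseries f s)) t (limn (pseries (pseries_diffs f) t)).
Proof.
move=> fb; apply: (@pseries_snd_diffs _ f (`|t| + 1)).
- exact: exp_bounded_cvg.
- exact/exp_bounded_cvg/exp_bounded_diffs.
- exact/exp_bounded_cvg/exp_bounded_diffs/exp_bounded_diffs.
- by rewrite [ltRHS]ger0_norm ?addr_ge0// ltrDl.
Qed.

Lemma lim_pseries_sum {n} (c : 'I_n -> R) (f : 'I_n -> nat -> R) t :
  (forall i, exp_bounded (f i)) ->
  limn (pseries (fun k => \sum_i c i * f i k) t) = \sum_i c i * limn (pseries (f i) t).
Proof.
move=> fb; apply/cvg_lim => //.
have -> : pseries (fun k => \sum_i c i * f i k) t
    = (fun N => \sum_i c i * pseries (f i) t N).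
  apply/funext => N; rewrite /pseries /series/=.
  under eq_bigr do rewrite mulr_suml.
  rewrite exchange_big/=; apply: eq_bigr => i _; rewrite mulr_sumr.
  by apply: eq_bigr => k _; rewrite mulrA.
apply: cvg_big => [|i _]; first exact: add_continuous.
apply: cvgMl_tmp; exact: exp_bounded_cvg.
Qed.

End matrix_series.

Section matrix_exponential.
Context {R : realType} {n : nat}.
Implicit Types (B M : 'M[R]_n).

Lemma exprmx_bound B K k : (forall i j, `|B i j| <= K) ->
  forall i j, `|(B ^+ k) i j| <= (n%:R * K) ^+ k.
Proof.
move=> BK; elim: k => [|k IH] i j.
  rewrite !expr0 (_ : (1 : 'M[R]_n) i j = (i == j)%:R); last by rewrite -[1]/(1%:M) mxE.
  by case: (i == j); rewrite ?normr1 ?normr0.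
rewrite !exprS -mulmxE mxE (le_trans (ler_norm_sum _ _ _))//.
have -> : n%:R * K * (n%:R * K) ^+ k = \sum_(l < n) K * (n%:R * K) ^+ k.
  by rewrite sumr_const card_ord -mulrA mulr_natl.
by apply: ler_sum => l _; rewrite normrM ler_pM.
Qed.

Definition expmx_coef B i j (k : nat) : R := (B ^+ k) i j / k`!%:R.

Lemma expmx_coef_bounded B i j : exp_bounded (expmx_coef B i j).
Proof.
have [K K0 BK] := coef_bounded B; exists 1, (n%:R * K); split => //.
  by rewrite mulr_ge0// ltW.
move=> k; rewrite mul1r /expmx_coef normrM [X in _ * X <= _]ger0_norm ?invr_ge0//.
by rewrite ler_wpM2r ?invr_ge0//; exact: exprmx_bound.
Qed.

Lemma expmxE B t i j : expmx (t *: B) i j = limn (pseries (expmx_coef B i j) t).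
Proof.
pose M : 'M[R]_n := \matrix_(i, j) limn (pseries (expmx_coef B i j) t).
suff h : series (fun k => (k`!%:R)^-1 *: (t *: B) ^+ k) @ \oo --> M.
  by rewrite /expmx (cvg_lim _ h)// ?mxE//; exact: norm_hausdorff.
apply: cvg_matrix => a b; rewrite mxE.
have -> : (fun N => series (fun k => (k`!%:R)^-1 *: (t *: B) ^+ k) N a b)
    = pseries (expmx_coef B a b) t.
  apply/funext => N; rewrite /pseries /series/= summxE; apply: eq_bigr => k _.
  rewrite /expmx_coef mxE.
  have -> : (t *: B) ^+ k = t ^+ k *: B ^+ k.
    elim: k => [|k IH]; first by rewrite !expr0 scale1r.
    by rewrite !exprS IH -!mulmxE -scalemxAl -scalemxAr scalerA.
  by rewrite mxE; ring.
exact/exp_bounded_cvg/expmx_coef_bounded.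
Qed.

Lemma mderiv_expmx B t :
  mderiv (fun s => expmx (s *: B)) t (B *m expmx (t *: B)).
Proof.
move=> i j; rewrite mxE; under eq_fun do rewrite expmxE.
apply: D1_eq (D1_pseries _ (expmx_coef_bounded B i j)).
under [RHS]eq_bigr do rewrite expmxE.
rewrite -lim_pseries_sum; last by move=> l; exact: expmx_coef_bounded.
congr (limn (pseries _ t)); apply/funext => k; rewrite /pseries_diffs /expmx_coef.
rewrite exprS -mulmxE mxE mulr_suml mulr_sumr; apply: eq_bigr => l _.
by rewrite mulrCA mulSfact_inv mulrA.
Qed.

(** Writing [B^(k+1)] as [B B^k] or as [B^k B] gives two expressions for the derivative of the same
    series. *)
Lemma expmxC B t : B *m expmx (t *: B) = expmx (t *: B) *m B.
Proof.
apply: (mderiv_unique (mderiv_expmx B t)) => i j.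
rewrite mxE; under eq_fun do rewrite expmxE.
apply: D1_eq (D1_pseries _ (expmx_coef_bounded B i j)).
under [RHS]eq_bigr do rewrite expmxE mulrC.
rewrite -lim_pseries_sum; last by move=> l; exact: expmx_coef_bounded.
congr (limn (pseries _ t)); apply/funext => k; rewrite /pseries_diffs /expmx_coef.
rewrite exprSr -mulmxE mxE mulr_suml mulr_sumr; apply: eq_bigr => l _.
by rewrite mulrCA mulSfact_inv; ring.
Qed.

Lemma expmx0 B : expmx (0 *: B) = 1%:M.
Proof.
apply/matrixP => i j; rewrite expmxE; apply/cvg_lim => //.
rewrite -cvg_shiftS/=.
have -> : (fun N => pseries (expmx_coef B i j) 0 N.+1) = cst (1%:M i j).
  apply/funext => N; rewrite /pseries /series/= big_nat_recl//= expr0 mulr1.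
  rewrite big1 ?addr0; last by move=> k _; rewrite expr0n mulr0.
  by rewrite /expmx_coef expr0 divr1.
exact: cvg_cst.
Qed.

Lemma trmxX B k : (B ^+ k)^T = B^T ^+ k.
Proof.
elim: k => [|k IH]; first by rewrite !expr0; exact: trmx1.
by rewrite exprSr exprS -IH -!mulmxE trmx_mul.
Qed.

Lemma expmx_tr B t : expmx (t *: B^T) = (expmx (t *: B))^T.
Proof.
apply/matrixP => i j; rewrite mxE !expmxE; congr (limn (pseries _ t)).
by apply/funext => k; rewrite /expmx_coef -trmxX mxE.
Qed.

Lemma mderiv_shift {m p} (F : R -> 'M[R]_(m, p)) (c e t : R) dF :
  mderiv F (c + e * t) dF -> mderiv (fun s => F (c + e * s)) t (e *: dF).
Proof.
move=> FdF i j; rewrite mxE mulrC; apply: (@D1_comp _ (fun s => F s i j) (fun s => c + e * s) t _ _ (FdF i j)).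
apply: D1_eq (D1D (D1_cst c t) (D1Zl e (D1_id t))).
by rewrite mulr1 add0r.
Qed.

Lemma mderiv_expmxN B t :
  mderiv (fun s => expmx (- s *: B)) t (- (expmx (- t *: B) *m B)).
Proof.
rewrite -expmxC -scaleN1r.
have := @mderiv_shift _ _ (fun s => expmx (s *: B)) 0 (-1) t _ (mderiv_expmx B _).
by rewrite add0r mulN1r; under eq_fun do rewrite add0r mulN1r.
Qed.

(** The product [e^((s+r)B) e^(-rB)] has zero derivative in [r], hence equals its value at
    [r = 0]. *)
Lemma expmxD B s t : expmx ((s + t) *: B) = expmx (s *: B) *m expmx (t *: B).
Proof.
have inv r : expmx (r *: B) *m expmx (- r *: B) = 1%:M.
  rewrite -[RHS]mulmx1 -{1}(expmx0 B) -(expmx0 B) -{2}oppr0.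
  apply: (@mderiv_const _ _ _ (fun r => expmx (r *: B) *m expmx (- r *: B))) => u.
  apply: mderiv_eq (mderivM (mderiv_expmx B u) (mderiv_expmxN B u)).
  by rewrite mulmxN -(expmxC B (- u)) mulmxA -(expmxC B u) subrr.
have h r : expmx ((s + r) *: B) *m expmx (- r *: B) = expmx (s *: B).
  have -> : expmx (s *: B) = expmx ((s + 0) *: B) *m expmx (- 0 *: B).
    by rewrite addr0 oppr0 expmx0 mulmx1.
  apply: (@mderiv_const _ _ _ (fun r => expmx ((s + r) *: B) *m expmx (- r *: B))) => u.
  have := @mderiv_shift _ _ (fun r => expmx (r *: B)) s 1 u _ (mderiv_expmx B _).
  rewrite mul1r scale1r; under eq_fun do rewrite mul1r.
  move=> D; apply: mderiv_eq (mderivM D (mderiv_expmxN B u)).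
  by rewrite mulmxN -(expmxC B (- u)) mulmxA -(expmxC B (s + u)) subrr.
rewrite -(h t) -mulmxA.
by have := inv (- t); rewrite opprK => ->; rewrite mulmx1.
Qed.

Lemma expmxV B t : expmx (- t *: B) *m expmx (t *: B) = 1%:M.
Proof. by rewrite -expmxD addNr expmx0. Qed.

End matrix_exponential.

(** * Exponential decay *)

Section exponential_decay.
Context {R : realType}.
Notation mu := (@lebesgue_measure R).

(** The rate is left unspecified, so the class is closed under sums, products and shifts. A constant
    in it is zero ([expdecay_cst]): identities for [Q_oo] are obtained in this way from identities
    at finite times. *)
Definition expdecay (f : R -> R) :=
  exists C c, 0 < c /\ forall t, 0 <= t -> `|f t| <= C * expR (- c * t).

Lemma expdecay_bound f C c : 0 < c ->
  (forall t, 0 <= t -> `|f t| <= C * expR (- c * t)) -> expdecay f.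
Proof. by move=> c0 H; exists C, c. Qed.

Lemma expdecay_ge0 f : expdecay f ->
  exists C c, [/\ 0 <= C, 0 < c & forall t, 0 <= t -> `|f t| <= C * expR (- c * t)].
Proof.
move=> [C [c [c0 H]]]; exists C, c; split => //.
by have := H 0 (lexx _); rewrite mulr0 expR0 mulr1; exact: le_trans.
Qed.

Lemma expdecay0 : expdecay (fun=> 0).
Proof. by exists 0, 1; split => // t _; rewrite normr0 mul0r. Qed.

Lemma expdecayD f g : expdecay f -> expdecay g -> expdecay (fun t => f t + g t).
Proof.
move=> /expdecay_ge0[C [c [C0 c0 fC]]] /expdecay_ge0[D [d [D0 d0 gD]]].
apply: (@expdecay_bound _ (C + D) (Num.min c d)); first by rewrite lt_min c0.
move=> t t0; rewrite (le_trans (ler_normD _ _))// mulrDl lerD//.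
  rewrite (le_trans (fC t t0))// ler_wpM2l// ler_expR ler_wpM2r// lerN2.
  by rewrite ge_min lexx.
rewrite (le_trans (gD t t0))// ler_wpM2l// ler_expR ler_wpM2r// lerN2.
by rewrite ge_min lexx orbT.
Qed.

Lemma expdecayM f g : expdecay f -> expdecay g -> expdecay (fun t => f t * g t).
Proof.
move=> /expdecay_ge0[C [c [C0 c0 fC]]] /expdecay_ge0[D [d [D0 d0 gD]]].
apply: (@expdecay_bound _ (C * D) (c + d)); first by rewrite addr_gt0.
move=> t t0; rewrite opprD mulrDl expRD normrM mulrACA ler_pM//; auto.
Qed.

Lemma expdecayZ (a : R) f : expdecay f -> expdecay (fun t => a * f t).
Proof.
move=> [C [c [c0 H]]]; exists (`|a| * C), c; split => // t t0.
by rewrite normrM -mulrA ler_wpM2l// H.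
Qed.

Lemma expdecayB f g : expdecay f -> expdecay g -> expdecay (fun t => f t - g t).
Proof.
move=> ef eg; under eq_fun do rewrite -[X in _ + X]mulN1r.
exact/expdecayD/expdecayZ.
Qed.

Lemma expdecay_sum (I : Type) (r : seq I) (f : I -> R -> R) :
  (forall i, expdecay (f i)) -> expdecay (fun t => \sum_(i <- r) f i t).
Proof.
move=> ef; elim: r => [|i r IH].
  by under eq_fun do rewrite big_nil; exact: expdecay0.
by under eq_fun do rewrite big_cons; exact: expdecayD.
Qed.

Lemma expdecay_shift s f : 0 <= s -> expdecay f -> expdecay (fun t => f (s + t)).
Proof.
move=> s0 [C [c [c0 H]]]; exists (C * expR (- c * s)), c; split => // t t0.
by rewrite -mulrA -expRD -mulrDr H// addr_ge0.
Qed.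

Lemma expdecay_cst (a : R) : expdecay (fun=> a) -> a = 0.
Proof.
move=> /expdecay_ge0[C [c [C0 c0 H]]]; apply/eqP; rewrite -normr_le0 leNgt.
(* At this time [C e^(-ct)] has fallen below [|a|], since [e^(ct) >= 1 + ct]. *)
apply/negP => a0; have Cp : 0 < C / (`|a| * c).
  rewrite divr_gt0 ?mulr_gt0//.
  have := H 0 (lexx _); rewrite mulr0 expR0 mulr1; exact: lt_le_trans.
have := H _ (ltW Cp); rewrite mulNr expRN leNgt => /negP; apply.
rewrite ltr_pdivrMr ?expR_gt0//.
have := expR_ge1Dx (c * (C / (`|a| * c))).
rewrite (_ : c * (C / (`|a| * c)) = C / `|a|); last by field; lra.
move=> h; have := ler_wpM2l (normr_ge0 a) h.
by rewrite mulrDr mulrCA mulfV ?gt_eqF//; lra.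
Qed.

Lemma expdecay_le f (a : R) : expdecay f -> (forall t, 0 <= t -> f t <= a) -> 0 <= a.
Proof.
move=> [C [c [c0 H]]] fa; rewrite leNgt; apply/negP => a0.
have /eqP : a = 0; last by rewrite lt_eqF.
apply: expdecay_cst; exists C, c; split => // t t0.
rewrite (le_trans _ (H t t0))// ler0_norm ?(ltW a0)//.
by have := fa t t0; have := ler_norm (- f t); rewrite normrN; lra.
Qed.

(* Differentiating [a^2 + b^2] along the damped rotation. *)
Lemma damped_rotation_decay (a b g h : R -> R) (al be : R) : al < 0 ->
  (forall t, D1 a t (g t + al * a t - be * b t)) ->
  (forall t, D1 b t (h t + al * b t + be * a t)) ->
  expdecay g -> expdecay h -> expdecay a /\ expdecay b.
Proof.
move=> al0 Da Db eg eh.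
have [C [c [C0 c0 kC]]] : exists C c : R, [/\ 0 <= C, 0 < c &
    forall t : R, 0 <= t -> g t ^+ 2 + h t ^+ 2 <= C * expR (- c * t)].
  have /expdecay_ge0[C [c [C0 c0 kC]]] := expdecayD (expdecayM eg eg) (expdecayM eh eh).
  by exists C, c; split => // t t0; rewrite !expr2 (le_trans (ler_norm _))// kC.
(* With [N = a^2 + b^2], Young's inequality spends half of the damping [2 al N] on the forcing. The
   bound [d <= - al] uses what is left, [d < c] keeps the forcing decaying after multiplication by
   [e^(dt)], and [K] is the total it can then contribute. *)
pose d : R := Num.min (- al) (c / 2).
have d0 : 0 < d by rewrite lt_min divr_gt0// oppr_gt0 al0.
have dal : al + d <= 0 by rewrite -lerBrDl sub0r ge_min lexx.
have dc : 0 < c - d.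
  have : d <= c / 2 by rewrite ge_min lexx orbT.
  lra.
pose K : R := C / (- al) / (c - d).
have K0 : 0 <= K by rewrite /K !divr_ge0// ltW// oppr_gt0.
have Kcd : K * (c - d) = C / (- al) by rewrite /K divfK// gt_eqF.
pose N t := a t ^+ 2 + b t ^+ 2.
have DN t : D1 N t (2 * al * N t + 2 * (a t * g t + b t * h t)).
  rewrite /N; under eq_fun do rewrite !expr2.
  by apply: D1_eq (D1D (D1M (Da t) (Da t)) (D1M (Db t) (Db t))); ring.
have NK t : 0 <= t -> N t * expR (d * t) <= N 0 + K.
  move=> t0.
  pose F s := - (N s * expR (d * s) + K * expR (- (c - d) * s)).
  have De (e s : R) : D1 (fun s => expR (e * s)) s (e * expR (e * s)).
    apply: D1_eq (D1_expR (D1Zl e (D1_id s))).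
    by rewrite mulr1 mulrC.
  have DF s := D1N (D1D (D1M (DN s) (De d s)) (D1Zl K (De (- (c - d)) s))).
  have := D1_le t0 (fun s _ => DF s); rewrite /F !mulr0 !expR0 !mulr1 lerN2.
  move=> H; have : N t * expR (d * t) + K * expR (- (c - d) * t) <= N 0 + K.
    apply: H => s /andP[s0 _]; rewrite oppr_ge0.
    have Es : expR (- (c - d) * s) = expR (d * s) * expR (- c * s).
      by rewrite -expRD; congr expR; ring.
    rewrite Es.
    set e := expR (d * s); set e' := expR (- c * s).
    have e0 : 0 < e by exact: expR_gt0.
    suff : 2 * al * N s + 2 * (a s * g s + b s * h s) + d * N s
         <= C / (- al) * e'.
      move=> /(ler_wpM2r (ltW e0)); rewrite -subr_le0 => key.
      apply: le_trans key; rewrite le_eqVlt; apply/orP; left; apply/eqP.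
      rewrite -Kcd; ring.
    have kC' := kC s s0.
    have : 2 * (a s * g s + b s * h s) <= - al * N s + (g s ^+ 2 + h s ^+ 2) / (- al).
      rewrite -subr_ge0.
      have -> : - al * N s + (g s ^+ 2 + h s ^+ 2) / (- al)
          - 2 * (a s * g s + b s * h s)
          = ((al * a s + g s) ^+ 2 + (al * b s + h s) ^+ 2) / (- al).
        by rewrite /N; field; lra.
      by rewrite divr_ge0 ?addr_ge0 ?sqr_ge0// oppr_ge0 ltW.
    have : (g s ^+ 2 + h s ^+ 2) / (- al) <= C / (- al) * e'.
      by rewrite mulrAC ler_wpM2r// invr_ge0 oppr_ge0 ltW.
    have N0 : 0 <= N s by rewrite addr_ge0 ?sqr_ge0.
    have := mulr_le0_ge0 dal N0; rewrite mulrDl; lra.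
  by apply: le_trans; rewrite lerDl mulr_ge0 ?expR_ge0.
have M0 : 0 <= N 0 + K by rewrite !addr_ge0 ?sqr_ge0.
have fin x t : 0 <= t -> x ^+ 2 <= N t ->
    `|x| <= Num.sqrt (N 0 + K) * expR (- (d / 2) * t).
  move=> t0 xN; rewrite -ler_sqr ?nnegrE ?mulr_ge0 ?sqrtr_ge0 ?expR_ge0//.
  rewrite real_normK ?num_real// exprMn sqr_sqrtr// -expRM_natl.
  rewrite (_ : 2%:R * (- (d / 2) * t) = - (d * t)); last by field.
  by rewrite expRN ler_pdivlMr ?expR_gt0// (le_trans _ (NK t t0))// ler_wpM2r ?expR_ge0.
split; exists (Num.sqrt (N 0 + K)), (d / 2); split; rewrite ?divr_gt0// => t t0;
  by rewrite fin// /N ?lerDl ?lerDr sqr_ge0.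
Qed.

Lemma integrable_expR_tail C c t : 0 <= C -> 0 < c ->
  (\int[mu]_(s in `[t, +oo[) (C * expR (- c * s))%:E = (C / c * expR (- c * t))%:E)%E.
Proof.
move=> C0 c0.
pose F s := - (C / c) * expR (- c * s).
have DF s : D1 F s (C * expR (- c * s)).
  apply: D1_eq (D1Zl _ (D1_expR (D1Zl (- c) (D1_id s)))).
  by field; lra.
have cF s : {for s, continuous F} by exact: D1_continuous (DF s).
rewrite (@ge0_continuous_FTC2y _ _ F t 0).
- by rewrite /F -EFinB sub0r mulNr opprK.
- by move=> s _; rewrite mulr_ge0 ?expR_ge0.
- apply: continuous_subspaceT => s.
  apply: (@D1_continuous _ _ _ (C * (expR (- c * s) * (- c * 1)))).
  exact: D1Zl (D1_expR (D1Zl (- c) (D1_id s))).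
- rewrite -[X in _ --> X](mulr0 (- (C / c))); apply: cvgMl_tmp.
  under eq_fun do rewrite mulNr.
  have cy : c * x @[x --> +oo] --> +oo by apply: gt0_cvgMry => //; exact: cvg_id.
  exact: (@cvg_comp _ _ _ (fun x => c * x) (fun y => expR (- y)) _ _ _ cy (@cvgr_expR R)).
- by move=> s _; have [] := DF s.
- by apply: cvg_at_right_filter; exact: cF.
- by move=> s _; rewrite derive1E; have [_ ->] := DF s.
Qed.

End exponential_decay.

Section expdecay_integral.
Context {R : realType}.
Notation mu := (@lebesgue_measure R).

Lemma expdecay_integrable (g : R -> R) : continuous g -> expdecay g ->
  mu.-integrable `[0, +oo[ (EFin \o g).
Proof.
move=> cg /expdecay_ge0[C [c [C0 c0 gC]]].
apply/integrableP; split.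
  by apply/measurable_EFinP; apply: measurable_funTS; exact: continuous_measurable_fun.
have fin : (\int[mu]_(s in `[0%R, +oo[) (C * expR (- c * s))%:E < +oo)%E.
  by rewrite integrable_expR_tail// ltry.
apply: le_lt_trans fin.
apply: ge0_le_integral => //=.
- by apply/measurable_EFinP/measurable_funTS; apply: measurableT_comp => //; exact: continuous_measurable_fun.
- apply/measurable_EFinP; apply: measurable_funM => //.
  by apply: measurableT_comp => //; exact: measurable_funM.
- by move=> s; rewrite in_itv/= andbT => s0; rewrite lee_fin gC.
Qed.

Lemma expdecay_tail (g : R -> R) : continuous g -> expdecay g ->
  expdecay (fun t => \int[mu]_(s in `[0, +oo[) g s - \int[mu]_(s in `[0, t]) g s).
Proof.
move=> cg eg; have ig := expdecay_integrable cg eg.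
have [C [c [C0 c0 gC]]] := expdecay_ge0 eg.
exists (C / c), c; split => // t t0.
rewrite Rintegral_itvB//.
have sub : `]t, +oo[ `<=` `[0, +oo[.
  by move=> s /=; rewrite !in_itv/= !andbT => ts; rewrite ltW// (le_lt_trans t0).
have ig' : mu.-integrable `]t, +oo[ (EFin \o g) by apply: integrableS ig.
rewrite -lee_fin EFin_normr_Rintegral//.
apply: le_trans (le_abse_integral _ _ _) _ => //; first exact: measurable_int ig'.
rewrite -(@integrable_expR_tail _ C c t C0 c0).
rewrite -integral_itv_obnd_cbnd; last first.
  apply/measurable_EFinP; apply: measurable_funM => //.
  by apply: measurableT_comp => //; exact: measurable_funM.
apply: ge0_le_integral => //=.
- by apply/measurable_EFinP/measurable_funTS; apply: measurableT_comp => //; exact: continuous_measurable_fun.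
- apply/measurable_EFinP; apply: measurable_funM => //.
  by apply: measurableT_comp => //; exact: measurable_funM.
- move=> s; rewrite in_itv/= andbT => ts; rewrite lee_fin gC//.
  by rewrite (le_trans t0)// ltW.
Qed.

(* Integrating from [-1] makes [0] an interior point, where the integral is
   differentiable. *)
Lemma D1_integral (g : R -> R) : continuous g ->
  exists F : R -> R, [/\ F 0 = 0, forall t, 0 <= t -> D1 F t (g t) &
    forall t, 0 <= t -> \int[mu]_(s in `[0, t]) g s = F t].
Proof.
move=> cg.
have ig (a b : R) : mu.-integrable `[a, b] (EFin \o g).
  apply: continuous_compact_integrable; first exact: segment_compact.
  exact: continuous_subspaceT.
pose F0 t := \int[mu]_(s in `[-1, t]) g s.
exists (fun t => F0 t - F0 0); split; first by rewrite subrr.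
  move=> t t0; rewrite -[g t]subr0; apply: D1B; last exact: D1_cst.
  have tn1 : -1 < t by rewrite (lt_le_trans _ t0)// ltrN10.
  have [|d1 d2] := @continuous_FTC1_closed _ g (-1) t (t + 1) _ (ig _ _) tn1 (cg t).
    by rewrite ltrDl.
  by apply: DeriveDef; [exact: d1|rewrite -derive1E; exact: d2].
move=> t t0; rewrite /F0 Rintegral_itvB// ?bnd_simp ?lerN10//.
rewrite Rintegral_itv_obnd_cbnd//.
by apply: integrableS (ig 0 t) => //; apply: subset_itv; rewrite bnd_simp.
Qed.

End expdecay_integral.

(** * Decay of the exponential of a stable matrix *)

Section hurwitz.
Context {R : realType}.

(** In complex notation [M = U + iV], [z = al + i be] and [N1 + i N2 = (B - z) M]. As [(e^(tB) M)' =
    z e^(tB) M + e^(tB) (B - z) M], decay of the forcing term is inherited by [e^(tB) M]. *)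
Lemma mul_expmx_decay {n} (B U V N1 N2 : 'M[R]_n) (al be : R) : al < 0 ->
  N1 = B *m U - al *: U + be *: V -> N2 = B *m V - al *: V - be *: U ->
  (forall i j, expdecay (fun t => (expmx (t *: B) *m N1) i j)) ->
  (forall i j, expdecay (fun t => (expmx (t *: B) *m N2) i j)) ->
  forall i j, expdecay (fun t => (expmx (t *: B) *m U) i j) /\
              expdecay (fun t => (expmx (t *: B) *m V) i j).
Proof.
move=> al0 N1E N2E e1 e2 i j.
apply: (damped_rotation_decay (be := be) al0 _ _ (e1 i j) (e2 i j)) => t.
  apply: D1_eq (mderivMr U (mderiv_expmx B t) i j).
  by rewrite N1E expmxC -mulmxA !mulmxDr mulmxN -!scalemxAr !mxE; ring.
apply: D1_eq (mderivMr V (mderiv_expmx B t) i j).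
by rewrite N2E expmxC -mulmxA !mulmxDr !mulmxN -!scalemxAr !mxE; ring.
Qed.

Local Notation cplx := (real_complex R).

(** By Cayley-Hamilton the product of the [B - z] over the roots [z] of the characteristic
    polynomial is [0], which decays trivially. Stripping the factors off one by one with
    [mul_expmx_decay] ends at the identity; no Jordan form is involved. *)
Lemma hurwitz_expmx_decay {n} (B : 'M[R]_n) : hurwitzmx B ->
  forall i j, expdecay (fun t => expmx (t *: B) i j).
Proof.
case: n B => [|n] B hB; first by move=> [].
pose Bc := map_mx cplx B.
pose re (M : 'M[R[i]]_n.+1) := map_mx (@complex.Re R) M.
pose im (M : 'M[R[i]]_n.+1) := map_mx (@complex.Im R) M.
pose dec (M : 'M[R[i]]_n.+1) := forall i j,
  expdecay (fun t => (expmx (t *: B) *m re M) i j) /\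
  expdecay (fun t => (expmx (t *: B) *m im M) i j).
have ReM (z w : R[i]) :
    complex.Re (z * w) = complex.Re z * complex.Re w - complex.Im z * complex.Im w.
  by case: z; case: w.
have ImM (z w : R[i]) :
    complex.Im (z * w) = complex.Re z * complex.Im w + complex.Im z * complex.Re w.
  by case: z; case: w.
have step (z : R[i]) M : complex.Re z < 0 -> dec ((Bc - z%:M) *m M) -> dec M.
  move=> z0 d; apply: (mul_expmx_decay z0 _ _ (fun i j => (d i j).1) (fun i j => (d i j).2)
    (be := complex.Im z)).
  - apply/matrixP => i j; rewrite mulmxBl mul_scalar_mx !mxE.
    rewrite [complex.Re _]raddfB/= ReM [complex.Re _]raddf_sum/=.
    under eq_bigr do rewrite mxE ReM/= mul0r subr0.
    by under [in RHS]eq_bigr do rewrite mxE; ring.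
  - apply/matrixP => i j; rewrite mulmxBl mul_scalar_mx !mxE.
    rewrite [complex.Im _]raddfB/= ImM [complex.Im _]raddf_sum/=.
    under eq_bigr do rewrite mxE ImM/= mul0r addr0.
    by under [in RHS]eq_bigr do rewrite mxE; ring.
have [r rE] := closed_field_poly_normal (char_poly Bc).
rewrite (monicP (char_poly_monic Bc)) scale1r in rE.
have rneg z : z \in r -> complex.Re z < 0.
  by move=> zr; apply: hB; rewrite eigenvalue_root_char rE root_prod_XsubC.
have red (s : seq R[i]) M : {in s, forall z, complex.Re z < 0} ->
    dec (\prod_(z <- s) (Bc - z%:M) * M) -> dec M.
  elim: s M => [|z s IH] M sneg; first by rewrite big_nil mul1r.
  rewrite big_cons -mulrA => /step d.
  apply: IH => [w ws|]; first by apply: sneg; rewrite inE ws orbT.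
  by apply: d; apply: sneg; rewrite inE eqxx.
have d1 : dec 1.
  apply: (red r) => //.
  have -> : \prod_(z <- r) (Bc - z%:M) = 0.
    have := Cayley_Hamilton Bc; rewrite rE rmorph_prod/= => <-.
    by apply: eq_bigr => z _; rewrite rmorphB/= horner_mx_X horner_mx_C.
  have re0 : re 0 = 0 by apply/matrixP => i j; rewrite !mxE.
  have im0 : im 0 = 0 by apply/matrixP => i j; rewrite !mxE.
  rewrite mul0r => i j; rewrite re0 im0.
  by under eq_fun do rewrite mulmx0 mxE; split; exact: expdecay0.
move=> i j; have [+ _] := d1 i j.
have -> : re 1 = 1%:M.
  by apply/matrixP => a b; rewrite /re -[1]/(1%:M) !mxE; case: (a == b).
by under eq_fun do rewrite mulmx1.
Qed.

End hurwitz.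

(** * The covariance matrices *)

Section covariance.
Context {R : realType} {n : nat} (Q B : 'M[R]_n).
Notation mu := (@lebesgue_measure R).

Definition OUmx (t : R) : 'M[R]_n := expmx (t *: B) *m Q *m (expmx (t *: B))^T.

Lemma mderiv_OUmx t : mderiv OUmx t (B *m OUmx t + OUmx t *m B^T).
Proof.
apply: mderiv_eq (mderivM (mderivMr Q (mderiv_expmx B t))
  (mderiv_tr (mderiv_expmx B t))).
by rewrite /OUmx trmx_mul !mulmxA.
Qed.

Lemma OUmxD s t : OUmx (s + t) = expmx (s *: B) *m OUmx t *m (expmx (s *: B))^T.
Proof. by rewrite /OUmx expmxD trmx_mul !mulmxA. Qed.

Lemma OUcov_fin t i j :
  OUcov Q B t%:E i j = \int[mu]_(s in `[0, t]) OUmx s i j.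
Proof.
rewrite mxE; congr Rintegral.
  apply/seteqP; split => s /=; rewrite in_itv/= lee_fin; first by case=> -> ->.
  by move=> /andP[].
by apply/funext => s; rewrite /OUmx expmx_tr.
Qed.

Lemma OUcov_infty i j :
  OUcov Q B +oo i j = \int[mu]_(s in `[0, +oo[) OUmx s i j.
Proof.
rewrite mxE; congr Rintegral.
  apply/seteqP; split => s /=; rewrite in_itv/= leey andbT; first by case.
  by [].
by apply/funext => s; rewrite /OUmx expmx_tr.
Qed.

Hypotheses (Q_posdef : posdefmx Q) (B_stable : hurwitzmx B).

Lemma OUcov_tr t : (OUcov Q B t)^T = OUcov Q B t.
Proof.
have [QT _] := Q_posdef.
have sym s : (expmx (s *: B) *m Q *m expmx (s *: B^T))^T
    = expmx (s *: B) *m Q *m expmx (s *: B^T).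
  by rewrite !trmx_mul QT expmx_tr trmxK mulmxA.
apply/matrixP => i j; rewrite !mxE; congr Rintegral; apply/funext => s.
by rewrite -[in LHS]sym mxE.
Qed.

Lemma OUmx_decay i j : expdecay (fun t => OUmx t i j).
Proof.
have eB := hurwitz_expmx_decay B_stable.
rewrite /OUmx; under eq_fun do rewrite mxE.
apply: expdecay_sum => k; apply: expdecayM; last by under eq_fun do rewrite mxE.
under eq_fun do rewrite mxE.
apply: expdecay_sum => l; under eq_fun do rewrite mulrC.
exact/expdecayZ/eB.
Qed.

(** [OUcov] vanishes at negative times and need not be differentiable at [0]. [S] extends it across
    [0], and from here on the covariances are known only through [S 0 = 0], the derivative of [S]
    and the rate of convergence at infinity. *)
Lemma OUcov_primitive : exists S : R -> 'M[R]_n,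
  [/\ S 0 = 0, forall t, 0 <= t -> mderiv S t (OUmx t),
      forall t, 0 <= t -> OUcov Q B t%:E = S t &
      forall i j, expdecay (fun t => (OUcov Q B +oo - S t) i j)].
Proof.
have cG i j : continuous (fun s => OUmx s i j).
  by move=> s; apply: D1_continuous (mderiv_OUmx s i j).
have H (ij : 'I_n * 'I_n) := D1_integral (cG ij.1 ij.2).
have [F HF] := choice H.
exists (fun t => \matrix_(i, j) F (i, j) t); split.
- by apply/matrixP => i j; rewrite !mxE; have [] := HF (i, j).
- move=> t t0 i j; under eq_fun do rewrite mxE.
  by have [_ /(_ t t0)] := HF (i, j).
- move=> t t0; apply/matrixP => i j; rewrite OUcov_fin [RHS]mxE.
  by have [_ _ /(_ t t0)] := HF (i, j).
move=> i j; have [C [c [c0 H']]] := expdecay_tail (cG i j) (OUmx_decay i j).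
exists C, c; split => // t t0; rewrite mxE OUcov_infty [X in _ + X]mxE [X in _ - X]mxE.
by have [_ _ /(_ t t0) <-] := HF (i, j); exact: H'.
Qed.

Lemma mderiv_eq_on (F H : R -> 'M[R]_n) dF t : 0 <= t ->
  (forall s, 0 <= s -> mderiv F s (dF s)) -> (forall s, 0 <= s -> mderiv H s (dF s)) ->
  F 0 = H 0 -> F t = H t.
Proof.
move=> t0 DF DH FH0; apply/matrixP => i j.
suff : `|F t i j - H t i j - (F 0 i j - H 0 i j)| <= 0.
  by rewrite FH0 subrr subr0 normr_le0 subr_eq0 => /eqP.
rewrite -[leRHS](subrr 0); apply: (@D1_dominated _ (fun s => F s i j - H s i j)
  (fun=> 0) (fun=> 0) (fun=> 0)) => //.
- move=> s /andP[s0 _]; rewrite -(subrr (dF s i j)).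
  by apply: D1B; [exact: DF|exact: DH].
- by move=> s _; exact: D1_cst.
- by move=> s _; rewrite normr0.
Qed.

(** With [E = e^(tB)], both sides of [S (t + r) = S t + E (S r) E^T] have the same derivative in
    [r]. Letting [r] grow, the defect of the claimed identity does not depend on [r] and yet decays,
    so it is zero. *)
Lemma OUcov_invariant t : 0 <= t ->
  OUcov Q B +oo = OUcov Q B t%:E
    + expmx (t *: B) *m OUcov Q B +oo *m (expmx (t *: B))^T.
Proof.
move=> t0; have [S [S0 DS SE dP]] := OUcov_primitive.
rewrite (SE t t0); set P := OUcov Q B +oo in dP *; set E := expmx _.
have SD r : 0 <= r -> S (t + r) = S t + E *m S r *m E^T.
  move=> r0; apply: (@mderiv_eq_on (fun r => S (t + r))
    (fun r => S t + E *m S r *m E^T) (fun r => OUmx (t + r)) r r0).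
  - move=> s s0; have /DS D : 0 <= t + s by rewrite addr_ge0.
    have := @mderiv_shift _ _ _ S t 1 s (OUmx (t + s)).
    by rewrite scale1r mul1r; under eq_fun do rewrite mul1r; apply.
  - move=> s s0; rewrite OUmxD -[_ *m _ *m _]add0r.
    apply: mderivD; first exact: mderiv_cst.
    exact/mderivMr/mderivMl/DS.
  - by rewrite addr0 S0 mulmx0 mul0mx addr0.
apply/eqP; rewrite -subr_eq0; apply/eqP/matrixP => i j; rewrite [RHS]mxE.
apply: expdecay_cst.
have : expdecay (fun r => (P - S (t + r)) i j - (E *m (P - S r) *m E^T) i j).
  apply: expdecayB; first exact: (expdecay_shift t0 (dP i j)).
  under eq_fun do rewrite mxE; apply: expdecay_sum => k.
  under eq_fun do rewrite mulrC; apply: expdecayZ.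
  under eq_fun do rewrite mxE; apply: expdecay_sum => l.
  exact/expdecayZ/dP.
move=> [C [c [c0 H]]]; exists C, c; split => // r r0.
rewrite (le_trans _ (H r r0))// SD// mulmxBr mulmxBl !mxE.
by rewrite le_eqVlt; apply/orP; left; apply/eqP; congr `|_|; ring.
Qed.

(** Negative times are included in order to bound the inverse of [e^(tB)] as well. The sum of
    squares turns all entries into one continuous function on a compact interval. *)
Lemma expmx_uniform_bound : exists2 K, 0 < K &
  forall t i j, -1 <= t <= 1 -> `|expmx (t *: B) i j| <= K.
Proof.
pose f t := \sum_(ij : 'I_n * 'I_n) expmx (t *: B) ij.1 ij.2 ^+ 2.
have cf : {within `[-1, 1], continuous f}.
  apply: derivable_within_continuous => t _.
  rewrite /f; under eq_fun do under eq_bigr do rewrite expr2.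
  have := @D1_sum R _ (index_enum _) (fun (ij : 'I_n * 'I_n) t =>
    expmx (t *: B) ij.1 ij.2 * expmx (t *: B) ij.1 ij.2) _ t (fun ij =>
     D1M (mderiv_expmx B t ij.1 ij.2) (mderiv_expmx B t ij.1 ij.2)).
  by case.
have [|c _ fc] := EVT_max _ cf; first by rewrite (le_trans (lerN10 _)).
have f0 t : 0 <= f t by apply: sumr_ge0 => ij _; exact: sqr_ge0.
exists (f c + 1); first by rewrite ltr_wpDl.
move=> t i j tt; have := fc t; rewrite in_itv/= => /(_ tt) ftc.
have : expmx (t *: B) i j ^+ 2 <= f t.
  rewrite /f (bigD1 (i, j))//= lerDl; apply: sumr_ge0 => ij _; exact: sqr_ge0.
set e := expmx _ _ _ => ef.
have := sqr_ge0 (`|e| - 1); rewrite sqrrB1 real_normK ?num_real//.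
have := normr_ge0 e; lra.
Qed.

(* Each bound is what Taylor's formula at [t = 0] gives. *)
Lemma OU_estimates : exists l u K : R, [/\ 0 < l, 0 < u & 0 < K] /\ [/\
  form_between l u (OUcov Q B +oo),
  forall t, 0 < t <= 1 -> form_between (l * t) (u * t) (OUcov Q B t%:E),
  forall t x, 0 < t <= 1 -> enorm (expmx (t *: B) *m x - x) <= K * t * enorm x,
  forall t x, 0 < t <= 1 -> enorm x <= K * enorm (expmx (t *: B) *m x) &
  forall t i j, 0 < t <= 1 -> `|OUcov Q B t%:E i j| <= K * t /\ `|OUmx t i j| <= K].
Proof.
have [lQ [uQ [lQ0 uQ0 Qlu]]] := posdef_form_between Q_posdef.
have [k k0 Ek] := expmx_uniform_bound.
pose K1 : R := (n * n)%:R * k + 1.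
have K10 : 0 < K1 by rewrite ltr_wpDl// mulr_ge0// ltW.
have EK t x : -1 <= t <= 1 -> enorm (expmx (t *: B) *m x) <= K1 * enorm x.
  move=> tt; rewrite (le_trans (enorm_mulmx _ (fun i j => Ek t i j tt)))//.
  by rewrite ler_wpM2r ?enorm_ge0// lerDl.
have ETK t x : -1 <= t <= 1 -> enorm ((expmx (t *: B))^T *m x) <= K1 * enorm x.
  move=> tt; rewrite (le_trans (@enorm_mulmx _ _ _ k _ _))//.
    by move=> i j; rewrite mxE Ek.
  by rewrite ler_wpM2r ?enorm_ge0// lerDl.
have tt (t : R) : 0 < t <= 1 -> -1 <= t <= 1.
  by move=> /andP[t0 ->]; rewrite andbT (le_trans (lerN10 _))// ltW.
have tt' (t : R) : 0 <= t <= 1 -> (-1 <= t <= 1) /\ (-1 <= - t <= 1).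
  move=> /andP[t0 t1]; split; apply/andP; split; lra.
have ETK' t x : 0 <= t <= 1 -> enorm x <= K1 * enorm ((expmx (t *: B))^T *m x).
  move=> t01; have := ETK (- t) ((expmx (t *: B))^T *m x) (tt' t t01).2.
  by rewrite mulmxA -trmx_mul -expmxD subrr expmx0 trmx1 mul1mx.
have EK' t x : 0 <= t <= 1 -> enorm x <= K1 * enorm (expmx (t *: B) *m x).
  move=> t01; have := EK (- t) (expmx (t *: B) *m x) (tt' t t01).2.
  by rewrite mulmxA expmxV mul1mx.
have Gform t x : 0 <= t <= 1 ->
    lQ / K1 ^+ 2 * inner x x <= inner (OUmx t *m x) x <= uQ * K1 ^+ 2 * inner x x.
  move=> t01; have -> : inner (OUmx t *m x) x =
      inner (Q *m ((expmx (t *: B))^T *m x)) ((expmx (t *: B))^T *m x).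
    by rewrite /OUmx -!mulmxA inner_mull.
  set y := _ *m x; rewrite -!enorm_sqr; apply/andP; split.
    rewrite (le_trans _ (form_ge Qlu _))// -mulrA ler_wpM2l ?(ltW lQ0)//.
    rewrite ler_pdivrMl ?exprn_gt0// -exprMn ler_sqr ?nnegrE ?mulr_ge0 ?enorm_ge0 ?(ltW K10)//.
    exact: ETK'.
  rewrite (le_trans (form_le Qlu _))// -mulrA ler_wpM2l ?(ltW uQ0)// -exprMn.
  rewrite ler_sqr ?nnegrE ?mulr_ge0 ?enorm_ge0 ?(ltW K10)//.
  by apply: ETK; exact: (tt' t t01).1.
have [S [S0 DS SE dP]] := OUcov_primitive.
have DSx x t : 0 <= t -> D1 (fun s => inner (S s *m x) x) t (inner (OUmx t *m x) x).
  move=> t0; have := D1_inner (mderivMr x (DS t t0)) (mderiv_cst x t).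
  by rewrite inner0r addr0.
have Slu x t : 0 <= t <= 1 ->
    lQ / K1 ^+ 2 * t * inner x x <= inner (S t *m x) x <= uQ * K1 ^+ 2 * t * inner x x.
  move=> /andP[t0 t1].
  have Dl (c s : R) : D1 (fun s => c * s * inner x x) s (c * inner x x).
    apply: D1_eq (D1M (D1Zl c (D1_id s)) (D1_cst _ s)); ring.
  have s01 (s : R) : 0 <= s <= t -> 0 <= s <= 1.
    by move=> /andP[-> /le_trans]; apply.
  apply/andP; split.
    have := @D1_le _ (fun s => inner (S s *m x) x - lQ / K1 ^+ 2 * s * inner x x) _ 0 t t0
      (fun s hs => D1B (DSx x s (proj1 (andP hs))) (Dl _ s)).
    rewrite S0 mul0mx inner0l mulr0 mul0r subr0 subr_ge0; apply => s hs.
    by rewrite subr_ge0; have /andP[] := Gform s x (s01 s hs).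
  have := @D1_le _ (fun s => uQ * K1 ^+ 2 * s * inner x x - inner (S s *m x) x) _ 0 t t0
    (fun s hs => D1B (Dl _ s) (DSx x s (proj1 (andP hs)))).
  rewrite S0 mul0mx inner0l mulr0 mul0r subr0 subr_ge0; apply => s hs.
  by rewrite subr_ge0; have /andP[] := Gform s x (s01 s hs).
have [uP uP0 Pu] := enorm_mulmx_bounded (OUcov Q B +oo).
(* [Q_oo] dominates [Q_1], which has the bound already: [S] is nondecreasing as a form, and its
   exponential convergence carries [S 1 <= S (1 + t)] to the limit. *)
have Pge x : lQ / K1 ^+ 2 * inner x x <= inner (OUcov Q B +oo *m x) x.
  have /andP[h _] : lQ / K1 ^+ 2 * 1 * inner x x <= inner (S 1 *m x) x <= uQ * K1 ^+ 2 * 1 * inner x x.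
    by apply: Slu; rewrite ler01 lexx.
  rewrite mulr1 in h; apply: (le_trans h).
  rewrite -subr_ge0; apply: (@expdecay_le _ (fun t => inner ((OUcov Q B +oo - S (1 + t)) *m x) x)).
    under eq_fun do rewrite innerE; apply: expdecay_sum => i.
    under eq_fun do rewrite mulrC; apply: expdecayZ.
    under eq_fun do rewrite mxE; apply: expdecay_sum => j.
    under eq_fun do rewrite mulrC; apply: expdecayZ.
    exact: expdecay_shift (dP i j).
  move=> t t0; rewrite mulmxBl innerBl lerB//.
  apply: (@D1_le _ (fun s => inner (S s *m x) x) (fun s => inner (OUmx s *m x) x)).
  - by rewrite lerDl.
  - by move=> s /andP[s1 _]; apply: DSx; rewrite (le_trans ler01).
  - move=> s _; rewrite /OUmx -!mulmxA inner_mull.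
    exact: form_ge0 Qlu _.
have [q q0 Qq] := enorm_mulmx_bounded Q.
have [b b0 Bb] := enorm_mulmx_bounded B.
pose k3 : R := K1 * (q * K1); pose k2 : R := b * K1.
have k30 : 0 < k3 by rewrite !mulr_gt0.
have k20 : 0 < k2 by rewrite !mulr_gt0.
have Gk t i j : 0 <= t <= 1 -> `|OUmx t i j| <= k3.
  move=> t01; apply: coef_bound => x; rewrite /OUmx -!mulmxA.
  rewrite (le_trans (EK _ _ (tt' t t01).1))// /k3 -!mulrA ler_wpM2l ?(ltW K10)//.
  rewrite (le_trans (Qq _))// ler_wpM2l ?(ltW q0)//.
  by apply: ETK; exact: (tt' t t01).1.
have s01 (t s : R) : 0 < t <= 1 -> 0 <= s <= t -> 0 <= s <= 1.
  by move=> /andP[_ t1] /andP[-> /le_trans]; apply.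
have Dk (k' s : R) : D1 (fun s => k' * s) s k'.
  by apply: D1_eq (D1Zl k' (D1_id s)); rewrite mulr1.
have Sk t i j : 0 < t <= 1 -> `|S t i j| <= k3 * t.
  move=> t01; have t0 : 0 <= t by case/andP: t01 => /ltW.
  have -> : S t i j = S t i j - S 0 i j by rewrite S0 mxE subr0.
  rewrite -[leRHS]subr0 -[X in _ <= _ - X](mulr0 k3).
  apply: (@D1_dominated _ (fun s => S s i j) (fun s => OUmx s i j)
    (fun s => k3 * s) (fun=> k3)) => // s st.
    by apply: DS; case/andP: st.
  by apply: Gk; exact: s01 st.
have Ek2 t i j : 0 < t <= 1 -> `|(expmx (t *: B) - 1%:M) i j| <= k2 * t.
  move=> t01; have t0 : 0 <= t by case/andP: t01 => /ltW.
  rewrite -(expmx0 B) -[leRHS]subr0 -[X in _ <= _ - X](mulr0 k2) mxE [X in _ + X]mxE.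
  apply: (@D1_dominated _ (fun s => expmx (s *: B) i j)
    (fun s => (B *m expmx (s *: B)) i j) (fun s => k2 * s) (fun=> k2)) => // s st.
    exact: mderiv_expmx.
  apply: coef_bound => x; rewrite -mulmxA (le_trans (Bb _))// /k2 -mulrA.
  rewrite ler_wpM2l ?(ltW b0)//; apply: EK; exact: (tt' s (s01 t s t01 st)).1.
pose K : R := K1 + k3 + (n * n)%:R * k2.
have nk2 : 0 <= (n * n)%:R * k2 by rewrite mulr_ge0// ltW.
have K1K : K1 <= K by rewrite /K; lra.
have k3K : k3 <= K by rewrite /K; lra.
have k2K : (n * n)%:R * k2 <= K by rewrite /K; lra.
have ge01 (t : R) : 0 < t <= 1 -> 0 <= t <= 1 by move=> /andP[/ltW -> ->].
(* One pair of constants serves [Q_oo] and all [Q_t / t]; [uP] is the norm bound of [Q_oo]. *)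
exists (lQ / K1 ^+ 2), (uQ * K1 ^+ 2 + uP), K; split; split.
- by rewrite divr_gt0 ?exprn_gt0.
- by rewrite addr_gt0 ?mulr_gt0 ?exprn_gt0.
- exact: lt_le_trans K1K.
- split=> [|x]; first exact: OUcov_tr.
  rewrite Pge/= (le_trans (ler_norm _))// (le_trans (inner_CS _ _))//.
  rewrite mulrDl ler_wpDl//.
    by rewrite mulr_ge0 ?inner_ge0// mulr_ge0 ?(ltW uQ0)// exprn_ge0 ?(ltW K10).
  by rewrite -enorm_sqr expr2 mulrA ler_wpM2r ?enorm_ge0.
- move=> t t01; split=> [|x]; first exact: OUcov_tr.
  have t0 : 0 <= t by case/andP: t01 => /ltW.
  rewrite SE//; have /andP[-> h] := Slu x t (ge01 t t01).
  rewrite (le_trans h)// ler_wpM2r ?inner_ge0// ler_wpM2r// lerDl ltW//.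
- move=> t x t01; have t0 : 0 <= t by case/andP: t01 => /ltW.
  rewrite -[X in _ - X]mul1mx -mulmxBl.
  rewrite (le_trans (enorm_mulmx _ (fun i j => Ek2 t i j t01)))//.
  by rewrite mulrA ler_wpM2r ?enorm_ge0// ler_wpM2r.
- move=> t x t01; rewrite (le_trans (EK' t x (ge01 t t01)))//.
  by rewrite ler_wpM2r ?enorm_ge0.
- move=> t i j t01; have t0 : 0 <= t by case/andP: t01 => /ltW.
  rewrite SE//; split; last by rewrite (le_trans (Gk t i j (ge01 t t01))).
  by rewrite (le_trans (Sk t i j t01))// ler_wpM2r.
Qed.

End covariance.

(** * Pointwise bounds on the kernel *)

Section scalar_bounds.
Context {R : realType}.
Implicit Types (k y s : R).

Lemma expr_expRN_bound (m : nat) k : 0 < k ->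
  exists2 C, 0 < C & forall y, 0 <= y -> y ^+ m * expR (- (k * y)) <= C.
Proof.
move=> k0; exists (m`!%:R / k ^+ m); first by rewrite divr_gt0 ?exprn_gt0// ltr0n fact_gt0.
move=> y y0; suff h : (k * y) ^+ m <= m`!%:R * expR (k * y).
  rewrite expRN ler_pdivrMr ?expR_gt0// mulrAC ler_pdivlMr ?exprn_gt0//.
  by rewrite -exprMn [y * k]mulrC.
have ky0 : 0 <= k * y by rewrite mulr_ge0// ltW.
case: m => [|m]; first by rewrite expr0 fact0 mul1r -expR0 ler_expR.
rewrite [leRHS]mulrC -ler_pdivrMr ?ltr0n ?fact_gt0//.
by rewrite (le_trans _ (expR_ge1Dxn m ky0))// lerDr.
Qed.

(** Here [s] stands for the rescaled time [t (1 + |u|)^2]: [e^(-k/s)] absorbs the powers of [1/s],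
    and [e^(-ks) = e^k e^(-k(1+s))] absorbs [(1 + s)^2]. *)
Lemma time_profile_bound (n : nat) k : 0 < k ->
  exists2 C, 0 < C & forall s, 0 < s ->
    (s^-1 ^+ n + 1) * s^-1 * expR (- (k / s) - k * s) <= C / (1 + s) ^+ 2.
Proof.
move=> k0.
have [C1 C10 H1] := @expr_expRN_bound n.+1 k k0.
have [C2 C20 H2] := @expr_expRN_bound 1 k k0.
have [C3 C30 H3] := @expr_expRN_bound 2 k k0.
exists ((C1 + C2) * (C3 * expR k)); first by rewrite mulr_gt0 ?addr_gt0 ?mulr_gt0 ?expR_gt0.
move=> s s0; have s1 : 0 < 1 + s by rewrite addr_gt0.
have si0 : 0 <= s^-1 by rewrite invr_ge0 ltW.
rewrite ler_pdivlMr ?exprn_gt0// expRD.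
have -> : (s^-1 ^+ n + 1) * s^-1 * (expR (- (k / s)) * expR (- (k * s))) * (1 + s) ^+ 2
   = (s^-1 ^+ n.+1 * expR (- (k / s)) + s^-1 ^+ 1 * expR (- (k / s)))
     * ((1 + s) ^+ 2 * expR (- (k * (1 + s))) * expR k).
  have -> : expR (- (k * s)) = expR (- (k * (1 + s))) * expR k.
    by rewrite -expRD; congr expR; ring.
  by rewrite (exprS s^-1 n) expr1; move: (s^-1 ^+ n) (s^-1) => w v; ring.
rewrite ler_pM//.
- by rewrite addr_ge0 ?mulr_ge0 ?exprn_ge0 ?expR_ge0.
- by rewrite !mulr_ge0 ?exprn_ge0 ?expR_ge0// ltW.
- by rewrite lerD ?H1 ?H2.
- by rewrite ler_wpM2r ?expR_ge0// H3// ltW.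
Qed.

End scalar_bounds.

Section kernel.
Context {R : realType} {n : nat} (Q B : 'M[R]_n).
Hypotheses (Q_posdef : posdefmx Q) (B_stable : hurwitzmx B).
Implicit Types (x u v y : 'cV[R]_n) (t : R).

Let P := OUcov Q B +oo%E.

Definition OUker t x u : R := gauss_pdf (OUcov Q B t%:E) (expmx (t *: B) *m x - u).

Definition OUpot x : R := 2^-1 * inner (invmx P *m x) x.

(** The Gaussian exponent of the overview, up to constants. It is written with [e^(tB) x - u], the
    vector in the kernel; [action_dominates] passes to [x - u]. *)
Definition OUaction t x u : R :=
  `|enorm (expmx (t *: B) *m x - u)| ^+ 2 / t + t * enorm u ^+ 2.

Let quad t x u : R :=
  inner (invmx (OUcov Q B t%:E) *m (expmx (t *: B) *m x - u))
        (expmx (t *: B) *m x - u).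

(* Completing the square in the reversed process: [quad t x u + 2 OUpot x] is a
   quadratic form in [(x, u)] whose marginal in [u] is [2 OUpot u]. *)
Lemma quad_reversed : exists2 c, 0 < c & forall t x u, 0 < t <= 1 ->
  c / t * enorm (expmx (t *: B) *m x - u + OUcov Q B t%:E *m (invmx P *m u)) ^+ 2
   <= quad t x u - 2 * OUpot u + 2 * OUpot x.
Proof.
have [l [b [K [[l0 b0 K0] [PF SF _ _ _]]]]] := OU_estimates Q_posdef B_stable.
exists b^-1; first by rewrite invr_gt0.
move=> t x u t01; have /andP[t0 t1] := t01.
set E := expmx (t *: B); set S := OUcov Q B t%:E; set z := invmx P *m u.
set y := E *m x - u; set g := y + S *m z.
have lt0 : 0 < l * t by rewrite mulr_gt0.
have bt0 : 0 < b * t by rewrite mulr_gt0.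
have SF' := SF t t01.
(* The reciprocal of the upper bound of [S]: below, shifting the trial vector by [s g] gains
   [2 s |g|^2] and costs [s^2 <S g, g> <= s |g|^2]. *)
pose s := (b * t)^-1; have s0 : 0 < s by rewrite invr_gt0.
have UP : P \in unitmx := form_unitmx l0 PF.
have Pz : P *m z = u by rewrite /z mulKVmx.
have ST : S^T = S by have [] := SF'.
(* The trial vectors are [z - s g] for [quad] and [E^T z] for [OUpot x]. Without the shift by [s g]
   the two lower bounds add up to exactly [2 OUpot u], by the invariance identity that enters in
   [PSE]. *)
have hq : 2 * inner (z - s *: g) (u - E *m x) - inner (S *m (z - s *: g)) (z - s *: g)
    <= quad t x u.
  rewrite /quad -/E -/S -/y.
  have -> : inner (invmx S *m y) y = inner (invmx S *m (u - E *m x)) (u - E *m x).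
    by rewrite -[u - _]opprB -/y mulmxN innerNl innerNr opprK.
  rewrite (form_invmx_variational lt0 SF' (u - E *m x) (z - s *: g)).
  by rewrite lerDl (form_invmx_ge0 lt0 SF').
have hx : 2 * inner (E^T *m z) x - inner (P *m (E^T *m z)) (E^T *m z) <= 2 * OUpot x.
  rewrite /OUpot mulrA mulfV// mul1r.
  rewrite (form_invmx_variational l0 PF x (E^T *m z)).
  by rewrite lerDl (form_invmx_ge0 l0 PF).
have PSE : inner (P *m (E^T *m z)) (E^T *m z) = inner u z - inner (S *m z) z.
  rewrite -{1}Pz -innerBl -mulmxBl /P [in RHS](OUcov_invariant Q B_stable (ltW t0)).
  rewrite -/S addrC addKr -/E -/P -!mulmxA.
  by rewrite [RHS]inner_mull.
have hg : inner (S *m g) g <= b * t * inner g g.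
  by rewrite -enorm_sqr; exact: form_le SF' g.
have sg : s ^+ 2 * inner (S *m g) g <= s * inner g g.
  rewrite expr2 -mulrA ler_wpM2l ?(ltW s0)// /s ler_pdivrMl//.
have -> : b^-1 / t * enorm g ^+ 2 = s * inner g g.
  by rewrite enorm_sqr /s invfM.
have pu : 2 * OUpot u = inner u z by rewrite /OUpot mulrA mulfV// mul1r innerC.
rewrite pu.
have gE : inner g g = inner g (E *m x) - inner g u + inner g (S *m z).
  by rewrite {2}/g /y !(innerDr, innerNr).
have Sgz : inner (S *m z) g = inner g (S *m z) by rewrite innerC.
have Sgz' : inner (S *m g) z = inner g (S *m z) by rewrite inner_mull ST.
have zx : inner (E^T *m z) x = inner z (E *m x) by rewrite inner_mull trmxK.
clearbody g; move: hq hx; rewrite PSE zx mulmxBr -scalemxAr.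
rewrite !(innerDl, innerDr, innerNl, innerNr, innerZl, innerZr) Sgz Sgz'.
rewrite (innerC u z) => hq hx.
have sgE : s * inner g g = s * inner g (E *m x) - s * inner g u + s * inner g (S *m z).
  by rewrite gE; ring.
rewrite expr2 -mulrA in sg; lra.
Qed.

(** Twice the right-hand side is the combination of [quad] and [quad - 2 OUpot u + 2 OUpot x] with
    weights [1 - th] and [th]. They bound [|y|^2 / t] and [|y + S z|^2 / t]; hence [|S z|^2 / t] is
    bounded too, and [|S z|] is at least a multiple of [t |u|]. *)
Lemma quad_lower th : 0 < th < 1 -> exists2 c, 0 < c & forall t x u, 0 < t <= 1 ->
  c * OUaction t x u <= quad t x u / 2 - th * (OUpot u - OUpot x).
Proof.
move=> /andP[th0 th1].
have [l [b [K [[l0 b0 K0] [PF SF _ _ _]]]]] := OU_estimates Q_posdef B_stable.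
have [c c0 Hc] := quad_reversed.
pose m := Num.min (th * c) ((1 - th) / b).
have m0 : 0 < m by rewrite lt_min mulr_gt0//= divr_gt0// subr_gt0.
(* Available is [m (Y + G) / 2]. The first bound spends [m Y / 4] on [Y]; the second spends at most
   [m (Y + G) / 4] on [U], because [|S z|^2 <= 2 G + 2 Y]. *)
pose e := Num.min (m / 4) (m / 8 * (l / b) ^+ 2).
have e0 : 0 < e by rewrite lt_min !mulr_gt0 ?exprn_gt0 ?divr_gt0// invr_gt0.
exists e => // t x u t01; have /andP[t0 t1] := t01.
have := Hc t x u t01; set z := invmx P *m u; set S := OUcov Q B t%:E.
rewrite /OUaction; set y := _ - u; set g := y + S *m z => hg.
have SF' := SF t t01.
have lt0 : 0 < l * t by rewrite mulr_gt0.
have bt0 : 0 < b * t by rewrite mulr_gt0.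
have hq : (b * t)^-1 * enorm y ^+ 2 <= quad t x u by exact: (form_invmx_ge lt0 SF').
have hz : b^-1 * enorm u <= enorm z.
  have := form_invmx_ge l0 PF u b0; rewrite -/z => h.
  have [->|u0] := eqVneq u 0; first by rewrite enorm0 mulr0 enorm_ge0.
  have up : 0 < enorm u by rewrite lt_def enorm_eq0 u0 enorm_ge0.
  rewrite -(ler_pM2r up) -mulrA -expr2 (le_trans h)//.
  by rewrite (le_trans (ler_norm _))// inner_CS.
have hSz : (l / b) ^+ 2 * (t ^+ 2 * enorm u ^+ 2) <= enorm (S *m z) ^+ 2.
  rewrite -!exprMn ler_sqr ?nnegrE ?mulr_ge0 ?enorm_ge0 ?invr_ge0 ?(ltW l0) ?(ltW b0) ?(ltW t0)//.
  rewrite (le_trans _ (form_enorm_ge SF' z))//.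
  rewrite (_ : l / b * (t * enorm u) = l * t * (b^-1 * enorm u)); last by ring.
  by rewrite ler_wpM2l// ltW.
have hS : enorm (S *m z) ^+ 2 <= 2 * enorm g ^+ 2 + 2 * enorm y ^+ 2.
  have -> : S *m z = g + - y by rewrite /g addrC addKr.
  by rewrite -(enormN y) enormD_sqr.
rewrite ger0_norm ?enorm_ge0//.
rewrite -(ler_pM2r t0).
have -> : e * (enorm y ^+ 2 / t + t * enorm u ^+ 2) * t
    = e * enorm y ^+ 2 + e * (t ^+ 2 * enorm u ^+ 2) by field; lra.
set Y := enorm y ^+ 2 in hq hS *; set G := enorm g ^+ 2 in hg hS *.
set U := t ^+ 2 * enorm u ^+ 2 in hSz *.
have Y0 : 0 <= Y := sqr_ge0 _; have G0 : 0 <= G := sqr_ge0 _.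
have U0 : 0 <= U by rewrite mulr_ge0 ?sqr_ge0.
have em : e <= m / 4 by rewrite ge_min lexx.
have em' : e <= m / 8 * (l / b) ^+ 2 by rewrite ge_min lexx orbT.
have mth : m <= th * c by rewrite ge_min lexx.
have mth' : m <= (1 - th) / b by rewrite ge_min lexx orbT.
have hq' : (1 - th) / b * Y <= (1 - th) * (quad t x u * t).
  rewrite -mulrA ler_wpM2l ?subr_ge0 ?(ltW th1)//.
  rewrite (_ : b^-1 * Y = (b * t)^-1 * Y * t); last by field; rewrite !gt_eqF.
  by rewrite ler_wpM2r// ltW.
have hg' : th * c * G <= th * ((quad t x u - 2 * OUpot u + 2 * OUpot x) * t).
  rewrite -mulrA ler_wpM2l ?(ltW th0)//.
  by move: hg; rewrite -(ler_pM2r t0) mulrAC divfK ?gt_eqF.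
have h1 := ler_wpM2r Y0 em.
have h2 := ler_wpM2r U0 em'.
have h3 := ler_wpM2r G0 mth.
have h4 := ler_wpM2r Y0 mth'.
have h5 : m / 8 * (l / b) ^+ 2 * U <= m / 8 * (2 * G + 2 * Y).
  by rewrite -mulrA ler_wpM2l ?divr_ge0 ?(ltW m0)// (le_trans hSz).
have h6 := mulr_ge0 (ltW m0) G0.
have -> : (quad t x u / 2 - th * (OUpot u - OUpot x)) * t =
  ((1 - th) * (quad t x u * t) + th * ((quad t x u - 2 * OUpot u + 2 * OUpot x) * t)) / 2.
  by field.
lra.
Qed.

(** For [t <= 1] the vector [e^(tB) x] differs from [x] by at most [K t |x|], and [|x|] is at most a
    multiple of [|e^(tB) x|]. This links the kernel with the global region, which is described by
    [x - u]. *)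
Lemma action_dominates : exists2 C, 0 < C & forall t x u, 0 < t <= 1 ->
  t * enorm x ^+ 2 <= C * OUaction t x u /\
  enorm (x - u) ^+ 2 / t <= C * OUaction t x u.
Proof.
have [l [b [K [[l0 b0 K0] [_ _ hE1 hE2 _]]]]] := OU_estimates Q_posdef B_stable.
exists (2 * K ^+ 2 + 2 + 4 * K ^+ 4).
  by rewrite !addr_gt0 ?mulr_gt0 ?exprn_gt0.
move=> t x u t01; have /andP[t0 t1] := t01.
rewrite /OUaction; set y := _ - u; rewrite ger0_norm ?enorm_ge0//.
set Y := enorm y ^+ 2; set U := enorm u ^+ 2.
have Y0 : 0 <= Y := sqr_ge0 _; have U0 : 0 <= U := sqr_ge0 _.
have hx : enorm x ^+ 2 <= K ^+ 2 * (2 * Y + 2 * U).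
  have : enorm x ^+ 2 <= (K * enorm (expmx (t *: B) *m x)) ^+ 2.
    by rewrite ler_sqr ?nnegrE ?mulr_ge0 ?enorm_ge0 ?(ltW K0)// hE2.
  rewrite exprMn => /le_trans; apply; rewrite ler_wpM2l ?sqr_ge0//.
  have -> : expmx (t *: B) *m x = y + u by rewrite /y subrK.
  exact: enormD_sqr.
have hd : enorm (x - u) ^+ 2 <= 2 * Y + 2 * (K * t) ^+ 2 * enorm x ^+ 2.
  have -> : x - u = y + - (expmx (t *: B) *m x - x) by rewrite /y opprB [RHS]addrC addrA subrK.
  rewrite (le_trans (enormD_sqr _ _))// lerD2l enormN -mulrA ler_wpM2l// -exprMn.
  rewrite ler_sqr ?nnegrE ?mulr_ge0 ?enorm_ge0 ?(ltW K0) ?(ltW t0)//.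
  exact: hE1.
have tY : t * Y <= Y / t.
  rewrite ler_pdivlMr// mulrAC -expr2 ler_piMl//.
  by rewrite exprn_ile1// ltW.
have hx' : t * enorm x ^+ 2 <= 2 * K ^+ 2 * (Y / t + t * U).
  have := ler_wpM2l (ltW t0) hx.
  have := ler_wpM2l (mulr_ge0 (ler0n R 2) (sqr_ge0 K)) tY; lra.
have Yt0 : 0 <= Y / t by apply: divr_ge0 => //; exact: ltW.
have tU0 : 0 <= t * U by apply: mulr_ge0 => //; exact: ltW.
have Z0 : 0 <= Y / t + t * U by exact: addr_ge0.
have hY : Y / t <= Y / t + t * U by rewrite lerDl.
set Z := Y / t + t * U in hx' Z0 hY *.
have K4Z : 0 <= K ^+ 4 * Z by rewrite mulr_ge0// exprn_ge0// ltW.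
have K2Z : 0 <= K ^+ 2 * Z by rewrite mulr_ge0// sqr_ge0.
split; first lra.
have h1 : enorm (x - u) ^+ 2 / t <= (2 * Y + 2 * (K * t) ^+ 2 * enorm x ^+ 2) / t.
  by rewrite ler_wpM2r// invr_ge0 ltW.
apply: (le_trans h1).
have -> : (2 * Y + 2 * (K * t) ^+ 2 * enorm x ^+ 2) / t
   = 2 * (Y / t) + 2 * K ^+ 2 * (t * enorm x ^+ 2) by field; lra.
have h2 := ler_wpM2l (mulr_ge0 (ler0n R 2) (sqr_ge0 K)) hx'.
have -> : K ^+ 4 = K ^+ 2 * K ^+ 2 by ring.
lra.
Qed.

End kernel.

(** * The time derivative of the logarithm of the kernel *)

Section kernel_variation.
Context {R : realType} {n : nat} (Q B : 'M[R]_n).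
Hypotheses (n_ge1 : (1 <= n)%N) (Q_posdef : posdefmx Q) (B_stable : hurwitzmx B).
Implicit Types (x u v y : 'cV[R]_n) (t : R).

Notation ker := (OUker Q B).
Notation action := (OUaction B).
Notation S t := (OUcov Q B t%:E).

Let quad t x u : R :=
  inner (invmx (S t) *m (expmx (t *: B) *m x - u)) (expmx (t *: B) *m x - u).

Lemma action_ge0 t x u : 0 < t -> 0 <= action t x u.
Proof.
by move=> t0; rewrite addr_ge0// ?divr_ge0 ?exprn_ge0 ?enorm_ge0 ?(ltW t0)// mulr_ge0 ?exprn_ge0 ?enorm_ge0 ?(ltW t0).
Qed.

(** The inverse of the determinant is the determinant of the inverse, whose entries are at most
    [1 / (l t)]. *)
Lemma det_OUcov_inv : exists2 C, 0 < C & forall t, 0 < t <= 1 ->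
  0 < \det (S t) /\ (\det (S t))^-1 <= C * t^-1 ^+ n.
Proof.
have [l [b [K [[l0 b0 K0] [_ SF _ _ _]]]]] := OU_estimates Q_posdef B_stable.
exists (n`!%:R * l^-1 ^+ n).
  by rewrite mulr_gt0 ?exprn_gt0 ?invr_gt0// ltr0n fact_gt0.
move=> t t01; have t0 : 0 < t by case/andP: t01.
have lt0 : 0 < l * t by rewrite mulr_gt0.
have SF' := SF t t01.
split; first exact: form_between_det_gt0 lt0 SF'.
rewrite -det_inv (le_trans (ler_norm _))//.
rewrite (le_trans (@det_bound _ _ _ (l * t)^-1 _))//.
  by apply: coef_bound => x; exact: form_invmx_enorm lt0 SF' x.
by rewrite invfM exprMn mulrA.
Qed.

Lemma ker_expR t x u : 0 < \det (S t) ->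
  ker t x u = (2 * pi) `^ (- (n%:R / 2)) *
    expR (- 2^-1 * ln (\det (S t)) - 2^-1 * quad t x u).
Proof.
move=> D0; rewrite /OUker /gauss_pdf.
rewrite (_ : _ `^ (- 2^-1) = expR (- 2^-1 * ln (\det (S t)))); last first.
  by rewrite /powR gt_eqF.
by rewrite -mulrA -expRD !mulNr.
Qed.

(** [L] is the logarithm of the kernel up to a constant. Each term of its derivative costs one
    factor [1/t]: the determinant by [D1_det], the inverse covariance through [- S^-1 S' S^-1], and
    the motion of [e^(tB) x] through [|x| |y| / t]. *)
Lemma ker_derivative : exists C (L dL : R -> 'cV[R]_n -> 'cV[R]_n -> R),
  [/\ 0 < C, forall t x u, 0 < t <= 1 ->
      L t x u = - 2^-1 * ln (\det (S t)) - 2^-1 * quad t x u,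
      forall t x u, 0 < t <= 1 -> D1 (fun s => L s x u) t (dL t x u) &
      forall t x u, 0 < t <= 1 -> `|dL t x u| <= C / t * (1 + action t x u)].
Proof.
have [l [b [K [[l0 b0 K0] [_ SF hE _ hS]]]]] := OU_estimates Q_posdef B_stable.
have [Cd Cd0 hdet] := det_OUcov_inv.
have [Ca Ca0 hact] := action_dominates Q_posdef B_stable.
have [S' [S'0 DS SE _]] := OUcov_primitive Q B_stable.
have [bB bB0 hB] := enorm_mulmx_bounded B.
have Dy t x u : mderiv (fun s => expmx (s *: B) *m x - u) t (B *m expmx (t *: B) *m x).
  apply: mderiv_eq (mderivB (mderivMr x (mderiv_expmx B t)) (mderiv_cst u t)).
  by rewrite subr0.
(* Built on the differentiable primitive [S'] and on [adjinv]; it agrees with the covariance and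
   [invmx] for [0 < t <= 1]. *)
pose L t x u := - 2^-1 * ln (\det (S' t)) - 2^-1 *
  inner (adjinv (S' t) *m (expmx (t *: B) *m x - u)) (expmx (t *: B) *m x - u).
pose C1 := Cd * (n`!%:R * (n%:R * K ^+ n)).
pose C2 := (n * n)%:R * K / l ^+ 2.
pose C3 := 2 * (bB * (1 + K)) / l.
pose C := C1 + C2 + C3 * (Ca + 1).
have C10 : 0 <= C1 by rewrite !mulr_ge0 ?exprn_ge0 ?(ltW K0) ?(ltW Cd0).
have C20 : 0 <= C2 by rewrite !mulr_ge0 ?invr_ge0 ?exprn_ge0 ?(ltW K0) ?(ltW l0).
have C30 : 0 < C3 by rewrite !mulr_gt0 ?invr_gt0 ?addr_gt0.
have H (t : R) x u : exists d, 0 < t <= 1 ->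
    D1 (fun s => L s x u) t d /\ `|d| <= C / t * (1 + action t x u).
  have [t01|] := boolP (0 < t <= 1); last by exists 0.
  have /andP[t0 t1] := t01.
  have lt0 : 0 < l * t by rewrite mulr_gt0.
  have SF' := SF t t01.
  have USt := form_unitmx lt0 SF'; have [D0 Di] := hdet t t01.
  have SEt := SE t (ltW t0); have DSt := DS t (ltW t0).
  have [d Dd dle] := @D1_det _ _ S' t (OUmx Q B t) (K * t) K DSt
    (fun i j => eq_rect _ (fun M : 'M[R]_n => `|M i j| <= K * t) (hS t i j t01).1 _ SEt)
    (fun i j => (hS t i j t01).2).
  pose y := expmx (t *: B) *m x - u; pose y' := B *m expmx (t *: B) *m x.
  pose G := invmx (S t); pose w := G *m y.
  have DG := mderiv_adjinv DSt; rewrite -SEt in DG; have {}DG := DG USt.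
  have Dq := D1_inner (mderivM DG (Dy t x u)) (Dy t x u).
  have D1lnd : D1 (fun s => ln (\det (S' s))) t ((\det (S t))^-1 * d).
    apply: (@D1_comp _ (@ln R) (fun s => \det (S' s)) t) => //.
    by rewrite -SEt; apply: is_derive1_ln.
  exists (- 2^-1 * ((\det (S t))^-1 * d) - 2^-1 *
     (inner (- (G *m OUmx Q B t *m G) *m y + G *m y') y + inner w y')) => _.
  split.
    apply: D1B; apply: D1Zl => //.
    by move: Dq; rewrite -SEt (adjinvE USt).
  have GT : G^T = G by exact: form_invmx_tr SF'.
  have qE : inner (- (G *m OUmx Q B t *m G) *m y + G *m y') y
      = - inner (OUmx Q B t *m w) w + inner w y'.
    rewrite innerDl mulNmx innerNl -!mulmxA [inner (G *m y') y]inner_mull GT -/w (innerC y').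
    by rewrite [inner (G *m _) y]inner_mull GT -/w.
  rewrite qE.
  have hw : enorm w <= (l * t)^-1 * enorm y by exact: form_invmx_enorm lt0 SF' y.
  have hx : enorm (expmx (t *: B) *m x) <= (1 + K) * enorm x.
    rewrite -[_ *m x](subrK x) (le_trans (enormD _ _))// addrC mulrDl mul1r lerD2l.
    rewrite (le_trans (hE t x t01))// ler_wpM2r ?enorm_ge0//.
    by rewrite ger_pMr.
  have hy' : enorm y' <= bB * (1 + K) * enorm x.
    by rewrite /y' -mulmxA (le_trans (hB _))// -mulrA ler_wpM2l ?(ltW bB0).
  have hG : `|inner (OUmx Q B t *m w) w| <= C2 / t * (enorm y ^+ 2 / t).
    rewrite (le_trans (inner_CS _ _))//.
    have h1 := @enorm_mulmx _ _ (OUmx Q B t) K w (fun i j => (hS t i j t01).2).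
    apply: (@le_trans _ _ ((n * n)%:R * K * enorm w ^+ 2)).
      by rewrite expr2 mulrA ler_wpM2r ?enorm_ge0.
    apply: (@le_trans _ _ ((n * n)%:R * K * ((l * t)^-1 * enorm y) ^+ 2)).
      rewrite ler_wpM2l ?mulr_ge0 ?(ltW K0)// ler_sqr ?nnegrE ?enorm_ge0//.
      by rewrite mulr_ge0 ?invr_ge0 ?enorm_ge0 ?(ltW lt0).
    by rewrite le_eqVlt; apply/orP; left; apply/eqP; rewrite /C2; field; rewrite !gt_eqF.
  have hwy : `|inner w y'| <= C3 / t * (enorm x * enorm y) / 2.
    rewrite (le_trans (inner_CS _ _))//.
    apply: (@le_trans _ _ (((l * t)^-1 * enorm y) * (bB * (1 + K) * enorm x))).
      by rewrite ler_pM ?enorm_ge0.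
    by rewrite le_eqVlt; apply/orP; left; apply/eqP; rewrite /C3; field; rewrite !gt_eqF.
  have hd : `|(\det (S t))^-1 * d| <= C1 / t.
    rewrite normrM ger0_norm ?invr_ge0 ?(ltW D0)//.
    apply: (@le_trans _ _ (Cd * t^-1 ^+ n * (n`!%:R * (n%:R * (K * t) ^+ n.-1 * K)))).
      by rewrite ler_pM ?invr_ge0 ?(ltW D0).
    (* The [t^(n-1)] from the derivative of the determinant cancels all but one of the [n] factors
       [1/t]. *)
    rewrite /C1 -[in t^-1 ^+ n](prednK n_ge1) -[in K ^+ n](prednK n_ge1) !exprS exprMn exprVn.
    rewrite le_eqVlt; apply/orP; left; apply/eqP; field.
    by rewrite !gt_eqF// exprn_gt0.
  have [ha _] := hact t x u t01.
  have A0 := action_ge0 x u t0.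
  have hyA : enorm y ^+ 2 / t <= action t x u.
    rewrite /OUaction ger0_norm ?enorm_ge0// lerDl mulr_ge0 ?sqr_ge0//; exact: ltW.
  (* By [2 |x| |y| <= t |x|^2 + |y|^2 / t], both terms being controlled by the action. *)
  have hxy : enorm x * enorm y <= (Ca + 1) * action t x u.
    have h2 : 0 <= (t * enorm x - enorm y) ^+ 2 / t by rewrite divr_ge0 ?sqr_ge0// ltW.
    have : (t * enorm x - enorm y) ^+ 2 / t
       = t * enorm x ^+ 2 + enorm y ^+ 2 / t - 2 * (enorm x * enorm y) by field; rewrite gt_eqF.
    have := mulr_ge0 (ltW Ca0) A0; rewrite mulrDl mul1r; lra.
  have ti0 : 0 < t^-1 by rewrite invr_gt0.
  set A := action t x u in ha A0 hyA hxy *.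
  have hG' : C2 / t * (enorm y ^+ 2 / t) <= C2 / t * A.
    by rewrite ler_wpM2l// mulr_ge0// ltW.
  have hwy' : C3 / t * (enorm x * enorm y) <= C3 / t * ((Ca + 1) * A).
    by rewrite ler_wpM2l// mulr_ge0 ?(ltW C30)// ltW.
  have -> : C / t * (1 + A) = C1 / t + C1 / t * A + C2 / t + C2 / t * A +
      C3 / t * (Ca + 1) + C3 / t * ((Ca + 1) * A).
    by rewrite /C; ring.
  have k1 := mulr_ge0 (mulr_ge0 C10 (ltW ti0)) A0.
  have k2 := mulr_ge0 C20 (ltW ti0).
  have k3 := mulr_ge0 (mulr_ge0 (ltW C30) (ltW ti0)) (addr_ge0 (ltW Ca0) ler01).
  move: hG hwy hd; rewrite !ler_norml => /andP[? ?] /andP[? ?] /andP[? ?].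
  by apply/andP; split; lra.
have [dL HdL] : exists dL : R -> 'cV[R]_n -> 'cV[R]_n -> R, forall t x u, 0 < t <= 1 ->
    D1 (fun s => L s x u) t (dL t x u) /\
    `|dL t x u| <= C / t * (1 + action t x u).
  have H' (txu : R * 'cV[R]_n * 'cV[R]_n) := H txu.1.1 txu.1.2 txu.2.
  by have [f Hf] := choice H'; exists (fun t x u => f (t, x, u)) => t x u; exact: (Hf (t, x, u)).
exists C, L, dL; split.
- by rewrite /C ltr_wpDl ?addr_ge0// mulr_gt0// addr_gt0.
- move=> t x u t01; have /andP[t0 t1] := t01; rewrite /L -SE ?(ltW t0)// adjinvE//.
  apply: (form_unitmx (mulr_gt0 l0 t0) (SF t t01)).
- by move=> t x u t01; have [] := HdL t x u t01.
- by move=> t x u t01; have [] := HdL t x u t01.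
Qed.

End kernel_variation.

(** * The variation of the kernel in time *)

Section kernel_bounds.
Context {R : realType} {n : nat} (Q B : 'M[R]_n).
Hypotheses (n_ge1 : (1 <= n)%N) (Q_posdef : posdefmx Q) (B_stable : hurwitzmx B).
Implicit Types (x u : 'cV[R]_n) (t s : R).

Notation ker := (OUker Q B).
Notation pot := (OUpot Q B).
Notation action := (OUaction B).
Notation S t := (OUcov Q B t%:E).

Definition OUmajorant (k : R) x u : R :=
  (1 + enorm u) ^+ n * expR (- (k * ((1 + enorm u) * enorm (x - u)))).

Let quad t x u : R :=
  inner (invmx (S t) *m (expmx (t *: B) *m x - u)) (expmx (t *: B) *m x - u).

Lemma ker_ge0 t x u : 0 <= ker t x u.
Proof. exact: gauss_pdf_ge0. Qed.

(** The endpoint [th = 1]: no decay is left, but the weight is exactly the one for which functions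
    integrable against the invariant measure are integrable against the kernel. *)
Lemma ker_pot_bound t : 0 < t <= 1 ->
  exists2 C, 0 <= C & forall x u, ker t x u <= C * expR (pot x - pot u).
Proof.
move=> t01; have [_ _ /(_ t t01)[D0 _]] := det_OUcov_inv Q_posdef B_stable.
have [c c0 hq] := quad_reversed Q_posdef B_stable.
exists ((2 * pi) `^ (- (n%:R / 2)) * expR (- 2^-1 * ln (\det (S t)))).
  by rewrite mulr_ge0 ?powR_ge0 ?expR_ge0.
move=> x u; rewrite ker_expR// -mulrA -expRD ler_wpM2l ?powR_ge0// ler_expR.
have t0 : 0 < t by case/andP: t01.
have := hq t x u t01; set a := c / t * _.
have : 0 <= a by rewrite mulr_ge0 ?sqr_ge0// divr_ge0 ?(ltW c0) ?(ltW t0).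
rewrite /quad; lra.
Qed.

(* The time factor telescopes along an increasing partition, whence a bound on the
   variation of [t |-> ker t x u] that is uniform in the partition. *)
Lemma ker_variation th (c' : R) : 0 < th < 1 -> 0 < c' ->
  exists C k, [/\ 0 < C, 0 < k & forall t t' x u, 0 < t -> t <= t' -> t' <= 1 ->
    c' <= (1 + enorm u) * enorm (x - u) ->
    `|ker t' x u - ker t x u| <=
      C * OUmajorant k x u * expR (th * (pot x - pot u)) *
        ((1 + t * (1 + enorm u) ^+ 2)^-1 - (1 + t' * (1 + enorm u) ^+ 2)^-1)].
Proof.
move=> th01 c'0.
have [c c0 hq] := quad_lower Q_posdef B_stable th01.
have [Cl [L [dL [Cl0 LE DL hdL]]]] := ker_derivative n_ge1 Q_posdef B_stable.
have [Cd Cd0 hdet] := det_OUcov_inv Q_posdef B_stable.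
have [Ca Ca0 hact] := action_dominates Q_posdef B_stable.
(* Chosen so that [k (m^2 / sg + sg)] is at most [c / 2] times the action plus [c / 4]. One half of
   it gives [e^(-km)], the other the time profile. *)
pose k := Num.min (c / (4 * Ca)) (c / 8).
have k0 : 0 < k by rewrite lt_min !divr_gt0// mulr_gt0.
(* Since [m >= c'], this turns [k m^2 / (2 sg)] into [k' / sg]. *)
pose k' := k / 2 * Num.min (c' ^+ 2) 1.
have k'0 : 0 < k' by rewrite mulr_gt0 ?divr_gt0// lt_min exprn_gt0// ltr01.
have [Cp Cp0 hp] := time_profile_bound n k'0.
pose K0 : R := (2 * pi) `^ (- (n%:R / 2)).
have K00 : 0 <= K0 by exact: powR_ge0.
pose C := K0 * (1 + Cd) * Cl * (1 + 2 / c) * expR (c / 4) * Cp + 1.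
have C0 : 0 <= K0 * (1 + Cd) * Cl * (1 + 2 / c) * expR (c / 4) * Cp.
  by rewrite !mulr_ge0 ?expR_ge0 ?addr_ge0 ?divr_ge0 ?(ltW Cd0) ?(ltW Cl0) ?(ltW c0) ?(ltW Cp0).
exists C, k; split => //; first by rewrite /C ltr_wpDl.
move=> t t' x u t0 tt' t'1 hglob.
set a := 1 + enorm u in hglob *; set d := enorm (x - u) in hglob *.
have a0 : 0 < a by rewrite ltr_pwDl ?enorm_ge0.
have d0 : 0 <= d := enorm_ge0 _.
pose m := a * d; have m0 : 0 <= m by rewrite mulr_ge0// ltW.
set M := OUmajorant k x u; set W := expR (th * _).
have s01 s : t <= s <= t' -> 0 < s <= 1.
  by move=> /andP[ts st']; rewrite (lt_le_trans t0 ts) (le_trans st').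
have kerE s : 0 < s <= 1 -> ker s x u = K0 * expR (L s x u).
  by move=> s01'; rewrite LE// ker_expR//; have [] := hdet s s01'.
rewrite !kerE ?(s01 t) ?(s01 t') ?lexx ?tt'//.
have Dg s : 0 < s -> D1 (fun s => - (C * M * W) * (1 + s * a ^+ 2)^-1) s
    (C * M * W * (a ^+ 2 / (1 + s * a ^+ 2) ^+ 2)).
  move=> s0; have e0 : 1 + s * a ^+ 2 != 0.
    by rewrite gt_eqF// addr_gt0// mulr_gt0// exprn_gt0.
  have De : D1 (fun s => 1 + s * a ^+ 2) s (a ^+ 2).
    by apply: D1_eq (D1D (D1_cst 1 s) (D1M (D1_id s) (D1_cst (a ^+ 2) s))); ring.
  by apply: D1_eq (D1Zl _ (@D1V _ (fun s => 1 + s * a ^+ 2) s _ e0 De)); field.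
have -> : C * M * W * ((1 + t * a ^+ 2)^-1 - (1 + t' * a ^+ 2)^-1)
  = - (C * M * W) * (1 + t' * a ^+ 2)^-1 - - (C * M * W) * (1 + t * a ^+ 2)^-1 by ring.
apply: (@D1_dominated _ (fun s => K0 * expR (L s x u))
  (fun s => K0 * (expR (L s x u) * dL s x u))
  (fun s => - (C * M * W) * (1 + s * a ^+ 2)^-1)
  (fun s => C * M * W * (a ^+ 2 / (1 + s * a ^+ 2) ^+ 2)) t t' tt').
- by move=> s /s01 s01'; apply/D1Zl/D1_expR/DL.
- by move=> s /s01/andP[s0 _]; exact: Dg.
move=> s /s01 s01'; have /andP[s0 s1] := s01'.
have [D0 Di] := hdet s s01'.
pose sg := s * a ^+ 2; have sg0 : 0 < sg by rewrite mulr_gt0// exprn_gt0.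
pose v := expR (- 2^-1 * ln (\det (S s))).
have v0 : 0 < v := expR_gt0 _.
have v2 : v ^+ 2 = (\det (S s))^-1.
  rewrite -expRM_natl (_ : 2%:R * _ = - ln (\det (S s))); last by field.
  by rewrite expRN lnK.
(* A crude bound on [det^(-1/2)] that avoids half-integer powers: the squares are compared, with
   [Cd w <= (1 + Cd)^2 (1 + w)^2]. The loss in the power of [1 / sg] is harmless for the time
   profile. *)
have hv : v <= (1 + Cd) * a ^+ n * (sg^-1 ^+ n + 1).
  have w0 : 0 <= sg^-1 ^+ n by rewrite exprn_ge0// invr_ge0 ltW.
  have an0 : 0 <= a ^+ n by rewrite exprn_ge0// ltW.
  rewrite -ler_sqr ?nnegrE ?(ltW v0)//; last first.
    by rewrite !mulr_ge0 ?addr_ge0 ?(ltW Cd0).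
  rewrite v2 (le_trans Di)//.
  have -> : s^-1 ^+ n = sg^-1 ^+ n * (a ^+ n) ^+ 2.
    rewrite /sg invfM exprMn -mulrA -exprM mulnC exprM -exprMn mulVf ?expr1n ?mulr1//.
    by rewrite gt_eqF// exprn_gt0.
  move: (sg^-1 ^+ n) (a ^+ n) w0 an0 => w an w0 an0.
  have -> : ((1 + Cd) * an * (w + 1)) ^+ 2 = an ^+ 2 * ((1 + Cd) ^+ 2 * (w + 1) ^+ 2) by ring.
  rewrite (_ : Cd * (w * an ^+ 2) = an ^+ 2 * (Cd * w)); last by ring.
  rewrite ler_wpM2l ?sqr_ge0// ler_pM ?(ltW Cd0)//.
    by have := sqr_ge0 Cd; rewrite sqrrD; have := ltW Cd0; lra.
  by have := sqr_ge0 w; rewrite sqrrD; lra.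
have A0 : 0 <= action s x u by exact: action_ge0.
have hqs := hq s x u s01'.
have [_ hd2] := hact s x u s01'.
have hm : m ^+ 2 / sg <= Ca * action s x u.
  rewrite (_ : m ^+ 2 / sg = d ^+ 2 / s)//.
  by rewrite /m /sg; field; rewrite !gt_eqF.
have hsg : sg <= 2 + 2 * action s x u.
  have h1 : a ^+ 2 <= 2 + 2 * enorm u ^+ 2.
    by have := sqr_ge0 (1 - enorm u); rewrite /a sqrrB sqrrD expr1n mul1r; lra.
  have := ler_wpM2l (ltW s0) h1; rewrite -/sg => h2.
  have h3 : s * enorm u ^+ 2 <= action s x u.
    by rewrite /OUaction lerDr divr_ge0 ?exprn_ge0// ltW.
  lra.
set Ac := action s x u in A0 hqs hm hsg *.
have kc1 : k * (m ^+ 2 / sg) <= c / 4 * Ac.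
  have h1 : k <= c / (4 * Ca) by rewrite ge_min lexx.
  rewrite (_ : c / 4 * Ac = c / (4 * Ca) * (Ca * Ac)); last by field; rewrite gt_eqF.
  by rewrite ler_pM ?divr_ge0 ?exprn_ge0 ?(ltW k0) ?(ltW sg0).
have kc2 : k * sg <= c / 8 * sg.
  by rewrite ler_wpM2r ?(ltW sg0)// ge_min lexx orbT.
have amgm : 2 * m <= m ^+ 2 / sg + sg.
  have : 0 <= (m - sg) ^+ 2 / sg by rewrite divr_ge0 ?sqr_ge0// ltW.
  have -> : (m - sg) ^+ 2 / sg = m ^+ 2 / sg + sg - 2 * m by field; rewrite gt_eqF.
  lra.
have glob : k' / sg + k' * sg <= k / 2 * (m ^+ 2 / sg + sg).
  rewrite mulrDr lerD//.
    rewrite mulrA ler_wpM2r ?invr_ge0 ?(ltW sg0)// /k' ler_wpM2l ?divr_ge0 ?(ltW k0)//.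
    apply: (@le_trans _ _ (c' ^+ 2)); first by rewrite ge_min lexx.
    by rewrite ler_sqr ?nnegrE ?(ltW c'0).
  rewrite ler_wpM2r ?(ltW sg0)// /k' ler_piMr ?divr_ge0 ?(ltW k0)//.
  by rewrite ge_min lexx orbT.
have hexp : expR (L s x u) <= v *
    (expR (- (c * Ac)) * W).
  rewrite LE// expRD /v ler_wpM2l ?expR_ge0// /W -expRD ler_expR.
  move: hqs; rewrite /quad; lra.
(* Half of the exponential absorbs the polynomial factor of the logarithmic derivative. *)
have hA : (1 + Ac) * expR (- (c * Ac)) <= (1 + 2 / c) * expR (- (c / 2 * Ac)).
  have -> : - (c * Ac) = - (c / 2 * Ac) + - (c / 2 * Ac) by field.
  rewrite expRD mulrA ler_wpM2r ?expR_ge0// expRN ler_pdivrMr ?expR_gt0//.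
  apply: (@le_trans _ _ ((1 + 2 / c) * (1 + c / 2 * Ac))).
    rewrite -subr_ge0.
    rewrite (_ : _ - _ = c / 2 * Ac + 2 / c); last by field; rewrite gt_eqF.
    by rewrite addr_ge0 ?mulr_ge0 ?invr_ge0 ?(ltW c0).
  by rewrite ler_wpM2l ?expR_ge1Dx// addr_ge0 ?divr_ge0 ?(ltW c0).
have hE : expR (- (c / 2 * Ac)) <=
    expR (c / 4) * expR (- (k * m)) * expR (- (k' / sg) - k' * sg).
  rewrite -!expRD ler_expR.
  have h1 : k * (2 * m) <= k * (m ^+ 2 / sg + sg) by rewrite ler_wpM2l ?(ltW k0).
  have h2 : c * sg <= c * (2 + 2 * Ac) by rewrite ler_wpM2l ?(ltW c0).
  lra.
have hT := hp sg sg0.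
have X0 : 0 <= K0 * (1 + Cd) * Cl * (1 + 2 / c) * expR (c / 4).
  by rewrite !mulr_ge0 ?expR_ge0 ?addr_ge0 ?divr_ge0 ?(ltW Cd0) ?(ltW Cl0) ?(ltW c0).
rewrite !normrM ger0_norm// (ger0_norm (expR_ge0 _)).
have hdLs := hdL s x u s01'; rewrite -/Ac in hdLs.
have W0 : 0 <= W := expR_ge0 _.
have M0 : 0 <= M by rewrite mulr_ge0 ?expR_ge0// exprn_ge0// ltW.
apply: (@le_trans _ _ (K0 * ((v * (expR (- (c * Ac)) * W)) * (Cl / s * (1 + Ac))))).
  by rewrite ler_wpM2l// ler_pM ?expR_ge0.
have -> : K0 * ((v * (expR (- (c * Ac)) * W)) * (Cl / s * (1 + Ac)))
  = K0 * W * Cl * (v / s * ((1 + Ac) * expR (- (c * Ac)))) by ring.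
apply: (@le_trans _ _ (K0 * W * Cl * ((1 + Cd) * a ^+ n * (sg^-1 ^+ n + 1) / s *
   ((1 + 2 / c) * (expR (c / 4) * expR (- (k * m)) * expR (- (k' / sg) - k' * sg)))))).
  rewrite ler_wpM2l ?mulr_ge0 ?(ltW Cl0)// ler_pM//.
  - by rewrite divr_ge0 ?(ltW v0) ?(ltW s0).
  - exact: mulr_ge0 (addr_ge0 ler01 A0) (expR_ge0 _).
  - by rewrite ler_wpM2r ?invr_ge0 ?(ltW s0).
  - by rewrite (le_trans hA)// ler_wpM2l// addr_ge0 ?divr_ge0 ?(ltW c0).
have -> : K0 * W * Cl * ((1 + Cd) * a ^+ n * (sg^-1 ^+ n + 1) / s *
   ((1 + 2 / c) * (expR (c / 4) * expR (- (k * m)) * expR (- (k' / sg) - k' * sg))))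
  = K0 * (1 + Cd) * Cl * (1 + 2 / c) * expR (c / 4) * (M * W) * a ^+ 2 *
    ((sg^-1 ^+ n + 1) * sg^-1 * expR (- (k' / sg) - k' * sg)).
  rewrite (_ : s^-1 = a ^+ 2 * sg^-1); last first.
    by rewrite /sg; field; rewrite !gt_eqF.
  rewrite /M /OUmajorant -/a -/d -/m.
  move: (sg^-1 ^+ n) (sg^-1) (a ^+ n) (expR (- (k' / sg) - k' * sg)) (c^-1) => e1 e2 e3 e4 e5; ring.
apply: (@le_trans _ _ (K0 * (1 + Cd) * Cl * (1 + 2 / c) * expR (c / 4) * (M * W) * a ^+ 2 *
   (Cp / (1 + sg) ^+ 2))).
  by rewrite ler_wpM2l//; exact: mulr_ge0 (mulr_ge0 X0 (mulr_ge0 M0 W0)) (sqr_ge0 a).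
have -> : K0 * (1 + Cd) * Cl * (1 + 2 / c) * expR (c / 4) * (M * W) * a ^+ 2 *
   (Cp / (1 + sg) ^+ 2)
 = (C - 1) * (M * W * (a ^+ 2 / (1 + sg) ^+ 2)).
  by rewrite /C addrK; ring.
rewrite -!(mulrA C) -(mulrA M) ler_wpM2r ?gerBl//.
exact: mulr_ge0 M0 (mulr_ge0 W0 (divr_ge0 (sqr_ge0 _) (sqr_ge0 _))).
Qed.

End kernel_bounds.

(** * Integration on [R^n] *)

Section integral_complements.
Context d (T : measurableType d) (R : realType).
Local Open Scope ereal_scope.
Import HBNNSimple.

(** The integral of a nonnegative function is a supremum over the simple functions below it, hence
    monotone whether or not the functions are measurable. This makes the norm of the jump function
    tractable without discussing its measurability. *)
Lemma ge0_le_integral_nonmeasurable (mu : {measure set T -> \bar R}) (f g : T -> \bar R) :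
  (forall x, 0 <= f x) -> (forall x, f x <= g x) -> \int[mu]_x f x <= \int[mu]_x g x.
Proof.
move=> f0 fg; have g0 x : 0 <= g x by rewrite (le_trans (f0 x)).
rewrite !ge0_integralTE//; apply: le_ereal_sup => _ [h hf <-].
by exists h => // x; rewrite (le_trans (hf x)).
Qed.

Lemma ge0_integral_density (mu nu : {measure set T -> \bar R}) (w : T -> R)
    (f : T -> \bar R) :
  measurable_fun setT w -> (forall x, (0 <= w x)%R) ->
  (forall A, measurable A -> nu A = \int[mu]_(x in A) (w x)%:E) ->
  measurable_fun setT f -> (forall x, 0 <= f x) ->
  \int[nu]_x f x = \int[mu]_x (f x * (w x)%:E).
Proof.
move=> mw w0 nuE mf f0; pose h := nnsfun_approx measurableT mf.
have fh x : (h k x)%:E @[k --> \oo] --> f x by exact: cvg_nnsfun_approx.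
have hnd x : {homo (fun k => (h k x)%:E) : a b / (a <= b)%N >-> a <= b}.
  by move=> a b ab; rewrite lee_fin; exact/lefP/nd_nnsfun_approx.
have mh k : measurable_fun setT (fun x => (h k x)%:E) by exact/measurable_EFinP.
have mw' : measurable_fun setT (fun x => (w x)%:E) by exact/measurable_EFinP.
have -> : \int[nu]_x f x = lim (\int[nu]_x (h k x)%:E @[k --> \oo]).
  rewrite -monotone_convergence//.
    by apply: eq_integral => x _; apply/esym/cvg_lim => //; exact: fh.
  by move=> k x _; rewrite lee_fin.
have -> : \int[mu]_x (f x * (w x)%:E)
    = lim (\int[mu]_x ((h k x)%:E * (w x)%:E) @[k --> \oo]).
  rewrite -monotone_convergence//.
  - by apply: eq_integral => x _; apply/esym/cvg_lim => //; apply: cvgeZr => //; exact: fh.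
  - by move=> k; exact: emeasurable_funM.
  - by move=> k x _; rewrite mule_ge0// lee_fin.
  - by move=> x _ a b ab; rewrite lee_wpmul2r ?lee_fin//; exact: hnd.
suff hk k : \int[nu]_x (h k x)%:E = \int[mu]_x ((h k x)%:E * (w x)%:E).
  by under eq_fun do rewrite hk.
have hE x : (h k x)%:E = \sum_(y \in range (h k)) (y * \1_(h k @^-1` [set y]) x)%:E.
  by rewrite fsumEFin// -fimfunE.
have hwE x : (h k x)%:E * (w x)%:E
    = \sum_(y \in range (h k)) ((y * \1_(h k @^-1` [set y]) x)%:E * (w x)%:E).
  by rewrite hE ge0_mule_fsuml// => y; exact: nnfun_muleindic_ge0.
under eq_integral do rewrite hE.
under [RHS]eq_integral do rewrite hwE.
have mset y : measurable (h k @^-1` [set y]) by exact: measurable_funPTI.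
have mind y : measurable_fun setT (fun x => (y * \1_(h k @^-1` [set y]) x)%:E).
  by apply/measurable_EFinP; apply: measurable_funM => //; exact: measurable_indic.
rewrite !ge0_integral_fsum//; last 3 first.
- by move=> y; exact: emeasurable_funM.
- by move=> y x _; rewrite mule_ge0 ?lee_fin//; exact: nnfun_muleindic_ge0.
- by move=> y x _; exact: nnfun_muleindic_ge0.
apply: eq_fsbigr => y yh.
have y0 : (0 <= y)%R by move: yh; rewrite inE => -[x _ <-].
under eq_integral do rewrite EFinM.
under [RHS]eq_integral do rewrite EFinM -muleA.
rewrite !ge0_integralZl//.
- rewrite integral_indic// setIT nuE// integral_mkcond; congr (_ * _).
  by apply: eq_integral => x _; rewrite epatch_indic/= muleC.
- by apply: emeasurable_funM => //; exact/measurable_EFinP.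
- by move=> x _; rewrite mule_ge0// lee_fin.
- by apply/measurable_EFinP; exact: measurable_indic.
Qed.

End integral_complements.

Section lebesgue_cV_theory.
Context {R : realType}.
Local Open Scope ereal_scope.

(* An alias of [lebesgue_cV], which is a bundled measure and hence cannot carry the
   sigma-finite structure. *)
Definition leb_cV n : set 'cV[R]_n -> \bar R := lebesgue_cV n.

HB.instance Definition _ n := Measure.on (@leb_cV n).

Lemma cons_cV0 n (p : 'cV[R]_n * R) : cons_cV p (lshift n (ord0 : 'I_1)) ord0 = p.2.
Proof.
by rewrite /cons_cV (col_mxEu ((p.2)%:M : 'M[R]_1) p.1) mxE eqxx mulr1n.
Qed.

Lemma cons_cVS n (p : 'cV[R]_n * R) (j : 'I_n) :
  cons_cV p (rshift 1 j) ord0 = p.1 j ord0.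
Proof. by rewrite /cons_cV (col_mxEd ((p.2)%:M : 'M[R]_1) p.1). Qed.

Lemma ord_cons n (P : 'I_n.+1 -> Prop) :
  P (lshift n (ord0 : 'I_1)) -> (forall j : 'I_n, P (rshift 1 j)) -> forall i, P i.
Proof.
move=> P0 PS i; case: (split_ordP (i : 'I_(1 + n))) => j ->; last exact: PS.
by rewrite ord1.
Qed.

Lemma prod_cons_cV n (h : R -> R) (p : 'cV[R]_n * R) :
  (\prod_(i < n.+1) h (cons_cV p i ord0) = h p.2 * \prod_(i < n) h (p.1 i ord0))%R.
Proof.
rewrite big_ord_recl -(cons_cV0 p); congr (h (cons_cV p _ _) * _)%R.
  exact: val_inj.
apply: eq_bigr => i _; rewrite -cons_cVS; congr (h (cons_cV p _ _)).
exact: val_inj.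
Qed.

Let box n (k : nat) : set 'cV[R]_n := [set x | forall i, (`|x i ord0| <= k%:R)%R].

Let measurable_box n k : measurable (@box n k).
Proof.
rewrite (_ : @box n k = \bigcap_(i in setT) [set x : 'cV[R]_n | (`|x i ord0| <= k%:R)%R]); last first.
  by apply/seteqP; split => x /= h i; [move=> _; exact: h|exact: (h i I)].
apply: fin_bigcap_measurable => // i _.
rewrite (_ : [set x | _] = (fun x : 'cV[R]_n => x i ord0) @^-1` `[(- k%:R)%R, k%:R]); last first.
  by apply/seteqP; split => x /=; rewrite in_itv/= ler_norml.
by rewrite -[_ @^-1` _]setTI; apply: measurable_cV_coord.
Qed.

Let box_finite n k : leb_cV (@box n k) < +oo.
Proof.
elim: n => [|n IH]; first by rewrite /leb_cV/= diracE ltry.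
have -> : leb_cV (@box n.+1 k) =
   (leb_cV (n:=n) \x @lebesgue_measure R) (@box n k `*` `[(- k%:R)%R, k%:R]).
  rewrite /leb_cV/= /cons_measure /pushforward; congr (_ _).
  apply/seteqP; split => -[y s] /=; rewrite in_itv/= -ler_norml.
    move=> h; split; last by have := h (lshift n (ord0 : 'I_1)); rewrite cons_cV0.
    by move=> i; have := h (rshift 1 i); rewrite cons_cVS.
  by move=> [h1 h2]; apply: ord_cons => [|j]; rewrite ?cons_cV0 ?cons_cVS.
rewrite product_measure1E//; last exact: measurable_box.
apply: lte_mul_pinfty => //; first by rewrite ge0_fin_numE.
have := @lebesgue_measure_itv R `[(- k%:R)%R, k%:R].
by move=> /= ->; case: ifP => _; rewrite ?ltry// -EFinB ltry.
Qed.

Let leb_cV_sigma_finite n : sigma_finite setT (@leb_cV n).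
Proof.
exists (@box n); last by move=> k; split; [exact: measurable_box|exact: box_finite].
apply/seteqP; split => // x _.
pose m : R := (\sum_(i < n) `|x i ord0|)%R.
exists (Num.bound m) => // i.
rewrite (le_trans _ (ltW (archi_boundP _)))//; last exact: sumr_ge0.
by rewrite /m (bigD1 i)//= lerDl sumr_ge0.
Qed.

HB.instance Definition _ n := Measure_isSigmaFinite.Build _ _ _ (@leb_cV n)
  (@leb_cV_sigma_finite n).

Lemma ge0_integral_cons_cV n (f : 'cV[R]_n.+1 -> \bar R) :
  measurable_fun setT f -> (forall x, 0 <= f x) ->
  \int[@leb_cV n.+1]_x f x
    = \int[@leb_cV n]_y \int[@lebesgue_measure R]_s f (cons_cV (y, s)).
Proof.
move=> mf f0.
transitivity (\int[(@leb_cV n \x @lebesgue_measure R)]_p f (cons_cV p)).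
  pose m : {measure set ('cV[R]_n * measurableTypeR R) -> \bar R} :=
    @leb_cV n \x @lebesgue_measure R.
  have mc : measurable_fun setT (@cons_cV R n : 'cV[R]_n * measurableTypeR R -> _).
    exact: measurable_cons_cV.
  have := @ge0_integral_pushforward _ _ _ _ R _ mc m setT f measurableT mf (fun x _ => f0 x).
  rewrite preimage_setT => H; apply: (etrans _ H); clear H.
  apply: (@eq_measure_integral _ _ _ _
    (measure_function_pushforward__canonical__measure_function_Measure m mc)) => A mA _.
  by [].
rewrite fubini_tonelli1//.
by apply: measurableT_comp mf _; exact: measurable_cons_cV.
Qed.

Lemma lebesgue_measure_reflection (a : R) (A : set R) : measurable A ->
  pushforward (@lebesgue_measure R) (fun s : R => a - s : measurableTypeR R)%R A
    = lebesgue_measure A.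
Proof.
have mphi : measurable_fun setT (fun s : R => a - s : measurableTypeR R)%R.
  exact: measurable_funB.
move=> mA; apply/esym.
pose m := measure_function_pushforward__canonical__measure_function_Measure
  (@lebesgue_measure R) mphi.
apply: (@lebesgue_measure_unique _ m) => //= _ [[b c]] _ <-.
rewrite /m/= /pushforward.
rewrite (_ : _ @^-1` _ = `[(a - c)%R, (a - b)%R[%classic); last first.
  apply/seteqP; split => s /=; rewrite !in_itv/= => /andP[h1 h2]; apply/andP; split; lra.
rewrite !lebesgue_measure_itv/= !lte_fin.
rewrite (_ : (a - c < a - b)%R = (b < c)%R); last by rewrite ltrD2l ltrN2.
by case: ifP => // _; rewrite -!EFinB; congr EFin; ring.
Qed.

Lemma ge0_integral_reflection (a : R) (f : R -> \bar R) :
  measurable_fun setT f -> (forall x, 0 <= f x) ->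
  \int[lebesgue_measure]_s f (a - s)%R = \int[lebesgue_measure]_s f s.
Proof.
move=> mf f0.
have mphi : measurable_fun setT (fun s : measurableTypeR R => a - s : measurableTypeR R)%R.
  exact: measurable_funB.
pose m : {measure set (measurableTypeR R) -> \bar R} := @lebesgue_measure R.
have := @ge0_integral_pushforward _ _ _ _ R _ mphi m setT f measurableT mf (fun x _ => f0 x).
rewrite preimage_setT => H; apply/esym; apply: (etrans _ H); clear H.
apply: (@eq_measure_integral _ _ _ _
  (measure_function_pushforward__canonical__measure_function_Measure m mphi)) => A mA _.
exact/esym/lebesgue_measure_reflection.
Qed.

(** The change of variables [u = e^(tB) x - y] between the semigroup and its kernel, done one
    coordinate at a time by Tonelli. *)
Lemma ge0_integral_reflection_cV n (a : 'cV[R]_n) (f : 'cV[R]_n -> \bar R) :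
  measurable_fun setT f -> (forall x, 0 <= f x) ->
  \int[@leb_cV n]_x f (a - x)%R = \int[@leb_cV n]_x f x.
Proof.
elim: n a f => [|n IH] a f mf f0.
  by apply: eq_integral => x _; congr f; apply/matrixP => -[].
pose b : 'cV[R]_n := \col_j a (rshift 1 j) ord0.
pose al := a (lshift n (ord0 : 'I_1)) ord0.
have ab y s : (a - cons_cV (y, s) = cons_cV (b - y, al - s))%R.
  apply/matrixP => i j; rewrite ord1; move: i; apply: ord_cons => [|i].
    by rewrite mxE [X in (_ + X)%R]mxE !cons_cV0.
  by rewrite mxE [X in (_ + X)%R]mxE !cons_cVS/= !mxE.
have msub : measurable_fun setT (fun x : 'cV[R]_n.+1 => a - x)%R.
  apply: measurable_fun_cV => i; under eq_fun do rewrite !mxE.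
  by apply: measurable_funB => //; exact: measurable_cV_coord.
have mcons y : measurable_fun setT (fun s => f (cons_cV (y, s))).
  apply: measurableT_comp mf _; apply: measurableT_comp (@measurable_cons_cV R n) _.
  exact: measurable_pair1.
have mint : measurable_fun setT (fun y => \int[@lebesgue_measure R]_s f (cons_cV (y, s))).
  apply: (@measurable_fun_fubini_tonelli_F _ _ _ (measurableTypeR R) _ lebesgue_measure
    (fun p => f (cons_cV p))) => //.
  by apply: measurableT_comp mf _; exact: measurable_cons_cV.
rewrite ge0_integral_cons_cV//; last exact: measurableT_comp mf msub.
rewrite [RHS](ge0_integral_cons_cV mf f0).
rewrite -[RHS](IH b) => [|//|y]; last exact: integral_ge0.
apply: eq_integral => y _.
rewrite -[RHS](@ge0_integral_reflection al (fun s => f (cons_cV ((b - y)%R, s))))//.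
by apply: eq_integral => s _; rewrite ab.
Qed.

Lemma ge0_integral_prod_cV n (h : R -> R) (w : R) : measurable_fun setT h ->
  (forall s, (0 <= h s)%R) -> \int[lebesgue_measure]_s (h s)%:E = w%:E ->
  \int[@leb_cV n]_x (\prod_(i < n) h (x i ord0))%:E = (w ^+ n)%:E.
Proof.
move=> mh h0 hw; elim: n => [|n IH].
  rewrite expr0; under eq_integral do rewrite big_ord0.
  by rewrite integral_dirac//= diracT mul1e.
have mprod m : measurable_fun setT (fun x : 'cV[R]_m => \prod_(i < m) h (x i ord0))%R.
  apply: measurable_prod => i _; apply: measurableT_comp mh _; exact: measurable_cV_coord.
rewrite ge0_integral_cons_cV//; last 2 first.
- by apply/measurable_EFinP; exact: mprod.
- by move=> x; rewrite lee_fin prodr_ge0.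
under eq_integral => y _.
  under eq_integral do rewrite prod_cons_cV/= mulrC EFinM.
  rewrite ge0_integralZl//; last 3 first.
  - exact/measurable_EFinP.
  - by move=> s _; rewrite lee_fin.
  - by rewrite lee_fin prodr_ge0.
  rewrite hw muleC.
  over.
rewrite ge0_integralZl//.
- by rewrite IH exprS EFinM.
- by apply/measurable_EFinP; exact: mprod.
- by move=> x _; rewrite lee_fin prodr_ge0.
- by rewrite -hw integral_ge0// => s _; rewrite lee_fin.
Qed.

End lebesgue_cV_theory.

(** * Measurability of functions of columns *)

Section measurability_cV.
Context {R : realType} {n : nat}.

(** The cell of side [1 / (k + 1)] containing [x], recorded by integers so that only countably many
    values occur. *)
Let grid (k : nat) (x : 'cV[R]_n) : 'cV[int]_n :=
  \col_i Num.floor (k.+1%:R * x i ord0).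

Let of_grid (k : nat) (c : 'cV[int]_n) : 'cV[R]_n :=
  \col_i ((c i ord0)%:~R / k.+1%:R).

Let measurable_grid k c : measurable [set x | grid k x = c].
Proof.
rewrite (_ : [set x | _] = \bigcap_(i in setT)
    (fun x : 'cV[R]_n => x i ord0) @^-1`
      `[(c i ord0)%:~R / k.+1%:R, (c i ord0 + 1)%:~R / k.+1%:R[); last first.
  apply/seteqP; split => [x /= <- i _|x /= H].
    rewrite /= in_itv/= mxE ler_pdivrMr// ltr_pdivlMr// [x i ord0 * _]mulrC.
    by rewrite floor_le floorD1_gt.
  apply/matrixP => i j; rewrite ord1 mxE; apply/floor_def.
  have := H i I; rewrite /= in_itv/= ler_pdivrMr// ltr_pdivlMr//.
  by rewrite [x i ord0 * _]mulrC.
apply: fin_bigcap_measurable => // i _.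
by rewrite -[_ @^-1` _]setTI; apply: measurable_cV_coord.
Qed.

(* A continuous function is the limit of its values on finer and finer grids. *)
Lemma continuous_cV_measurable (f : 'cV[R]_n -> R) :
  continuous (f : 'cV[R]_n -> R^o) -> measurable_fun setT f.
Proof.
move=> cf; apply: (@measurable_fun_cvg _ _ _ _ (fun k x => f (of_grid k (grid k x)))).
  move=> k _ Y mY; rewrite setTI.
  rewrite (_ : _ @^-1` _ = \bigcup_(c in [set: 'cV[int]_n])
     ([set x | grid k x = c] `&` [set x | Y (f (of_grid k c))])); last first.
    by apply/seteqP; split => [x /= Yx|x /= [c _ [<-]]//]; exists (grid k x).
  apply: countable_bigcupT_measurable => // c; apply: measurableI => //.
  have [Yc|Yc] := pselect (Y (f (of_grid k c))).
    by rewrite (_ : [set x | _] = setT)//; apply/seteqP; split.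
  by rewrite (_ : [set x | _] = set0)//; apply/seteqP; split.
move=> x _; apply: (@cvg_comp _ _ _ (fun k => of_grid k (grid k x)) f _ (nbhs x)); last exact: cf.
apply: cvg_matrix => i j; rewrite ord1.
apply/cvgrPdist_le => e e0.
near=> k.
have k0 : (0 : R) < k.+1%:R by [].
have -> : of_grid k (grid k x) i ord0 = (Num.floor (k.+1%:R * x i ord0))%:~R / k.+1%:R.
  by rewrite !mxE.
have h1 : (Num.floor (k.+1%:R * x i ord0))%:~R <= k.+1%:R * x i ord0 by exact: floor_le.
have h2 : k.+1%:R * x i ord0 < (Num.floor (k.+1%:R * x i ord0) + 1)%:~R by exact: floorD1_gt.
rewrite intrD in h2.
set z := (Num.floor _)%:~R in h1 h2 *.
apply: (@le_trans _ _ (k.+1%:R^-1)).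
  rewrite (_ : x i ord0 - z / k.+1%:R = (k.+1%:R * x i ord0 - z) / k.+1%:R); last first.
    by field; rewrite addrC natr1 gt_eqF.
  rewrite normrM [`|_^-1|]ger0_norm ?invr_ge0// ler_piMl ?invr_ge0//.
  by rewrite ger0_norm ?subr_ge0//; move: h2; rewrite mulr1z; lra.
near: k; apply: filterS (near_infty_natSinv_lt (PosNum e0)) => k; exact: ltW.
Unshelve. all: by end_near. Qed.

Lemma measurable_inner d (T : measurableType d) (F G : T -> 'cV[R]_n) :
  measurable_fun setT F -> measurable_fun setT G ->
  measurable_fun setT (fun x => inner (F x) (G x)).
Proof.
move=> mF mG; under eq_fun do rewrite innerE.
apply: measurable_sum => i; apply: measurable_funM.
  exact: measurableT_comp (measurable_cV_coord i) mF.
exact: measurableT_comp (measurable_cV_coord i) mG.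
Qed.

Lemma measurable_enorm d (T : measurableType d) (F : T -> 'cV[R]_n) :
  measurable_fun setT F -> measurable_fun setT (fun x => enorm (F x)).
Proof.
move=> mF; have mi := measurable_inner mF mF.
exact: measurableT_comp (continuous_measurable_fun (@sqrt_continuous R)) mi.
Qed.

Lemma measurable_mulmx_cV d (T : measurableType d) (M : 'M[R]_n) (F : T -> 'cV[R]_n) :
  measurable_fun setT F -> measurable_fun setT (fun x => M *m F x).
Proof.
move=> mF; apply: measurable_fun_cV => i; under eq_fun do rewrite mxE.
apply: measurable_sum => j; apply: measurable_funM => //.
exact: measurableT_comp (measurable_cV_coord j) mF.
Qed.

Lemma measurable_funB_cV d (T : measurableType d) (F G : T -> 'cV[R]_n) :
  measurable_fun setT F -> measurable_fun setT G ->
  measurable_fun setT (fun x => F x - G x).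
Proof.
move=> mF mG; apply: measurable_fun_cV => i; under eq_fun do rewrite !mxE.
apply: measurable_funB.
  exact: measurableT_comp (measurable_cV_coord i) mF.
exact: measurableT_comp (measurable_cV_coord i) mG.
Qed.

Lemma measurable_pot (Q B : 'M[R]_n) : measurable_fun setT (OUpot Q B).
Proof.
apply: measurable_funM => //; apply: measurable_inner => //.
exact: measurable_mulmx_cV.
Qed.

Lemma measurable_ker (Q B : 'M[R]_n) t x : measurable_fun setT (OUker Q B t x).
Proof.
apply: measurableT_comp (measurable_gauss_pdf _) _.
exact: measurable_funB_cV.
Qed.

Lemma measurable_majorant k :
  measurable_fun setT (fun xu : 'cV[R]_n * 'cV[R]_n => OUmajorant k xu.1 xu.2).
Proof.
have m2 : measurable_fun setT (fun xu : 'cV[R]_n * 'cV[R]_n => 1 + enorm xu.2).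
  by apply: measurable_funD => //; apply: measurable_enorm.
apply: measurable_funM; first exact: measurable_funX.
apply: measurableT_comp => //; apply: measurableT_comp => //.
apply: measurable_funM => //; apply: measurable_funM => //.
by apply: measurable_enorm; apply: measurable_funB_cV.
Qed.

End measurability_cV.

(** * Integrals of the majorant *)

Section laplace.
Context {R : realType}.

(** The majorant with its scale [1 + |u|] frozen to a constant [a]. *)
Definition lapl {n} (a k : R) (z : 'cV[R]_n) : R :=
  a ^+ n * expR (- (k * (a * enorm z))).

Lemma lapl_ge0 {n} a k (z : 'cV[R]_n) : 0 <= a -> 0 <= lapl a k z.
Proof. by move=> a0; rewrite mulr_ge0 ?expR_ge0 ?exprn_ge0. Qed.

Lemma measurable_lapl {n} a k : measurable_fun setT (@lapl n a k).
Proof.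
apply: measurable_funM => //; apply: measurableT_comp => //.
apply: measurableT_comp => //; apply: measurable_funM => //.
by apply: measurable_funM => //; exact: measurable_enorm.
Qed.

Let h1 (a k s : R) := a * expR (- (k * (a * `|s|))).

Let continuous_h1 a k : continuous (h1 a k).
Proof.
have c1 : continuous (fun s : R => - (k * (a * `|s|))).
  move=> s; apply: cvgN; apply: cvgM; first exact: cvg_cst.
  by apply: cvgM; [exact: cvg_cst|exact: norm_continuous].
move=> s; apply: cvgM; first exact: cvg_cst.
exact: (@cvg_comp _ _ _ (fun s => - (k * (a * `|s|))) (@expR R) _ _ _ (c1 s) (@continuous_expR R _)).
Qed.

Lemma integral_laplace (a k : R) : 0 < a -> 0 < k ->
  (\int[lebesgue_measure]_s (a * expR (- (k * (a * `|s|))))%:E = (2 / k)%:E)%E.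
Proof.
move=> a0 k0; rewrite -[LHS]/(\int[lebesgue_measure]_s (h1 a k s)%:E)%E.
rewrite ge0_symfun_integralT.
- transitivity (2%:E * (k^-1)%:E)%E; last by rewrite -EFinM.
  congr (_ * _)%E.
  transitivity (\int[lebesgue_measure]_(s in `[0%R, +oo[) (a * expR (- (k * a) * s))%:E)%E.
    rewrite (_ : [set x | 0 <= x] = `[0, +oo[%classic); last first.
      by apply/seteqP; split => s /=; rewrite in_itv/= andbT.
    apply: eq_integral => s; rewrite inE/= in_itv/= andbT => s0.
    by rewrite /h1 ger0_norm// mulNr mulrA.
  rewrite integrable_expR_tail ?mulr_gt0 ?(ltW a0)// mulr0 expR0 mulr1.
  by congr EFin; field; rewrite !gt_eqF.
- by move=> s; rewrite mulr_ge0 ?expR_ge0// ltW.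
- exact: continuous_h1.
- by move=> s /=; rewrite /h1 normrN.
Qed.

(** The norm is at least the mean of the [|z_i|], so the integrand is below a product of
    one-dimensional Laplace profiles of rate [k / n]. The scale [a] drops out, which is why the
    bound is uniform. *)
Lemma lapl_integral {n} (a k : R) (x : 'cV[R]_n) : (1 <= n)%N -> 0 < a -> 0 < k ->
  (\int[@leb_cV R n]_u (lapl a k (x - u))%:E <= ((2 / (k / n%:R)) ^+ n)%:E)%E.
Proof.
move=> n1 a0 k0.
have n0 : 0 < n%:R :> R by rewrite ltr0n.
have kn0 : 0 < k / n%:R by rewrite divr_gt0.
have mh : measurable_fun setT (h1 a (k / n%:R)).
  by apply: continuous_measurable_fun; exact: continuous_h1.
have h0 s : 0 <= h1 a (k / n%:R) s by rewrite mulr_ge0 ?expR_ge0// ltW.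
rewrite (@ge0_integral_reflection_cV R n x (fun z => (lapl a k z)%:E)); last 2 first.
- by apply/measurable_EFinP; exact: measurable_lapl.
- by move=> z; rewrite lee_fin lapl_ge0// ltW.
rewrite -(ge0_integral_prod_cV n mh h0 (integral_laplace a0 kn0)).
apply: ge0_le_integral_nonmeasurable => z; first by rewrite lee_fin lapl_ge0// ltW.
rewrite lee_fin /lapl /h1 big_split/= prodr_const card_ord ler_wpM2l ?exprn_ge0 ?(ltW a0)//.
rewrite -expR_sum ler_expR sumrN lerN2.
rewrite -mulr_sumr -mulr_sumr.
rewrite (_ : k / n%:R * _ = k * (a * ((\sum_(i < n) `|z i ord0|) / n%:R))); last by ring.
rewrite !ler_wpM2l ?(ltW a0) ?(ltW k0)// ler_pdivrMr//.
apply: (@le_trans _ _ (\sum_(i < n) enorm z)).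
  by apply: ler_sum => i _; exact: normr_le_enorm.
by rewrite sumr_const card_ord mulr_natr.
Qed.

(** Needed for the integral in [u], where the scale varies. If [|x - u| <= 1], then [1 + |u|] and
    [1 + |x|] agree up to a factor [2]; otherwise half of the exponential absorbs [(1 + |u|)^n] and
    the other half still decays at unit scale. *)
Lemma majorant_le_lapl {n} (k : R) : 0 < k -> exists2 C, 0 < C & forall x u : 'cV[R]_n,
  OUmajorant k x u <=
    2 ^+ n * lapl (1 + enorm x) (k / 2) (x - u) + C * lapl 1 (k / 2) (x - u).
Proof.
move=> k0; have k20 : 0 < k / 2 by rewrite divr_gt0.
have [C C0 HC] := @expr_expRN_bound R n (k / 2) k20.
exists C => // x u.
have x0 := enorm_ge0 x; have u0 := enorm_ge0 u; have d0 := enorm_ge0 (x - u).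
have ax0 : 0 <= 1 + enorm x by rewrite addr_ge0.
have au0 : 0 <= 1 + enorm u by rewrite addr_ge0.
have xu : enorm x <= enorm u + enorm (x - u).
  by rewrite -{1}(subrK u x) addrC enormD.
have ux : enorm u <= enorm x + enorm (x - u).
  by rewrite -{1}(subrK x u) addrC enorm_distC (le_trans (enormD _ _)).
have [d1|d1] := leP (enorm (x - u)) 1.
  rewrite -[leLHS]addr0 lerD//; last by rewrite mulr_ge0 ?lapl_ge0// ltW.
  rewrite /OUmajorant /lapl [leRHS]mulrA -exprMn ler_pM ?exprn_ge0 ?expR_ge0//.
    by rewrite lerXn2r ?nnegrE ?mulr_ge0//; lra.
  rewrite ler_expR lerN2 -[leLHS]mulrA ler_wpM2l ?(ltW k0)// mulrA.
  by rewrite ler_wpM2r//; lra.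
rewrite -[leLHS]add0r lerD//; first by rewrite mulr_ge0 ?exprn_ge0 ?lapl_ge0.
rewrite /OUmajorant /lapl expr1n mul1r.
have -> : - (k * ((1 + enorm u) * enorm (x - u))) =
    - (k / 2 * ((1 + enorm u) * enorm (x - u))) + - (k / 2 * ((1 + enorm u) * enorm (x - u))).
  by field.
rewrite expRD mulrA ler_pM ?mulr_ge0 ?exprn_ge0 ?expR_ge0//.
  rewrite (le_trans _ (HC (1 + enorm u) au0))// ler_wpM2l ?exprn_ge0//.
  rewrite ler_expR lerN2 ler_wpM2l ?(ltW k20)// ler_peMr// ltW//.
rewrite ler_expR lerN2 ler_wpM2l ?(ltW k20)// ler_wpM2r//; lra.
Qed.

Lemma majorant_integrals {n} (k : R) : (1 <= n)%N -> 0 < k -> exists2 W, 0 < W &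
  (forall x, \int[@leb_cV R n]_u (OUmajorant k x u)%:E <= W%:E)%E /\
  (forall u, \int[@leb_cV R n]_x (OUmajorant k x u)%:E <= W%:E)%E.
Proof.
move=> n1 k0; have [C C0 HC] := @majorant_le_lapl n k k0.
have k20 : 0 < k / 2 by rewrite divr_gt0.
have n0 : 0 < n%:R :> R by rewrite ltr0n.
pose w1 := (2 / (k / n%:R)) ^+ n; pose w2 := (2 / (k / 2 / n%:R)) ^+ n.
have w10 : 0 < w1 by rewrite exprn_gt0// !divr_gt0.
have w20 : 0 < w2 by rewrite exprn_gt0// !divr_gt0.
have ax0 (x : 'cV[R]_n) : 0 < 1 + enorm x by rewrite ltr_pwDl ?enorm_ge0.
exists (w1 + (2 ^+ n * w2 + C * w2)).
  by rewrite addr_gt0// addr_gt0// mulr_gt0// exprn_gt0.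
have m0 (x u : 'cV[R]_n) : 0 <= OUmajorant k x u.
  by rewrite mulr_ge0 ?expR_ge0 ?exprn_ge0// ltW.
have mshift a b (x : 'cV[R]_n) :
    measurable_fun setT (fun u : 'cV[R]_n => (lapl a b (x - u))%:E).
  have mx : measurable_fun setT (fun u : 'cV[R]_n => x - u).
    by apply: measurable_funB_cV; [exact: measurable_cst|exact: measurable_id].
  by apply/measurable_EFinP; exact: measurableT_comp (measurable_lapl a b) mx.
have scale (c a b : R) (x : 'cV[R]_n) : 0 <= c -> 0 < a ->
    (\int[@leb_cV R n]_u (c%:E * (lapl a b (x - u))%:E)
      = c%:E * \int[@leb_cV R n]_u (lapl a b (x - u))%:E)%E.
  move=> c0 a0; apply: ge0_integralZl => //.
  by move=> u _; rewrite lee_fin lapl_ge0// ltW.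
split=> [x|u].
  apply: (@le_trans _ _ (\int[@leb_cV R n]_u ((2 ^+ n)%:E * (lapl (1 + enorm x) (k / 2) (x - u))%:E
      + C%:E * (lapl 1 (k / 2) (x - u))%:E)))%E.
    apply: ge0_le_integral_nonmeasurable => u; first by rewrite lee_fin.
    by rewrite -!EFinM -EFinD lee_fin HC.
  rewrite ge0_integralD//; last 4 first.
  - by move=> u _; rewrite lee_fin mulr_ge0 ?exprn_ge0 ?lapl_ge0 ?(ltW (ax0 x)).
  - exact: measurable_funeM.
  - by move=> u _; rewrite lee_fin mulr_ge0 ?lapl_ge0 ?(ltW C0).
  - exact: measurable_funeM.
  rewrite !scale ?exprn_ge0 ?(ltW C0)//.
  rewrite [leRHS]EFinD -[leLHS]add0e leeD ?lee_fin ?(ltW w10)//.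
  rewrite EFinD !EFinM leeD// lee_wpmul2l ?lee_fin ?exprn_ge0 ?(ltW C0)//; exact: lapl_integral.
(* In the integral in [x] the scale is already constant. *)
apply: (@le_trans _ _ (\int[@leb_cV R n]_x (lapl (1 + enorm u) k (u - x))%:E))%E.
  apply: ge0_le_integral_nonmeasurable => x; rewrite lee_fin//.
  by rewrite /OUmajorant /lapl enorm_distC.
rewrite (le_trans (lapl_integral u n1 (ax0 u) k0))// lee_fin -/w1 lerDl.
exact: addr_ge0 (mulr_ge0 (exprn_ge0 _ (ler0n _ _)) (ltW w20)) (mulr_ge0 (ltW C0) (ltW w20)).
Qed.

End laplace.

(** * Schur's test *)

Section schur.
Local Open Scope ereal_scope.

Lemma ge0_le_poweR (R : realType) (r : R) (x y : \bar R) :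
  (0 <= r)%R -> 0 <= x -> x <= y -> x `^ r <= y `^ r.
Proof.
move=> r0 x0 xy; apply: gt0_ler_poweR => //; rewrite in_itv/= ?x0 ?leey//.
by rewrite (le_trans x0 xy).
Qed.

Context d (T : measurableType d) (R : realType).
Variable mu : {sigma_finite_measure set T -> \bar R}.

(** Split [M = M^(1/p) M^(1/q)] with [1/p + 1/q = 1]. Hölder and the bound on the integral in [u]
    give [(int M g)^p <= W^(p-1) int M g^p] pointwise; Tonelli and the bound on the integral in [x]
    contribute the last factor [W]. *)
Lemma schur_test (M : T -> T -> R) (g : T -> R) (W p : R) : (1 < p)%R -> (0 < W)%R ->
  measurable_fun setT (fun xu : T * T => M xu.1 xu.2) ->
  (forall x u, (0 <= M x u)%R) ->
  (forall x, \int[mu]_u (M x u)%:E <= W%:E) ->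
  (forall u, \int[mu]_x (M x u)%:E <= W%:E) ->
  measurable_fun setT g -> (forall u, (0 <= g u)%R) ->
  \int[mu]_x (\int[mu]_u (M x u * g u)%:E) `^ p
    <= (W `^ p)%:E * \int[mu]_u (g u `^ p)%:E.
Proof.
move=> p1 W0 mM M0 MW1 MW2 mg g0.
have p0 : (0 < p)%R by rewrite (lt_trans ltr01).
have pm1 : (0 < p - 1)%R by rewrite subr_gt0.
pose q := (p / (p - 1))%R.
have q0 : (0 < q)%R by rewrite divr_gt0.
have pq : (p^-1 + q^-1 = 1)%R by rewrite /q; field; rewrite !gt_eqF.
have mMx x : measurable_fun setT (M x).
  exact: (measurableT_comp mM (measurable_pair1 x)).
have mgp : measurable_fun setT (fun u => g u `^ p)%R.
  exact: (measurableT_comp (measurable_powR _) mg).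
have mMg : measurable_fun setT (fun xu : T * T => (M xu.1 xu.2 * g xu.2 `^ p)%:E).
  apply/measurable_EFinP; apply: measurable_funM => //.
  exact: measurableT_comp mgp measurable_snd.
have pointwise x : (\int[mu]_u (M x u * g u)%:E) `^ p
    <= (W `^ (p - 1))%:E * \int[mu]_u (M x u * g u `^ p)%:E.
  pose a u := (M x u `^ q^-1)%R.
  pose b u := (M x u `^ p^-1 * g u)%R.
  have ma : measurable_fun setT a.
    exact: (measurableT_comp (measurable_powR _) (mMx x)).
  have mb : measurable_fun setT b.
    apply: measurable_funM => //.
    exact: (measurableT_comp (measurable_powR _) (mMx x)).
  have a0 u : (0 <= a u)%R by exact: powR_ge0.
  have b0 u : (0 <= b u)%R by rewrite mulr_ge0 ?powR_ge0.
  have := hoelder mu mb ma p0 q0 pq.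
  rewrite Lnorm1 => H.
  have -> : \int[mu]_u (M x u * g u)%:E = \int[mu]_u `|(EFin \o (b \* a)%R) u|.
    apply: eq_integral => u _; rewrite -[RHS]/(`|b u * a u|%:E).
    rewrite ger0_norm; last by rewrite mulr_ge0.
    rewrite /a /b mulrAC -powRD ?pq ?powRr1//.
    by rewrite (gt_eqF ltr01).
  apply: (le_trans (ge0_le_poweR (ltW p0) _ H)); first exact: integral_ge0.
  rewrite poweRM ?Lnorm_ge0// poweR_Lnorm ?gt_eqF// muleC lee_pmul ?poweR_ge0//.
  - by apply: integral_ge0 => u _; exact: poweR_ge0.
  - have -> : (p = q * (p - 1))%R by rewrite /q divfK// gt_eqF.
    rewrite poweRrM poweR_Lnorm ?gt_eqF// -poweR_EFin.
    rewrite (_ : (q * (p - 1) - 1 = p - 1)%R); last by rewrite /q divfK// gt_eqF.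
    apply: ge0_le_poweR; [exact: ltW| |].
      by apply: integral_ge0 => u _; exact: poweR_ge0.
    apply: le_trans (MW1 x); rewrite le_eqVlt; apply/orP; left; apply/eqP.
    apply: eq_integral => u _ /=; rewrite ger0_norm// /a -powRrM mulVf ?gt_eqF//.
    by rewrite powRr1.
  - rewrite le_eqVlt; apply/orP; left; apply/eqP.
    apply: eq_integral => u _ /=; rewrite ger0_norm// /b powRM ?powR_ge0//.
    by rewrite -powRrM mulVf ?gt_eqF// powRr1.
have Mg0 x u : (0 <= M x u * g u `^ p)%R by rewrite mulr_ge0 ?powR_ge0.
have mF : measurable_fun setT (fun x => \int[mu]_u (M x u * g u `^ p)%:E).
  by apply: (@measurable_fun_fubini_tonelli_F _ _ _ _ _ mu
    (fun xu => (M xu.1 xu.2 * g xu.2 `^ p)%:E)) => // xu; rewrite lee_fin.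
apply: (@le_trans _ _ (\int[mu]_x
    ((W `^ (p - 1))%:E * \int[mu]_u (M x u * g u `^ p)%:E))).
  by apply: ge0_le_integral_nonmeasurable => // x; exact: poweR_ge0.
rewrite ge0_integralZl//; last 2 first.
- by move=> x _; apply: integral_ge0 => u _; rewrite lee_fin.
- by rewrite lee_fin powR_ge0.
have -> : (W `^ p = W `^ (p - 1) * W)%R by rewrite mulrC mulr_powRB1// ltW.
rewrite EFinM -muleA lee_wpmul2l ?lee_fin ?powR_ge0//.
rewrite (@fubini_tonelli _ _ _ _ _ mu mu (fun xu => (M xu.1 xu.2 * g xu.2 `^ p)%:E))//=; last first.
  by move=> xu; rewrite lee_fin.
rewrite -ge0_integralZl//; last 3 first.
- exact/measurable_EFinP.
- by move=> u _; rewrite lee_fin powR_ge0.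
- by rewrite lee_fin ltW.
apply: ge0_le_integral_nonmeasurable => u.
  by apply: integral_ge0 => x _; rewrite lee_fin.
under eq_integral do rewrite mulrC EFinM.
rewrite ge0_integralZl//; last 3 first.
- by apply/measurable_EFinP; exact: measurableT_comp mM (measurable_pair2 u).
- by move=> x _; rewrite lee_fin.
- by rewrite lee_fin powR_ge0.
by rewrite muleC lee_wpmul2r ?lee_fin ?powR_ge0.
Qed.

End schur.

(** * The global part *)

Section jump_bound.
Context {R : realType}.
Local Open Scope ereal_scope.

Lemma poweR_le_id (x : \bar R) (r : R) : (0 < r <= 1)%R -> x = 0 \/ 1 <= x -> x `^ r <= x.
Proof.
move=> /andP[r0 r1] [->|]; first by rewrite poweR0r// gt_eqF.
case: x => [x||//]; last by rewrite poweRyr// gt_eqF.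
by rewrite !lee_fin => x1; exact: ler1_powR.
Qed.

(** The jump number is [0] or at least [1], so its power [1/rho] does not exceed it; this is why the
    final constant is independent of [rho]. Then [N] jumps above [la] contribute at least [N la] to
    the variation. *)
Lemma jump_number_le (I : set R) (a : R -> R) (la rho : R) (G : \bar R) :
  (0 < la)%R -> (1 <= rho)%R -> 0 <= G ->
  (forall N (t : nat -> R), (forall i, (i <= N)%N -> I (t i)) ->
     (forall i, (i < N)%N -> (t i < t i.+1)%R) ->
     (\sum_(i < N) `|a (t i.+1) - a (t i)|)%R%:E <= G) ->
  la%:E * jump_number I a la `^ rho^-1 <= G.
Proof.
move=> la0 rho1 G0 HG; set J := jump_number I a la.
have rho0 : (0 < rho)%R by rewrite (lt_le_trans ltr01).
have J01 : J = 0 \/ 1 <= J.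
  have [[N [N1 HN]]|H] := pselect (exists N, (1 <= N)%N /\ has_jumps I a la N).
    right; apply: (@le_trans _ _ (N%:R)%:E); first by rewrite lee_fin ler1n.
    by apply: ereal_sup_ubound; right; exists N.
  left; rewrite /J /jump_number (_ : _ `|` _ = [set 0]) ?ereal_sup1//.
  apply/seteqP; split => [y [//|/= [N HN _]]|y ->]; last by left.
  by exfalso; apply: H; exists N.
apply: (@le_trans _ _ (la%:E * J)).
  apply: lee_wpmul2l; first by rewrite lee_fin ltW.
  by apply: poweR_le_id => //; rewrite invr_gt0 rho0 invf_le1.
rewrite muleC -lee_pdivlMr//; apply: ge_ereal_sup => y [->|/= [N [N1 [t [It Ht]]] <-]].
  by rewrite mule_ge0// lee_fin invr_ge0 ltW.
rewrite lee_pdivlMr//; apply: le_trans (HG N t It _); last by move=> i /Ht[].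
rewrite -EFinM lee_fin.
have -> : (N%:R * la = \sum_(i < N) la)%R by rewrite sumr_const card_ord mulr_natl.
by apply: ler_sum => i _; have [_ /ltW] := Ht i (ltn_ord i).
Qed.

End jump_bound.

(** * Gaussian integrals as Lebesgue integrals *)

Section gaussian_integrals.
Context {R : realType} {n : nat}.
Local Open Scope ereal_scope.
Notation leb := (@leb_cV R n).

Lemma ge0_integral_gaussian (S : 'M[R]_n) (f : 'cV[R]_n -> \bar R) :
  measurable_fun setT f -> (forall x, 0 <= f x) ->
  \int[gaussian S]_x f x = \int[leb]_x (f x * (gauss_pdf S x)%:E).
Proof.
move=> mf f0; apply: ge0_integral_density mf f0.
- exact: measurable_gauss_pdf.
- exact: gauss_pdf_ge0.
- by [].
Qed.

Lemma OU_ker (Q B : 'M[R]_n) (t : R) (g : 'cV[R]_n -> R) (x : 'cV[R]_n) :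
  measurable_fun setT g ->
  OU Q B t g x = (\int[leb]_u (g u * OUker Q B t x u))%R.
Proof.
move=> mg; rewrite /OU /Rintegral; congr fine.
set S := OUcov Q B t%:E; pose Ex := (expmx (t *: B) *m x)%R.
have mrefl : measurable_fun setT (fun u : 'cV[R]_n => Ex - u)%R.
  by apply: measurable_funB_cV; [exact: measurable_cst|exact: measurable_id].
have key (F : 'cV[R]_n -> R) : measurable_fun setT F -> (forall u, (0 <= F u)%R) ->
    \int[OUmeasure Q B t%:E]_y (F (Ex - y)%R)%:E = \int[leb]_u (F u * OUker Q B t x u)%:E.
  move=> mF F0; rewrite ge0_integral_gaussian; last 2 first.
  - by apply/measurable_EFinP; exact: measurableT_comp mF mrefl.
  - by move=> y; rewrite lee_fin.
  rewrite -(@ge0_integral_reflection_cV R n Ex (fun u => (F u * OUker Q B t x u)%:E)).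
  - by apply: eq_integral => y _; rewrite EFinM /OUker -/Ex subKr.
  - by apply/measurable_EFinP; apply: measurable_funM => //; exact: measurable_ker.
  - by move=> u; rewrite lee_fin mulr_ge0//; exact: ker_ge0.
(* Positive and negative parts are treated separately, so the two sides agree even where the
   integral diverges. *)
rewrite integralE [RHS]integralE; congr (_ - _).
  transitivity (\int[OUmeasure Q B t%:E]_y (Num.max (g (Ex - y)%R) 0%R)%:E).
    by apply: eq_integral => y _; rewrite funeposE -EFin_max.
  rewrite (key (fun u => Num.max (g u) 0%R)); last 2 first.
  - exact: measurable_maxr.
  - by move=> u; rewrite le_max lexx orbT.
  apply: eq_integral => u _; rewrite funeposE -EFin_max; congr EFin.
  by rewrite maxr_pMl ?ker_ge0// mul0r.
transitivity (\int[OUmeasure Q B t%:E]_y (Num.max (- g (Ex - y)) 0)%R%:E).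
  by apply: eq_integral => y _; rewrite funenegE -EFinN -EFin_max.
rewrite (key (fun u => (Num.max (- g u) 0)%R)); last 2 first.
- by apply: measurable_maxr => //; exact: measurableT_comp.
- by move=> u; rewrite le_max lexx orbT.
apply: eq_integral => u _; rewrite funenegE -EFinN -EFin_max; congr EFin.
by rewrite maxr_pMl ?ker_ge0// mul0r mulNr.
Qed.

End gaussian_integrals.

Section invariant_measure.
Context {R : realType} {n : nat} (Q B : 'M[R]_n).
Hypotheses (n_ge1 : (1 <= n)%N) (Q_posdef : posdefmx Q) (B_stable : hurwitzmx B).
Local Open Scope ereal_scope.
Notation leb := (@leb_cV R n).
Notation pot := (OUpot Q B).
Notation gam := (OUmeasure Q B +oo).

Lemma gauss_pdf_invariant : exists2 K : R, (0 < K)%R &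
  forall x, gauss_pdf (OUcov Q B +oo) x = (K * expR (- pot x))%R.
Proof.
have [l [b [K [[l0 _ _] [PF _ _ _ _]]]]] := OU_estimates Q_posdef B_stable.
exists ((2 * pi) `^ (- (n%:R / 2)) * (\det (OUcov Q B +oo)) `^ (- 2^-1))%R.
  rewrite mulr_gt0// powR_gt0 ?mulr_gt0 ?pi_gt0//.
  exact: form_between_det_gt0 l0 PF.
by move=> x; rewrite /gauss_pdf /OUpot mulNr.
Qed.

(** Since [c |u|^2 >= |u| - 1 / (4c)], the Gaussian is below a Laplace profile, whose integral is
    already known to be finite. *)
Lemma integral_expR_pot : \int[leb]_u (expR (- pot u))%:E < +oo.
Proof.
have [l [b [K [[l0 b0 _] [PF _ _ _ _]]]]] := OU_estimates Q_posdef B_stable.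
pose c := (2^-1 * b^-1)%R; have c0 : (0 < c)%R by rewrite mulr_gt0// invr_gt0.
have H u : (expR (- pot u) <= expR ((4 * c)^-1) * lapl 1 1 (0 - u))%R.
  rewrite /lapl expr1n !mul1r -expRD ler_expR sub0r enormN.
  have : (c * enorm u ^+ 2 <= pot u)%R.
    by rewrite /pot -mulrA ler_wpM2l// (form_invmx_ge l0 PF).
  have : (0 <= c * (enorm u - (2 * c)^-1) ^+ 2)%R by rewrite mulr_ge0 ?sqr_ge0// ltW.
  have -> : (c * (enorm u - (2 * c)^-1) ^+ 2 = c * enorm u ^+ 2 - enorm u + (4 * c)^-1)%R.
    by field; rewrite gt_eqF.
  lra.
apply: (@le_lt_trans _ _ (\int[leb]_u ((expR ((4 * c)^-1))%:E * (lapl 1 1 (0 - u))%:E))).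
  apply: ge0_le_integral_nonmeasurable => u; first by rewrite lee_fin expR_ge0.
  by rewrite -EFinM lee_fin.
have ml : measurable_fun setT (fun u : 'cV[R]_n => (lapl 1 1 (0 - u))%:E).
  have m0 : measurable_fun setT (fun u : 'cV[R]_n => 0 - u)%R.
    by apply: measurable_funB_cV; [exact: measurable_cst|exact: measurable_id].
  by apply/measurable_EFinP; exact: measurableT_comp (measurable_lapl 1 1) m0.
rewrite ge0_integralZl//; last by move=> u _; rewrite lee_fin lapl_ge0.
apply: (@le_lt_trans _ _ ((expR ((4 * c)^-1))%:E * ((2 / (1 / n%:R)) ^+ n)%:E)).
  by rewrite lee_wpmul2l ?lee_fin ?expR_ge0// lapl_integral.
by rewrite -EFinM ltry.
Qed.

Lemma Lnorm_invariant (p : R) : (0 < p)%R -> exists2 K : R, (0 < K)%R &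
  forall F : 'cV[R]_n -> \bar R, measurable_fun setT F -> (forall x, 0 <= F x) ->
  'N[gam]_p%:E[F] `^ p = K%:E * \int[leb]_u (F u `^ p * (expR (- pot u))%:E).
Proof.
move=> p0; have [K K0 KE] := gauss_pdf_invariant; exists K => // F mF F0.
rewrite poweR_Lnorm ?gt_eqF//.
under eq_integral do rewrite gee0_abs//.
rewrite ge0_integral_gaussian; last 2 first.
- exact: (measurableT_comp (measurable_poweR _) mF).
- by move=> x; exact: poweR_ge0.
under eq_integral do rewrite KE EFinM muleCA.
rewrite ge0_integralZl//.
- apply: emeasurable_funM.
    exact: (measurableT_comp (measurable_poweR _) mF).
  apply/measurable_EFinP; apply: measurableT_comp => //; apply: measurableT_comp => //.
  exact: measurable_pot.
- by move=> x _; rewrite mule_ge0 ?poweR_ge0// lee_fin expR_ge0.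
- by rewrite lee_fin ltW.
Qed.

(** The invariant measure is finite and [|f| <= 1 + |f|^p]. *)
Lemma integrable_pot (p : R) (f : 'cV[R]_n -> R) : (1 < p)%R ->
  f \in Lfun gam p%:E -> measurable_fun setT f /\
  \int[leb]_u (`|f u| * expR (- pot u))%:E < +oo.
Proof.
move=> p1 fL; have p0 : (0 < p)%R by rewrite (lt_trans ltr01).
have mf : measurable_fun setT f.
  by have /sub_Lfun_mfun := fL; rewrite inE.
have finf : 'N[gam]_p%:E[EFin \o f] < +oo.
  by have /sub_Lfun_finLfun := fL; rewrite inE.
split=> //; have [K K0 HK] := Lnorm_invariant p0.
have mpot : measurable_fun setT (fun u => (expR (- pot u))%:E).
  apply/measurable_EFinP; apply: measurableT_comp => //; apply: measurableT_comp => //.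
  exact: measurable_pot.
have e0 u : (0 <= expR (- pot u))%R by exact: expR_ge0.
have mfp : measurable_fun setT (fun u => (`|f u| `^ p)%R%:E).
  apply/measurable_EFinP; apply: (measurableT_comp (measurable_powR _)).
  exact: measurableT_comp.
have fp : \int[leb]_u ((`|f u| `^ p)%R%:E * (expR (- pot u))%:E) < +oo.
  have mab : measurable_fun setT (abse \o (EFin \o f)).
    apply: measurableT_comp; first exact: abse_measurable.
    exact/measurable_EFinP.
  have := HK (abse \o (EFin \o f)) mab (fun=> abse_ge0 _).
  rewrite Lnorm_abse => HK'.
  have H : 'N[gam]_p%:E[EFin \o f] `^ p < +oo by exact: poweR_lty.
  rewrite HK' in H.
  rewrite ltNge leye_eq; apply/negP => /eqP E.
  by move: H; rewrite [X in _ * X]E gt0_muley ?lte_fin// ltxx.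
apply: (@le_lt_trans _ _ (\int[leb]_u ((expR (- pot u))%:E +
    (`|f u| `^ p)%R%:E * (expR (- pot u))%:E))).
  apply: ge0_le_integral_nonmeasurable => u; first by rewrite lee_fin mulr_ge0.
  rewrite -EFinM -EFinD lee_fin -[X in (_ <= X + _)%R]mul1r -mulrDl ler_wpM2r//.
  have [f1|f1] := leP `|f u|%R 1%R; first by rewrite ler_wpDr// powR_ge0.
  by rewrite ler_wpDl// le1r_powR// ltW.
rewrite ge0_integralD//.
- by rewrite lte_add_pinfty// integral_expR_pot.
- exact: emeasurable_funM.
Qed.

End invariant_measure.

(** * The kernel of the global part *)

Section global_part.
Context {R : realType} {n : nat} (Q B : 'M[R]_n).
Hypotheses (Q_posdef : posdefmx Q) (B_stable : hurwitzmx B).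
Notation leb := (@leb_cV R n).
Notation pot := (OUpot Q B).
Notation ker := (OUker Q B).

Section fixed_function.
Variables (f : 'cV[R]_n -> R).
Hypotheses (mf : measurable_fun setT f)
  (intf : (\int[leb]_u (`|f u| * expR (- pot u))%:E < +oo)%E).

Lemma ker_integrable t y (h : 'cV[R]_n -> R) : 0 < t <= 1 ->
  measurable_fun setT h -> (forall u, `|h u| <= `|f u|) ->
  leb.-integrable setT (fun u => (h u * ker t y u)%:E).
Proof.
move=> t01 mh hf; have [C C0 HC] := ker_pot_bound Q_posdef B_stable t01.
apply/integrableP; split.
  by apply/measurable_EFinP; apply: measurable_funM => //; exact: measurable_ker.
apply: (@le_lt_trans _ _ (\int[leb]_u ((C * expR (pot y))%:E *
    (`|f u| * expR (- pot u))%:E))%E).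
  apply: ge0_le_integral_nonmeasurable => u; first exact: abse_ge0.
  rewrite -EFinM lee_fin normrM mulrCA ler_pM// ger0_norm ?ker_ge0//.
  by rewrite -mulrA -expRD HC.
have mfe : measurable_fun setT (fun u => (`|f u| * expR (- pot u))%:E).
  apply/measurable_EFinP; apply: measurable_funM; first exact: measurableT_comp.
  apply: measurableT_comp => //; apply: measurableT_comp => //.
  exact: measurable_pot.
have Ce0 : (0 <= (C * expR (pot y))%:E)%E by rewrite lee_fin mulr_ge0 ?expR_ge0.
have fe0 u : (0 <= (`|f u| * expR (- pot u))%:E)%E by rewrite lee_fin mulr_ge0 ?expR_ge0.
by rewrite (ge0_integralZl _ measurableT mfe (fun u _ => fe0 u) Ce0) lte_mul_pinfty.
Qed.

(** The cut-off is [eta(u) = 1 - sum_j rt_j(y) r_j(u)]. If [r_j(u)] is nonzero, [u] lies in [4 B_j],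
    whence [1 + |c_j| <= (1 + 4A)(1 + |u|)]. So if [(1 + |u|) |y - u| < A / (1 + 4A)], then
    [|y - u|] is at most the radius of [B_j], [y] lies in [5 B_j] and [rt_j(y) = 1]; the sum is then
    [sum_j r_j(u) = 1]. *)
Lemma OUglob_ker (A : R) (c : nat -> 'cV[R]_n) (r rt : nat -> 'cV[R]_n -> R)
    (y : 'cV[R]_n) : 0 < A -> localization A c r rt ->
  exists eta : 'cV[R]_n -> R, [/\ measurable_fun setT eta,
    forall u, 0 <= eta u <= 1,
    forall u, eta u != 0 -> A / (1 + 4 * A) <= (1 + enorm u) * enorm (y - u) &
    forall t, 0 < t <= 1 -> OUglob Q B r rt t f y = \int[leb]_u (f u * eta u * ker t y u)].
Proof.
move=> A0 [_ rsm r0 rsum rsupp _ _ rt01 _ rt1 _].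
pose h N u := series (fun j => rt j y * r j u) N.
have mr j : measurable_fun setT (r j).
  by apply: continuous_cV_measurable; have [] := rsm j 0%N.
have mh N : measurable_fun setT (h N).
  by apply: measurable_sum => j; exact: measurable_funM.
have term0 j u : 0 <= rt j y * r j u.
  by rewrite mulr_ge0//; have /andP[] := rt01 j y.
have term_le j u : rt j y * r j u <= r j u.
  by rewrite ler_piMl//; have /andP[] := rt01 j y.
have hnd u : nondecreasing_seq (h ^~ u).
  by apply: nondecreasing_series => j _ _; exact: term0.
have r1 N u : series (fun j => r j u) N <= 1.
  rewrite -(cvg_lim _ (rsum u))//; apply: nondecreasing_cvgn_le.
    by apply: nondecreasing_series.
  exact: cvgP (rsum u).
have h1 N u : h N u <= 1.
  by rewrite (le_trans _ (r1 N u))// /h /series/= ler_sum.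
have h0 N u : 0 <= h N u by rewrite /h /series/= sumr_ge0.
have hcvg u : cvgn (h ^~ u).
  apply: nondecreasing_is_cvgn => //; exists 1 => _ [N _ <-]; exact: h1.
pose zeta u := limn (h ^~ u).
have mz : measurable_fun setT zeta.
  by apply: (@measurable_fun_cvg _ _ _ _ h) => // u _; exact: hcvg.
have z01 u : 0 <= zeta u <= 1.
  apply/andP; split.
    by apply: limr_ge; [exact: hcvg|apply: nearW => N; exact: h0].
  by apply: limr_le; [exact: hcvg|apply: nearW => N; exact: h1].
exists (fun u => 1 - zeta u); split.
- exact: measurable_funB.
- by move=> u; have /andP[? ?] := z01 u; rewrite subr_ge0 gerBl; apply/andP; split.
- move=> u; apply: contraR; rewrite -ltNge => near_u.
  suff -> : zeta u = 1 by rewrite subrr.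
  rewrite /zeta (_ : h ^~ u = series (fun j => r j u)); first exact: cvg_lim (rsum u).
  apply/funext => N; rewrite /h /series/=; apply: eq_bigr => j _.
  have [->|rju] := eqVneq (r j u) 0; first by rewrite mulr0.
  rewrite rt1 ?mul1r//.
  have : locball A 4 (c j) u by apply: rsupp; apply: subset_closure.
  rewrite /locball /cball/= => uc.
  set d := 1 + enorm (c j) in uc *.
  have d1 : 1 <= d by rewrite lerDl enorm_ge0.
  have d0 : 0 < d by rewrite (lt_le_trans ltr01).
  have uc4 : enorm (u - c j) <= 4 * A.
    by rewrite (le_trans uc)// ler_pdivrMr// ler_peMr// mulr_ge0// ltW.
  have u0 : 0 < 1 + enorm u by rewrite ltr_pwDl ?enorm_ge0.
  have dA : d <= (1 + 4 * A) * (1 + enorm u).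
    have : enorm (c j) <= enorm u + enorm (u - c j).
      by rewrite -{1}(subrK u (c j)) addrC enorm_distC (le_trans (enormD _ _)).
    have := mulr_ge0 (ltW A0) (enorm_ge0 u); rewrite /d; lra.
  have yu : enorm (y - u) <= A / d.
    move: near_u => /ltW; rewrite ler_pdivlMr; last by rewrite addr_gt0// mulr_gt0.
    rewrite ler_pdivlMr// => H; apply: le_trans H.
    have := ler_wpM2l (enorm_ge0 (y - u)) dA; lra.
  rewrite -[y - c j](subrKA u) (le_trans (enormD _ _))//.
  apply: (@le_trans _ _ (A / d + 4 * A / d)); first exact: lerD.
  by rewrite -mulrDl ler_wpM2r ?invr_ge0 ?(ltW d0)//; lra.
move=> t t01.
have mfh N : measurable_fun setT (fun u => f u * h N u) by exact: measurable_funM.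
have fh_le N u : `|f u * h N u| <= `|f u|.
  by rewrite normrM ler_piMr// ger0_norm.
have fz_le u : `|f u * zeta u| <= `|f u|.
  by have /andP[? ?] := z01 u; rewrite normrM ler_piMr// ger0_norm.
have ih N := ker_integrable y t01 (mfh N) (fh_le N).
have iz := ker_integrable y t01 (measurable_funM mf mz) fz_le.
have if_ := ker_integrable y t01 mf (fun u => lexx _).
have locN N : series (fun j => rt j y * OU Q B t (f \* r j) y) N
    = \int[leb]_u (f u * h N u * ker t y u).
  elim: N => [|N IH].
    rewrite /series/= big_geq// /Rintegral integral0_eq// => u _.
    by rewrite /h /series/= big_geq// mulr0 mul0r.
  rewrite seriesSr IH OU_ker; last exact: measurable_funM.
  have mfr : measurable_fun setT (fun u => f u * r N u) by exact: measurable_funM.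
  have ir : leb.-integrable setT (fun u => (f u * r N u * ker t y u)%:E).
    apply: ker_integrable => // u; rewrite normrM ler_piMr// ger0_norm//.
    apply: le_trans (r1 N.+1 u); rewrite seriesSr lerDr /series/= sumr_ge0//.
  have ir' : leb.-integrable setT (fun u => (rt N y * (f u * r N u * ker t y u))%:E).
    by under eq_fun do rewrite EFinM; exact: integrableZl.
  rewrite -RintegralZl// -RintegralD//; last exact: ih.
  apply: eq_Rintegral => u _.
  have -> : h N.+1 u = h N u + rt N y * r N u by rewrite /h seriesSr.
  by rewrite /=; ring.
have locE : OUloc Q B r rt t f y = \int[leb]_u (f u * zeta u * ker t y u).
  rewrite /OUloc (funext locN); apply/cvg_lim => //.
  have mabs : measurable_fun setT (fun u => `|f u|) by exact: measurableT_comp.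
  have iabs : leb.-integrable setT (fun u => (`|f u| * ker t y u)%:E).
    by apply: ker_integrable => // u; rewrite normr_id.
  have hcv u : (f u * h N u * ker t y u)%:E @[N --> \oo] --> (f u * zeta u * ker t y u)%:E.
    apply: cvg_EFin; first exact: nearW.
    by apply: cvgMr_tmp; apply: cvgMl_tmp; exact: hcvg.
  have dom N u : (`|(f u * h N u * ker t y u)%:E| <= (`|f u| * ker t y u)%:E)%E.
    by rewrite lee_fin normrM (ger0_norm (ker_ge0 _ _ _ _ _)) ler_wpM2r ?ker_ge0.
  (* The partial sums of the cut-off lie between [0] and [1], so [|f|] times the kernel
     dominates. *)
  have [_ _ lim_int] := @dominated_convergence _ _ _ leb setT measurableT
    (fun N u => (f u * h N u * ker t y u)%:E) (fun u => (f u * zeta u * ker t y u)%:E)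
    (fun u => (`|f u| * ker t y u)%:E)
    (fun N => measurable_int _ (ih N)) (measurable_int _ iz)
    (aeW _ (fun u _ => hcv u)) iabs (aeW _ (fun u N _ => dom N u)).
  apply: fine_cvg; rewrite fineK; first exact: lim_int.
  exact: integrable_fin_num.
rewrite /OUglob locE OU_ker// -RintegralB//.
by apply: eq_Rintegral => u _; ring.
Qed.

End fixed_function.

End global_part.

(** * The variation of the global part *)

Section variation.
Context {R : realType} {n : nat} (Q B : 'M[R]_n).
Hypotheses (n_ge1 : (1 <= n)%N) (Q_posdef : posdefmx Q) (B_stable : hurwitzmx B).
Notation leb := (@leb_cV R n).
Notation pot := (OUpot Q B).
Notation ker := (OUker Q B).

(** The sum over the partition is taken inside the integral in [u], where [eta] restricts to the
    region of [ker_variation]. The localization enters only through [A / (1 + 4A)], so [C] and [k]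
    are chosen before it. *)
Lemma OUglob_variation (A th : R) : 0 < A -> 0 < th < 1 ->
  exists C k, [/\ 0 < C, 0 < k & forall c r rt, localization A c r rt ->
    forall f : 'cV[R]_n -> R, measurable_fun setT f ->
    (\int[leb]_u (`|f u| * expR (- pot u))%:E < +oo)%E ->
    forall y N (t : nat -> R), (forall i, (i <= N)%N -> 0 < t i <= 1) ->
    (forall i, (i < N)%N -> t i < t i.+1) ->
    ((\sum_(i < N) `|OUglob Q B r rt (t i.+1) f y - OUglob Q B r rt (t i) f y|)%R%:E
      <= \int[leb]_u (C * expR (th * pot y) *
           (OUmajorant k y u * (`|f u| * expR (- (th * pot u)))))%:E)%E].
Proof.
move=> A0 th01; have c'0 : 0 < A / (1 + 4 * A) by rewrite divr_gt0// addr_gt0// mulr_gt0.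
have [C [k [C0 k0 HC]]] := ker_variation n_ge1 Q_posdef B_stable th01 c'0.
exists C, k; split => // c r rt loc f mf intf y N t It incr.
have [eta [meta eta01 eta_far etaE]] := OUglob_ker Q_posdef B_stable mf intf y A0 loc.
have mker s := measurable_ker Q B s y.
have mfe : measurable_fun setT (fun u => f u * eta u) by exact: measurable_funM.
have fe_le u : `|f u * eta u| <= `|f u|.
  by have /andP[? ?] := eta01 u; rewrite normrM ler_piMr// ger0_norm.
have kint s : 0 < s <= 1 -> leb.-integrable setT (fun u => (f u * eta u * ker s y u)%:E).
  by move=> s01; exact: (ker_integrable Q_posdef B_stable mf intf y s01 mfe fe_le).
pose D i u := `|f u * eta u| * `|ker (t i.+1) y u - ker (t i) y u|.
have mD i : measurable_fun setT (D i).
  apply: measurable_funM; first exact: measurableT_comp.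
  by apply: measurableT_comp => //; exact: measurable_funB.
have diff (i : 'I_N) : (`|OUglob Q B r rt (t i.+1) f y - OUglob Q B r rt (t i) f y|%:E
    <= \int[leb]_u (D i u)%:E)%E.
  have t1 : 0 < t i.+1 <= 1 by exact: It.
  have t0 : 0 < t i <= 1 by apply: It; exact: ltnW.
  rewrite !etaE// -RintegralB//; [|by exact: kint|by exact: kint].
  have iB : leb.-integrable setT
      (fun u => (f u * eta u * ker (t i.+1) y u - f u * eta u * ker (t i) y u)%:E).
    under eq_fun do rewrite EFinB.
    by apply: integrableB => //; exact: kint.
  rewrite EFin_normr_Rintegral//.
  apply: (le_trans (le_abse_integral _ _ _)) => //; first exact: measurable_int iB.
  apply: ge0_le_integral_nonmeasurable => u; first exact: abse_ge0.
  by rewrite lee_fin /D -normrM mulrBr.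
rewrite -sumEFin; apply: (le_trans (lee_sum _ (fun i _ => diff i))).
rewrite -ge0_integral_sum//; last 2 first.
- by move=> i; exact/measurable_EFinP.
- by move=> i u _; rewrite lee_fin mulr_ge0.
apply: ge0_le_integral_nonmeasurable => u.
  by apply: sume_ge0 => i _; rewrite lee_fin mulr_ge0.
rewrite sumEFin lee_fin.
have maj0 : 0 <= OUmajorant k y u.
  by rewrite mulr_ge0 ?expR_ge0// exprn_ge0// addr_ge0// enorm_ge0.
have [eta0|/eta_far far] := eqVneq (eta u) 0.
  rewrite big1 => [|i _]; last by rewrite /D eta0 mulr0 normr0 mul0r.
  apply: mulr_ge0; first by rewrite mulr_ge0 ?expR_ge0// ltW.
  by rewrite mulr_ge0// mulr_ge0 ?expR_ge0.
pose phi s := (1 + s * (1 + enorm u) ^+ 2)^-1.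
have phi01 s : 0 < s -> 0 <= phi s <= 1.
  move=> s0; rewrite /phi; have d1 : 1 <= 1 + s * (1 + enorm u) ^+ 2.
    by rewrite lerDl mulr_ge0 ?sqr_ge0// ltW.
  by rewrite invr_ge0 invf_le1 ?(le_trans ler01)// ?(lt_le_trans ltr01).
pose E := C * OUmajorant k y u * expR (th * (pot y - pot u)).
have E0 : 0 <= E by rewrite mulr_ge0 ?expR_ge0// mulr_ge0// ltW.
(* The sum telescopes to [phi (t 0) - phi (t N) <= 1], whatever the partition. *)
apply: (@le_trans _ _ (\sum_(i < N) (`|f u| * E * (phi (t i) - phi (t i.+1))))).
  apply: ler_sum => i _; rewrite /D -mulrA ler_pM//.
  have /andP[ti0 _] := It i (ltnW (ltn_ord i)); have /andP[_ ti1] := It i.+1 (ltn_ord i).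
  by apply: HC => //; rewrite ltW// incr.
rewrite -mulr_sumr.
have -> : \sum_(i < N) (phi (t i) - phi (t i.+1)) = phi (t 0%N) - phi (t N).
  rewrite -[RHS]opprB -(telescope_sumr (fun i => phi (t i)) (leq0n N)) big_mkord -sumrN.
  by apply: eq_bigr => i _; rewrite opprB.
have /andP[tN _] := It N (leqnn N); have /andP[t0 _] := It 0%N (leq0n N).
have /andP[_ p1] := phi01 _ t0; have /andP[p0 _] := phi01 _ tN.
apply: (@le_trans _ _ (`|f u| * E)).
  apply: ler_piMr; first by apply: mulr_ge0.
  by rewrite lerBlDr (le_trans p1)// lerDl.
rewrite /E mulrBr expRD le_eqVlt; apply/orP; left; apply/eqP; ring.
Qed.

End variation.

Lemma ge0_poweR_le_cancel (R : realType) (p : R) (x y : \bar R) : 0 < p ->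
  (0 <= x)%E -> (0 <= y)%E -> (x `^ p <= y `^ p)%E -> (x <= y)%E.
Proof.
move=> p0 x0 y0 xy.
rewrite -(poweRe1 x0) -(poweRe1 y0) -(mulfV (lt0r_neq0 p0)) !poweRrM.
by apply: ge0_le_poweR => //; [rewrite invr_ge0 ltW|exact: poweR_ge0].
Qed.

(** * Transfer to the invariant measure *)

Section weighted_schur.
Context {R : realType} {n : nat} (Q B : 'M[R]_n).
Hypotheses (Q_posdef : posdefmx Q) (B_stable : hurwitzmx B).
Local Open Scope ereal_scope.
Notation leb := (@leb_cV R n).
Notation pot := (OUpot Q B).
Notation gam := (OUmeasure Q B +oo).

(* The weight [expR (pot / p)] is the [p]-th root of the inverse density of the
   invariant measure, which turns the Gaussian estimate into a Lebesgue one. *)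
Lemma Lnorm_majorant (k p W : R) (f : 'cV[R]_n -> R) (F : 'cV[R]_n -> \bar R) (C : R) :
  (1 < p)%R -> (0 < W)%R -> (0 < C)%R ->
  (forall x, \int[leb]_u (OUmajorant k x u)%:E <= W%:E) ->
  (forall u, \int[leb]_x (OUmajorant k x u)%:E <= W%:E) ->
  measurable_fun setT f -> (forall y, 0 <= F y) ->
  (forall y, F y <= \int[leb]_u (C * expR (p^-1 * pot y) *
     (OUmajorant k y u * (`|f u| * expR (- (p^-1 * pot u)))))%:E) ->
  'N[gam]_p%:E[F] <= (C * W)%:E * 'N[gam]_p%:E[EFin \o f].
Proof.
move=> p1 W0 C0 MW1 MW2 mf F0 FG; have p0 : (0 < p)%R by rewrite (lt_trans ltr01).
have pN0 : p != 0%R by rewrite gt_eqF.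
have [K K0 HK] := Lnorm_invariant Q_posdef B_stable p0.
pose g u := (`|f u| * expR (- (p^-1 * pot u)))%R.
have g0 u : (0 <= g u)%R by rewrite mulr_ge0 ?expR_ge0.
have mpot := measurable_pot Q B.
have mg : measurable_fun setT g.
  apply: measurable_funM; first exact: measurableT_comp.
  apply: measurableT_comp => //; apply: measurableT_comp => //.
  exact: measurable_funM.
have M0 (x u : 'cV[R]_n) : (0 <= OUmajorant k x u)%R.
  by rewrite mulr_ge0 ?expR_ge0// exprn_ge0// addr_ge0// enorm_ge0.
pose I y := \int[leb]_u (OUmajorant k y u * g u)%:E.
have I0 y : 0 <= I y by apply: integral_ge0 => u _; rewrite lee_fin mulr_ge0.
have mMg : measurable_fun setT (fun xu : 'cV[R]_n * 'cV[R]_n =>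
    (OUmajorant k xu.1 xu.2 * g xu.2)%:E).
  apply/measurable_EFinP; apply: measurable_funM; first exact: measurable_majorant.
  exact: measurableT_comp mg measurable_snd.
have mI : measurable_fun setT I.
  apply: (@measurable_fun_fubini_tonelli_F _ _ _ _ _ leb _ mMg) => xu.
  by rewrite lee_fin mulr_ge0.
pose w y := (C * expR (p^-1 * pot y))%R.
have w0 y : (0 <= w y)%R by rewrite mulr_ge0 ?expR_ge0// ltW.
have mw : measurable_fun setT (EFin \o w).
  apply/measurable_EFinP; apply: measurable_funM => //.
  by apply: measurableT_comp => //; exact: measurable_funM.
have FG' y : F y <= (w y)%:E * I y.
  rewrite -ge0_integralZl_EFin//.
  - by move=> u _; rewrite lee_fin mulr_ge0.
  - exact: (measurableT_comp mMg (measurable_pair1 y)).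
apply: (@ge0_poweR_le_cancel _ p) => //; first exact: Lnorm_ge0.
  by rewrite mule_ge0 ?Lnorm_ge0// lee_fin mulr_ge0// ltW.
pose G y := (w y)%:E * I y.
(* [F] will be the jump function, whose measurability is not assumed. It is replaced by the
   measurable [G] before the norm is rewritten as a Lebesgue integral. *)
apply: (@le_trans _ _ ('N[gam]_p%:E[G] `^ p)).
  rewrite !poweR_Lnorm//; apply: ge0_le_integral_nonmeasurable => y.
    exact: poweR_ge0.
  rewrite /G !gee0_abs ?mule_ge0 ?lee_fin//.
  by apply: ge0_le_poweR => //; exact: ltW.
rewrite HK; last 2 first.
- exact: emeasurable_funM.
- by move=> y; rewrite /G mule_ge0// lee_fin.
(* The [p]-th power of the weight [e^(pot / p)] cancels the density [e^(- pot)], leaving an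
   unweighted integral for Schur's test. *)
have wE y : G y `^ p * (expR (- pot y))%:E = (C `^ p)%:E * I y `^ p.
  rewrite /G poweRM ?lee_fin// poweR_EFin muleAC -EFinM; congr (_%:E * _).
  rewrite /w powRM ?expR_ge0 ?(ltW C0)// -expRM -mulrA -expRD.
  by rewrite mulrAC mulVf// mul1r subrr expR0 mulr1.
under eq_integral do rewrite wE.
rewrite ge0_integralZl//; last 3 first.
- exact: (measurableT_comp (measurable_poweR _) mI).
- by move=> y _; exact: poweR_ge0.
- by rewrite lee_fin powR_ge0.
have mab : measurable_fun setT (abse \o (EFin \o f)).
  apply: measurableT_comp; first exact: abse_measurable.
  exact/measurable_EFinP.
rewrite poweRM ?Lnorm_ge0//; last by rewrite lee_fin mulr_ge0// ltW.
rewrite -[X in _ * X `^ p]Lnorm_abse HK; [|exact: mab|by move=> ?; exact: abse_ge0].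
rewrite muleCA poweR_EFin powRM ?(ltW C0) ?(ltW W0)// EFinM -muleA.
apply: lee_wpmul2l; first by rewrite lee_fin powR_ge0.
rewrite [leRHS]muleCA; apply: lee_wpmul2l; first by rewrite lee_fin ltW.
apply: (le_trans (schur_test p1 W0 (measurable_majorant k) M0 MW1 MW2 mg g0)).
apply: lee_wpmul2l; first by rewrite lee_fin powR_ge0.
rewrite le_eqVlt; apply/orP; left; apply/eqP; apply: eq_integral => u _.
rewrite /= -EFinM powRM ?expR_ge0// -expRM; congr (_ * expR _)%:E.
by rewrite mulNr mulrAC mulVf// mul1r.
Qed.

End weighted_schur.

Theorem proposition5p1 (R : realType) (n : nat) (Q B : 'M[R]_n)
    (n_ge1 : (1 <= n)%N) (Q_posdef : posdefmx Q) (B_stable : hurwitzmx B) :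
  exists A0 : R, forall A : R, 4 < A -> A0 <= A ->
  forall p : R, 1 < p ->
  exists C : R,
  forall (x : nat -> 'cV[R]_n) (r rt : nat -> 'cV[R]_n -> R),
  localization A x r rt ->
  forall rho : R, 1 <= rho ->
  forall f : 'cV[R]_n -> R, f \in Lfun (OUmeasure Q B +oo%E) p%:E ->
  (jump_quasinorm (OUmeasure Q B +oo%E) `]0%R, 1%R]
     (fun t => OUglob Q B r rt t f) rho p
   <= C%:E * 'N[OUmeasure Q B +oo%E]_(p%:E)[EFin \o f])%E.
Proof.
exists 0 => A A4 _ p p1.
have A0 : 0 < A by rewrite (lt_trans _ A4).
have p0 : 0 < p by rewrite (lt_trans ltr01).
have th01 : 0 < p^-1 < 1 by rewrite invr_gt0 p0 invf_lt1.
have [C [k [C0 k0 HC]]] := OUglob_variation n_ge1 Q_posdef B_stable A0 th01.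
have [W W0 [MW1 MW2]] := majorant_integrals n_ge1 k0.
(* Both factors are fixed before the localization, [rho] and [f] are introduced: this is the claimed
   uniformity. *)
exists (C * W) => c r rt loc rho rho1 f fL.
have [mf intf] := integrable_pot n_ge1 Q_posdef B_stable p1 fL.
apply: ge_ereal_sup => _ [la /= la0 <-].
apply: (Lnorm_majorant Q_posdef B_stable p1 W0 C0 MW1 MW2 mf) => y.
  by rewrite mule_ge0 ?poweR_ge0// lee_fin ltW.
apply: jump_number_le => //.
  apply: integral_ge0 => u _; rewrite lee_fin !mulr_ge0 ?expR_ge0// ?(ltW C0)//.
  by rewrite exprn_ge0// addr_ge0// enorm_ge0.
by move=> N t It incr; apply: (HC c r rt).
Qed.
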